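(* Let $s>\tfrac34$. Then the DFS operator $W\colon f\mapsto f\circ\phi$ maps $H^s(\mathrm{SO}(3))$ into $L^2(\mathbb T^3)$ and $$W=\mathcal F_{\mathbb T^3}\,\mathbf W\,\mathcal F_{\mathrm{SO}(3)}^{-1}\quad\text{on } H^s(\mathrm{SO}(3)),$$ where $\mathbf W\colon h^s(\mathcal J_\infty)\to\ell_2(\mathbb Z^3)$ is the bounded linear operator $$(\mathbf W\hat f)_{k,j,l}=\mathrm i^{k-l}\sum_{n=\max\{|k|,|l|,|j|\}}^{\infty}\sqrt{2n+1}\;d_n^{j,k}(0)\,d_n^{j,l}(0)\,\hat f_n^{-k,-l},\qquad (k,j,l)\in\mathbb Z^3.$$
   Context: $\mathbb T=\mathbb R/2\pi\mathbb Z$. $R_y(\cdot),R_z(\cdot)$ denote the rotations about the $y$- and $z$-axis, and $R(\alpha,\beta,\gamma)=R_z(\alpha)R_y(\beta)R_z(\gamma)$; every element of $\mathrm{SO}(3)$ has this form with $\alpha,\gamma\in\mathbb T$, $\beta\in[0,\pi]$. The Euler angle map is $\phi\colon\mathbb T^3\to\mathrm{SO}(3)$, $\phi(\alpha,\beta,\gamma)=R(\alpha,\beta,\gamma)$. Preimages under $\phi$ of Haar null sets are Lebesgue null sets, so $f\circ\phi$ is well defined almost everywhere for $f\in L^2(\mathrm{SO}(3))$. $L^2(\mathrm{SO}(3))$ is taken with respect to the Haar probability measure, $d\mu(R(\alpha,\beta,\gamma))=\frac1{8\pi^2}\sin\beta\,d\alpha\,d\beta\,d\gamma$. Wigner-d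 functions: for $n\in\mathbb N_0$, $k,l\in\mathbb Z$, $|k|,|l|\le n$, and $x\in[-1,1]$, $$d_n^{k,l}(x)=(-1)^{\nu}\binom{2n-s}{s+a}^{1/2}\binom{s+b}{b}^{-1/2}\Big(\frac{1-x}2\Big)^{a/2}\Big(\frac{1+x}2\Big)^{b/2}P_s^{a,b}(x),$$ where (in this formula only) $a=|k-l|$, $b=|k+l|$, $s=n-\max\{|k|,|l|\}$, $\nu=k+l$ if $k>l$ and $\nu=0$ otherwise, and $P_s^{a,b}$ is the Jacobi polynomial of degree $s$ with parameters $a,b$. Wigner-D functions: $D_n^{k,l}(R(\alpha,\beta,\gamma))=\sqrt{2n+1}\,e^{-\mathrm ik\alpha}\,d_n^{k,l}(\cos\beta)\,e^{-\mathrm il\gamma}$ for $\beta\in[0,\pi]$; they form an orthonormal basis of $L^2(\mathrm{SO}(3))$. $\mathcal J_\infty=\{(n,k,l): n\in\mathbb N_0,\ k,l=-n,\dots,n\}$. For $s\ge0$, $h^s(\mathcal J_\infty)$ is the Hilbert space of complex vectors $\hat f$ indexed by $\mathcal J_\infty$ with $\|\hat f\|_{h^s}^2=\sum_{(n,k,l)\in\mathcal J_\infty}(1+n(n+1))^s|\hat f_n^{k,l}|^2<\infty$, and $H^s(\mathrm{SO}(3))$ is the set of $f\in L^2(\mathrm{SO}(3))$ whose harmonic coefficients $\hat f_n^{k,l}=\langle f,D_n^{k,l}\rangle$ form an element of $h^s(\mathcal J_\infty)$. The Fourier transforms are $\mathcal F_{\mathrm{SO}(3)}\colon\ell_2(\mathcal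 J_\infty)\to L^2(\mathrm{SO}(3))$, $\hat f\mapsto\sum\hat f_n^{k,l}D_n^{k,l}$, and $\mathcal F_{\mathbb T^3}\colon\ell_2(\mathbb Z^3)\to L^2(\mathbb T^3)$, $\hat g\mapsto\sum\hat g_{k,j,l}e^{\mathrm i(k\alpha+j\beta+l\gamma)}$. *)

(* Defs.v *)
From HB Require Import structures.
From mathcomp Require Import all_boot all_order all_algebra.
From mathcomp Require Import finmap complex.
From mathcomp Require Import all_classical all_reals all_analysis.
From mathcomp Require Import measurable_realfun showcase.summability.
From mathcomp Require Import ring lra.

Set Implicit Arguments.
Unset Strict Implicit.
Unset Printing Implicit Defensive.

Import Order.TTheory GRing.Theory Num.Theory numFieldNormedType.Exports.

Local Open Scope classical_set_scope.
Local Open Scope ring_scope.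

Definition sqmod (R : realType) (z : R[i]) : R := Normc.normc z ^+ 2.

Definition expi (R : realType) (x : R) : R[i] := (cos x +i* sin x)%C.

Section L2.
Local Open Scope ereal_scope.
Context d (T : measurableType d) (R : realType).
Variables (mu : {measure set T -> \bar R}) (D : set T).
Implicit Types f g : T -> R[i].

Definition sqnormL2 f : \bar R := \int[mu]_(x in D) (sqmod (f x))%:E.

(* [f] represents an element of L^2(D, mu). *)
Definition L2 f : Prop :=
  [/\ measurable_fun D (fun x => complex.Re (f x)),
      measurable_fun D (fun x => complex.Im (f x)) &
      sqnormL2 f < +oo].

Definition Cintegral f : R[i] :=
  ((\int[mu]_(x in D) complex.Re (f x))%R
   +i* (\int[mu]_(x in D) complex.Im (f x))%R)%C.

Definition innerL2 f g : R[i] := Cintegral (fun x => f x * (g x)^*%C)%R.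

(* [g = \sum_i c i * e i], the (unordered) sum converging in L^2(D, mu). *)
Definition sumL2 (I : choiceType) (e : I -> T -> R[i]) (c : I -> R[i]) g :=
  sqnormL2 (fun x => g x - \sum_(i <- F) c i * e i x)%R
    @[F --> @totally I] --> (0 : \bar R).

End L2.

Section sequence_spaces.
Context (I : choiceType) (R : realType).
Implicit Types c : I -> R[i].

Definition sqnorm_wl2 (w : I -> R) c : \bar R :=
  (\esum_(i in [set: I]) (w i * sqmod (c i))%:E)%E.

Definition sqnorm_l2 c : \bar R := sqnorm_wl2 (fun=> 1) c.

Definition l2 c : Prop := (sqnorm_l2 c < +oo)%E.

End sequence_spaces.

Section rotations.
Variable R : realType.

Definition is_SO3 (A : 'M[R]_3) : bool := (A *m A^T == 1%:M) && (\det A == 1).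

Definition SO3 := {A : 'M[R]_3 | is_SO3 A}.

HB.instance Definition _ := Choice.on SO3.

Lemma is_SO3_1 : is_SO3 1%:M.
Proof. by rewrite /is_SO3 trmx1 mulmx1 det1 !eqxx. Qed.

HB.instance Definition _ :=
  isPointed.Build SO3 (exist _ (1%:M : 'M[R]_3) is_SO3_1).

Lemma is_SO3M (A B : 'M[R]_3) : is_SO3 A -> is_SO3 B -> is_SO3 (A *m B).
Proof.
move=> /andP[/eqP AA /eqP dA] /andP[/eqP BB /eqP dB].
rewrite /is_SO3 trmx_mul mulmxA -(mulmxA A) BB mulmx1 AA eqxx /=.
by rewrite det_mulmx dA dB mulr1.
Qed.

Definition SO3_open : set (set SO3) :=
  [set val @^-1` U | U in [set U : set 'M[R]_3 | open U]].

HB.instance Definition _ :=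
  Measurable.copy SO3 (g_sigma_algebraType SO3_open).

Definition mx3 (a b c d e f g h k : R) : 'M[R]_3 :=
  \matrix_(i, j) nth 0 (nth [::] [:: [:: a; b; c]; [:: d; e; f]; [:: g; h; k]] i) j.

Definition Rz (t : R) : 'M[R]_3 :=
  mx3 (cos t) (- sin t) 0
      (sin t) (cos t)   0
      0       0         1.

Definition Ry (t : R) : 'M[R]_3 :=
  mx3 (cos t)   0 (sin t)
      0         1 0
      (- sin t) 0 (cos t).

Lemma is_SO3_Rz t : is_SO3 (Rz t).
Proof.
have cs := cos2Dsin2 t.
apply/andP; split; apply/eqP.
  apply/matrixP => -[[|[|[|//]]] hi] [[|[|[|//]]] hj];
    rewrite !(mxE, big_ord_recl, big_ord0)/= ?mxE/=; try lra.
rewrite (expand_det_row _ ord0) !big_ord_recl big_ord0 /cofactor.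
rewrite !(expand_det_row _ ord0) !big_ord_recl !big_ord0 /cofactor !det_mx11.
by rewrite !mxE /= /bump /=; lra.
Qed.

Lemma is_SO3_Ry t : is_SO3 (Ry t).
Proof.
have cs := cos2Dsin2 t.
apply/andP; split; apply/eqP.
  apply/matrixP => -[[|[|[|//]]] hi] [[|[|[|//]]] hj];
    rewrite !(mxE, big_ord_recl, big_ord0)/= ?mxE/=; try lra.
rewrite (expand_det_row _ ord0) !big_ord_recl big_ord0 /cofactor.
rewrite !(expand_det_row _ ord0) !big_ord_recl !big_ord0 /cofactor !det_mx11.
by rewrite !mxE /= /bump /=; lra.
Qed.


Let M := measurableTypeR R.

Definition angles := (M * M * M)%type.

Definition euler (t : angles) : SO3 :=
  exist _ (Rz t.1.1 *m Ry t.1.2 *m Rz t.2)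
    (is_SO3M (is_SO3M (is_SO3_Rz _) (is_SO3_Ry _)) (is_SO3_Rz _)).

Lemma measurable_euler_entry (i j : 'I_3) :
  measurable_fun [set: angles] (fun t => \val (euler t) i j : R).
Proof.
have mm (A B : angles -> 'M[R]_3) :
    (forall i j, measurable_fun setT (fun t => A t i j : R)) ->
    (forall i j, measurable_fun setT (fun t => B t i j : R)) ->
    forall i j, measurable_fun setT (fun t => (A t *m B t) i j : R).
  move=> mA mB {}i {}j; under eq_fun do rewrite mxE.
  by apply: measurable_sum => k; apply: measurable_funM.
have mc (f : angles -> R) : measurable_fun setT f ->
    measurable_fun setT (fun t => cos (f t) : R).
  exact: (measurableT_comp (continuous_measurable_fun (@continuous_cos R))).
have ms (f : angles -> R) : measurable_fun setT f ->
    measurable_fun setT (fun t => sin (f t) : R).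
  exact: (measurableT_comp (continuous_measurable_fun (@continuous_sin R))).
have mz (f : angles -> R) : measurable_fun setT f ->
    forall i j, measurable_fun setT (fun t => Rz (f t) i j : R).
  move=> mf {}i {}j; under eq_fun do rewrite mxE.
  move: i j => [[|[|[|//]]] hi] [[|[|[|//]]] hj] /=; try exact: measurable_cst;
    try exact: mc; try exact: ms.
  by apply: measurable_funN; exact: ms.
have my (f : angles -> R) : measurable_fun setT f ->
    forall i j, measurable_fun setT (fun t => Ry (f t) i j : R).
  move=> mf {}i {}j; under eq_fun do rewrite mxE.
  move: i j => [[|[|[|//]]] hi] [[|[|[|//]]] hj] /=; try exact: measurable_cst;
    try exact: mc; try exact: ms.
  by apply: measurable_funN; exact: ms.
have m11 : measurable_fun [set: angles] (fun t => t.1.1 : R).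
  exact: (measurableT_comp measurable_fst).
have m12 : measurable_fun [set: angles] (fun t => t.1.2 : R).
  exact: (measurableT_comp measurable_snd).
apply: (mm) => [|{}i {}j]; last by apply: mz; exact: measurable_snd.
by apply: mm => {}i {}j; [exact: mz|exact: my].
Qed.

Lemma measurable_euler : measurable_fun [set: angles] euler.
Proof.
apply: (@measurability _ _ _ SO3 _ _ SO3_open) => // _ [_ [U Uo <-] <-].
pose box (pq : 'M[rat]_3 * 'M[rat]_3) : set 'M[R]_3 :=
  [set A | forall i j, ratr (pq.1 i j) < A i j < ratr (pq.2 i j)].
have -> : U = \bigcup_(pq in [set pq | box pq `<=` U]) box pq.
  apply/seteqP; split=> [A UA|A [pq pqU]]; last exact: pqU.
  have /nbhs_ballP[e /= e0 AeU] : nbhs A U by exact: open_nbhs_nbhs.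
  have lt1 i j : A i j - e < A i j by rewrite ltrBlDr ltrDl.
  have lt2 i j : A i j < A i j + e by rewrite ltrDl.
  pose p := \matrix_(i, j) projT1 (cid (rat_in_itvoo (lt1 i j))).
  pose q := \matrix_(i, j) projT1 (cid (rat_in_itvoo (lt2 i j))).
  have pP i j : A i j - e < ratr (p i j) < A i j.
    by rewrite mxE; case: cid => x /=; rewrite in_itv.
  have qP i j : A i j < ratr (q i j) < A i j + e.
    by rewrite mxE; case: cid => x /=; rewrite in_itv.
  exists (p, q) => /=; last first.
    by move=> i j /=; have /andP[_ ->] := pP i j; have /andP[->] := qP i j.
  move=> B pqB; apply: AeU; split=> // i j; rewrite /ball /= distrC ltr_distl.
  have /= /andP[pB Bq] := pqB i j.
  have /andP[pA _] := pP i j; have /andP[_ Aq] := qP i j.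
  by rewrite (lt_trans pA pB) (lt_trans Bq Aq).
rewrite setTI !preimage_bigcup bigcup_mkcond.
apply: countable_bigcupT_measurable => // pq; case: ifPn => // _.
rewrite [X in measurable X](_ : _ = \bigcap_(ij in [set: 'I_3 * 'I_3])
    ([set: angles] `&` (fun t => \val (euler t) ij.1 ij.2 : R) @^-1`
      `]ratr (pq.1 ij.1 ij.2), ratr (pq.2 ij.1 ij.2)[%classic)); last first.
  apply/seteqP; split=> [t /= H [i j] _ /=|t /= H i j].
    by split=> //=; rewrite in_itv /=; exact: H.
  by have [_] := H (i, j) I; rewrite /= in_itv.
apply: fin_bigcap_measurable => // -[i j] _ /=.
exact: measurable_euler_entry.
Qed.


Definition lebesgue3 : {measure set angles -> \bar R} :=
  ((@lebesgue_measure R \x @lebesgue_measure R) \x @lebesgue_measure R)%E.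

Definition euler_domain : set angles :=
  `[0, 2 * pi[%classic `*` `[0, pi]%classic `*` `[0, 2 * pi[%classic.

Definition euler_density (t : angles) : R := sin t.1.2 / (8 * pi ^+ 2).

(* The Haar probability measure of SO(3), through its density in Euler angles:
   the push-forward along [euler] of sin(beta) / (8 pi^2) dalpha dbeta dgamma. *)
Definition haar (A : set SO3) : \bar R :=
  (\int[lebesgue3]_(t in euler_domain `&` euler @^-1` A) (euler_density t)%:E)%E.

Let measurable_euler_domain : measurable euler_domain.
Proof. by apply: measurableX => //; exact: measurableX. Qed.

Let measurable_euler_density : measurable_fun [set: angles] euler_density.
Proof.
apply: measurable_funM => //.
apply: (measurableT_comp (continuous_measurable_fun (@continuous_sin R))).
exact: (measurableT_comp measurable_snd).
Qed.

Let euler_density_ge0 t : euler_domain t -> 0 <= euler_density t.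
Proof.
move=> [[_ +] _]; rewrite /= in_itv /= => /andP[b0 bpi].
apply: divr_ge0; last by rewrite mulr_ge0// sqr_ge0.
by apply: sin_ge0_pi; rewrite b0.
Qed.

Let haar0 : haar set0 = 0%E.
Proof. by rewrite /haar preimage_set0 setI0 integral_set0. Qed.

Let haar_ge0 A : (0 <= haar A)%E.
Proof.
by apply: integral_ge0 => t [Dt _]; rewrite lee_fin euler_density_ge0.
Qed.

Let haar_sigma_additive : semi_sigma_additive haar.
Proof.
move=> /= F mF tF mUF; rewrite /haar; apply: cvg_toP.
  apply: ereal_nondecreasing_is_cvgn => m n mn.
  by apply: lee_sum_nneg_natr => // k _ _; exact: haar_ge0.
rewrite preimage_bigcup setI_bigcupr ge0_integral_bigcup//=.
- move=> k; apply: measurableI => //.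
  by rewrite -[X in measurable X]setTI; exact: measurable_euler.
- by apply: measurable_funTS; apply/measurable_EFinP.
- by move=> t [k _ [Dt _]]; rewrite lee_fin euler_density_ge0.
- apply/trivIsetP => i j _ _ ij; rewrite setIACA setIid -preimage_setI.
  by move/trivIsetP : tF => ->//; rewrite preimage_set0 setI0.
Qed.

HB.instance Definition _ :=
  isMeasure.Build _ SO3 R haar haar0 haar_ge0 haar_sigma_additive.

End rotations.

Section wigner.
Variable R : realType.

(* P_s^(a,b)(x) =
   \sum_(m <= s) C(s+a, s-m) C(s+b, m) ((x-1)/2)^m ((x+1)/2)^(s-m). *)
Definition jacobi (a b s : nat) : {poly R} :=
  \sum_(m < s.+1) ('C(s + a, s - m) * 'C(s + b, m))%:R *:
    ((2^-1 *: ('X - 1)) ^+ m * (2^-1 *: ('X + 1)) ^+ (s - m)).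

(* Meaningful when |k|, |l| <= n, in which case no subtraction truncates. *)
Definition wignerd (n : nat) (k l : int) (x : R) : R :=
  let a := absz (k - l) in
  let b := absz (k + l) in
  let s := (n - maxn (absz k) (absz l))%N in
  let nu : int := if (l < k)%R then k + l else 0 in
  (-1) ^ nu * Num.sqrt 'C(2 * n - s, s + a)%:R / Num.sqrt 'C(s + b, b)%:R
  * ((1 - x) / 2) `^ (a%:R / 2) * ((1 + x) / 2) `^ (b%:R / 2)
  * (jacobi a b s).[x].

Definition euler_angles (A : SO3 R) : angles R :=
  xget (0, 0, 0) [set t | 0 <= t.1.2 <= pi /\ euler t = A].

Definition wignerD_angles (n : nat) (k l : int) (t : angles R) : R[i] :=
  ((Num.sqrt (2 * n + 1)%:R)%:C * expi (- (k%:~R * t.1.1))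
   * (wignerd n k l (cos t.1.2))%:C * expi (- (l%:~R * t.2)))%C.

(* Independent of the choice of Euler angles, see [wignerD_euler]. *)
Definition wignerD (n : nat) (k l : int) (A : SO3 R) : R[i] :=
  wignerD_angles n k l (euler_angles A).

Lemma expiD (x y : R) : expi (x + y) = expi x * expi y.
Proof. by rewrite /expi cosD sinD [sin x * cos y + _]addrC. Qed.

Lemma eq_expi_mul (x y : R) (k : int) : cos x = cos y -> sin x = sin y ->
  expi (k%:~R * x) = expi (k%:~R * y).
Proof.
move=> cxy sxy.
have en (n : nat) : expi (n%:R * x) = expi (n%:R * y).
  elim: n => [|n IHn]; first by rewrite !mul0r.
  by rewrite -addn1 natrD !mulrDl !expiD IHn !mul1r /expi cxy sxy.
case: k => n; first exact: en.
have [cn sn] : cos (n.+1%:R * x) = cos (n.+1%:R * y) /\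
    sin (n.+1%:R * x) = sin (n.+1%:R * y).
  by have [] := en n.+1.
by rewrite NegzE mulrNz !mulNr /expi !cosN !sinN cn sn.
Qed.

Let euler_entries (t : angles R) : let A := \val (euler t) in
  [/\ A ord_max ord_max = cos t.1.2,
      A ord_max 0 = - (sin t.1.2 * cos t.2) /\
      A ord_max 1 = sin t.1.2 * sin t.2,
      A 0 ord_max = sin t.1.2 * cos t.1.1 /\
      A 1 ord_max = sin t.1.2 * sin t.1.1 &
      A 0 0 = cos t.1.2 * (cos t.1.1 * cos t.2) - sin t.1.1 * sin t.2 /\
      A 1 0 = cos t.1.2 * (sin t.1.1 * cos t.2) + cos t.1.1 * sin t.2].
Proof.
by split; [|split..]; rewrite /= mxE !big_ord_recl big_ord0 /=
  ![(Rz _ *m Ry _) _ _]mxE !big_ord_recl !big_ord0 !mxE /=; ring.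
Qed.

Let wignerd1 n k l : k != l -> wignerd n k l 1 = 0.
Proof.
move=> kl; rewrite /wignerd subrr mul0r powR0 ?mulr0 ?mul0r//.
by rewrite mulf_neq0// pnatr_eq0 absz_eq0 subr_eq0.
Qed.

Let wignerdN1 n k l : k != - l -> wignerd n k l (-1) = 0.
Proof.
move=> kl; rewrite /wignerd subrr mul0r.
rewrite [X in _ * X * _](_ : _ = 0) ?mulr0 ?mul0r//.
by apply: powR0; rewrite mulf_neq0// pnatr_eq0 absz_eq0 addr_eq0.
Qed.

Lemma wignerD_euler n k l (t : angles R) : 0 <= t.1.2 <= pi ->
  wignerD n k l (euler t) = wignerD_angles n k l t.
Proof.
move=> bt; rewrite /wignerD.
have [] : [set u | 0 <= u.1.2 <= pi /\ euler u = euler t]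
    (euler_angles (euler t)) by apply: (xgetPex (0, 0, 0)); exists t.
move: (euler_angles _) => u bu /(congr1 val) eut.
have [] := euler_entries u; have [] := euler_entries t; rewrite /= in eut *.
rewrite {}eut.
move: t u bt bu => [[a b] c] [[a' b'] c'] /= bt bu.
move=> -> [-> ->] [-> ->] [-> ->] cb [sc ss] [sc' ss'] [e00 e10].
have bb : b' = b by apply: cos_inj; rewrite ?in_itv.
move: sc ss sc' ss' e00 e10 {cb}; rewrite {}bb => sc ss sc' ss' e00 e10.
rewrite /wignerD_angles /= -!mulrN.
have [sb0|sb0] := eqVneq (sin b) 0; last first.
  have cc : cos c = cos c' by apply: (mulfI sb0); apply: oppr_inj.
  have cs : sin c = sin c' by apply: (mulfI sb0).
  have ac : cos a = cos a' by apply: (mulfI sb0).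
  have as' : sin a = sin a' by apply: (mulfI sb0).
  by congr (_ * _ * _ * _); apply: eq_expi_mul; rewrite ?cosN ?sinN // ?cs ?as'.
have pr (x y z w : R[i]) : x * y * z * w = x * z * (y * w) by ring.
have : cos b ^+ 2 = 1 by rewrite -(cos2Dsin2 b) sb0 expr0n addr0.
move/eqP; rewrite sqrf_eq1 => /orP[/eqP cb|/eqP cb]; rewrite cb in e00 e10 *.
  have [<-|kl] := eqVneq k l; last first.
    by rewrite wignerd1// rmorph0 !mulr0 !mul0r.
  rewrite !pr -!expiD.
  rewrite -!mulrDr; congr (_ * _ * _).
  by apply: eq_expi_mul; rewrite -!opprD ?cosN ?sinN ?cosD ?sinD; lra.
have [kl|kl] := eqVneq k (- l); last first.
  by rewrite wignerdN1// rmorph0 !mulr0 !mul0r.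
rewrite kl !pr !mulrNz !mulNr -!mulrN !opprK -!expiD -!mulrDr; congr (_ * _ * _).
by apply: eq_expi_mul; rewrite ?cosB ?sinB; lra.
Qed.

End wigner.

Definition Jinf_pred (p : nat * int * int) : bool :=
  (absz p.1.2 <= p.1.1)%N && (absz p.2 <= p.1.1)%N.

Definition Jinf := {p : nat * int * int | Jinf_pred p}.

HB.instance Definition _ := Choice.on Jinf.

Section fourier.
Variable R : realType.
Implicit Types (s : R) (fhat : Jinf -> R[i]) (f : SO3 R -> R[i]).

Definition sqnorm_hs s fhat : \bar R :=
  sqnorm_wl2 (fun p : Jinf =>
    let n := (\val p).1.1 in (1 + n * (n + 1))%:R `^ s) fhat.

Definition hs s fhat : Prop := (sqnorm_hs s fhat < +oo)%E.

Definition basisD (p : Jinf) : SO3 R -> R[i] :=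
  wignerD (\val p).1.1 (\val p).1.2 (\val p).2.

Definition L2_SO3 f : Prop := L2 (@haar R) setT f.

Definition harmonic_coef f (p : Jinf) : R[i] :=
  innerL2 (@haar R) setT f (basisD p).

Definition Hs s f : Prop := L2_SO3 f /\ hs s (harmonic_coef f).

(* The graph of the Fourier transform of SO(3): f = \sum_p fhat p * D_p. *)
Definition fourier_SO3 fhat f : Prop :=
  [/\ l2 fhat, L2_SO3 f & sumL2 (@haar R) setT basisD fhat f].

(* Functions on the torus are 2pi-periodic functions of the three angles; the
   Lebesgue measure of a period cell is not normalized, which affects neither
   membership in L^2 nor convergence. *)
Definition periodic3 (g : angles R -> R[i]) : Prop :=
  forall a b c : R, [/\ g (a + 2 * pi, b, c) = g (a, b, c),
                        g (a, b + 2 * pi, c) = g (a, b, c) &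
                        g (a, b, c + 2 * pi) = g (a, b, c)].

Definition torus_cell : set (angles R) :=
  `[0, 2 * pi[%classic `*` `[0, 2 * pi[%classic `*` `[0, 2 * pi[%classic.

Definition L2_T3 (g : angles R -> R[i]) : Prop :=
  periodic3 g /\ L2 (@lebesgue3 R) torus_cell g.

Definition trig3 (q : int * int * int) (t : angles R) : R[i] :=
  expi (q.1.1%:~R * t.1.1 + q.1.2%:~R * t.1.2 + q.2%:~R * t.2).

Definition fourier_T3 (ghat : int * int * int -> R[i]) g : Prop :=
  [/\ l2 ghat, L2_T3 g & sumL2 (@lebesgue3 R) torus_cell trig3 ghat g].

Definition DFS f : angles R -> R[i] := f \o @euler R.

(* fhat_n^(k,l), extended by 0 outside of the index set. *)
Definition coef0 fhat (n : nat) (k l : int) : R[i] :=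
  oapp fhat 0 (insub (n, k, l)).

Definition DFS_partial_sum fhat (q : int * int * int) (m : nat) : R[i]^o :=
  let: (k, j, l) := q in
  \sum_(maxn (maxn (absz k) (absz l)) (absz j) <= n < m)
    (Num.sqrt (2 * n + 1)%:R * wignerd n j k 0 * wignerd n j l (0 : R))%:C%C
    * coef0 fhat n (- k) (- l).

Definition DFS_hat fhat (q : int * int * int) : R[i] :=
  let: (k, j, l) := q in
  'i%C ^ (k - l) * limn (DFS_partial_sum fhat (k, j, l)).

End fourier.

(* Main.v *)
Require Import Defs.
From HB Require Import structures.
From mathcomp Require Import all_boot all_order all_algebra.
From mathcomp Require Import finmap complex.
From mathcomp Require Import all_classical all_reals all_analysis.
From mathcomp Require Import measurable_realfun showcase.summability.
From mathcomp Require Import ring lra zify.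

Import Order.TTheory GRing.Theory Num.Theory numFieldNormedType.Exports.

Local Open Scope classical_set_scope.
Local Open Scope ring_scope.

Set Implicit Arguments.
Unset Strict Implicit.
Unset Printing Implicit Defensive.

(** Write [D_n^{k,l}(R(a,b,c)) = e^{-ika} w(b) e^{-ilc}], where [w] extends to
    all real [b] as a homogeneous polynomial in [cos (b/2)] and [sin (b/2)].
    Diagonalizing rotations in the basis [cos +- i sin] gives the finite
    expansion [w(b) = i^{k-l} sum_j d_n^{j,k}(0) d_n^{j,l}(0) e^{ijb}] (up to
    signs of the indices), hence the formula of the operator on each basis
    function.

    Boundedness: orthonormality of the [D_n^{k,l}] controls a trigonometric
    polynomial of degree [< N] in the weight [|sin b|], and removing that weight
    costs a factor [O(N)] in the square of the norm; summing dyadic blocks in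
    [n] by Cauchy-Schwarz converges when [s > 1/2].

    The span of the [D_n^{k,l}] is an algebra containing the matrix entries.  The
    bounded functions it approximates in L^2 are closed under bounded pointwise
    limits, so they include all indicators of Borel sets: the system is complete.

    Finally [f o phi] is compared with the truncations of the Fourier series of
    [f]: away from [sin b = 0], convergence in L^2(SO(3)) passes to the torus,
    and the tails are bounded on the whole torus by the operator bound. *)

(** * The finite Fourier expansion of the Wigner-d functions *)

(** A Wigner-d function is a matrix entry of the rotation by the half angle acting on binary forms
    of degree [2 * n]. In the eigenbasis of that rotation only the change of basis is left; its
    entries are Krawtchouk values, and these are, up to normalisation, the Wigner-d functions at 0.

    The analytic obstacle is that the Euler map turns Haar measure into the weight [|sin b|], which
    vanishes at [b = 0] and [b = pi]. The loss [O(N)] comes from the pointwise bound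
    [1 <= sqrt M |sin| + cos ^ (2 M)]: the mean of [cos ^ (2 M)] is of order [1 / sqrt M], and the
    squared modulus of a trigonometric polynomial with [P] frequencies is at most [P] times its
    mean. Taking [M] of order [P ^ 2] lets the cosine term be absorbed on the left and leaves the
    factor [sqrt M], of order [P].

    For completeness, the sign function is a pointwise limit of iterates of one cubic polynomial, so
    the indicators of the sets [0 < u] are reached from inside the algebra, without a uniform
    density theorem. *)

Section bihomogeneous.
Context {S : comNzRingType}.
Implicit Types a b c d x y : S.

(** Matrix entry, in the monomial basis, of a 2x2 matrix acting by substitution on binary forms of
    degree [p + q], with the first variable set to 1. For a rotation and suitable weights these
    entries become the Wigner-d functions. *)
Definition bicoef a b c d (p q v : nat) : S :=
  ((a%:P + b *: 'X) ^+ p * (c%:P + d *: 'X) ^+ q)`_v.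

Lemma coef_linX a b p i :
  ((a%:P + b *: 'X) ^+ p)`_i = b ^+ i * a ^+ (p - i) *+ 'C(p, i).
Proof.
rewrite exprDn coef_sum.
have [ip|pi] := leqP i p; last first.
  rewrite bin_small// mulr0n big1// => j _.
  rewrite coefMn -polyC_exp coefCM exprZn coefZ coefXn [i == j]eqn_leq.
  by rewrite [(i <= j)%N]leqNgt (leq_trans (ltn_ord j) pi)/= !mulr0 mul0rn.
rewrite (bigD1 (Ordinal (n := p.+1) ip))//= big1 ?addr0 => [|j ji].
  by rewrite coefMn -polyC_exp coefCM exprZn coefZ coefXn eqxx mulr1 mulrC.
rewrite coefMn -polyC_exp coefCM exprZn coefZ coefXn.
have /negPf -> : i != j by apply: contra_neq ji => ij; apply: val_inj.
by rewrite !mulr0 mul0rn.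
Qed.

(** Bounding [r] by both [v] and [q] makes the index set symmetric in [v] and [q], the two numbers
    exchanged by [bicoef_tr]. *)
Lemma bicoefE a b c d p q v : bicoef a b c d p q v =
  \sum_(r < (p + q).+1 | (r <= v)%N && (r <= q)%N)
    (a ^+ (p - (v - r)) * b ^+ (v - r) * c ^+ (q - r) * d ^+ r)
      *+ ('C(p, v - r) * 'C(q, r)).
Proof.
pose F r := (a ^+ (p - (v - r)) * b ^+ (v - r) * c ^+ (q - r) * d ^+ r)
      *+ ('C(p, v - r) * 'C(q, r)).
rewrite /bicoef coefMr.
transitivity (\sum_(0 <= r < v.+1) F r).
  rewrite big_mkord; apply: eq_bigr => r _.
  rewrite !coef_linX /F mulrnAl mulrnAr -mulrnA mulnC.
  by congr (_ *+ _); move: (a ^+ _) (b ^+ _) (c ^+ _) (d ^+ _) => *; ring.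
rewrite -(big_mkord (fun r => (r <= v)%N && (r <= q)%N) F).
rewrite [LHS](big_nat_widen 0 _ (v + (p + q)).+1) ?ltnS ?leq_addr//.
rewrite [RHS](big_nat_widen 0 _ (v + (p + q)).+1) ?ltnS ?leq_addl//.
rewrite [LHS]big_mkcond [RHS]big_mkcond.
 apply: eq_bigr => r _ /=.
rewrite !ltnS; case: (leqP r v) => //= rv; case: (leqP r q) => //= rq.
  by rewrite (leq_trans rq (leq_addl _ _)).
by rewrite /F (bin_small rq) muln0 mulr0n.
Qed.

(** Transposing the 2x2 matrix transposes its action on forms, up to the factorial weights of an
    invariant inner product. The identity holds term by term in [bicoefE]. *)
Lemma bicoef_tr a b c d p q u v : (u + v = p + q)%N ->
  bicoef a b c d p q v *+ (u`! * v`!) = bicoef a c b d u v q *+ (p`! * q`!).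
Proof.
move=> uv; rewrite !bicoefE uv -!sumrMnl.
apply: eq_big => [r|r /andP[rv rq]]; first by rewrite andbC.
rewrite -!mulrnA.
have [vrp|pvr] := leqP (v - r) p; last first.
  have -> : 'C(p, v - r) = 0%N by rewrite bin_small.
  have -> : 'C(u, q - r) = 0%N by rewrite bin_small//; lia.
  by rewrite !mul0n !mulr0n.
have E : (q - r <= u)%N by lia.
have -> : (u - (q - r) = p - (v - r))%N by lia.
congr (_ *+ _); first by move: (a ^+ _) (b ^+ _) (c ^+ _) (d ^+ _) => *; ring.
have := bin_fact vrp; have := bin_fact E; have := bin_fact rv; have := bin_fact rq.
have -> : (u - (q - r) = p - (v - r))%N by lia.
move=> <- <- <- <-.
move: (_`!) (_`!) (_`!) (_`!) 'C(_, _) 'C(_, _) 'C(_, _) 'C(_, _) => *; ring.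
Qed.

Lemma bicoefC a b c d p q v : bicoef a b c d p q v = bicoef c d a b q p v.
Proof. by rewrite /bicoef mulrC. Qed.

Lemma bicoef_oppy a b c d p q v :
  bicoef a (- b) c (- d) p q v = (-1) ^+ v * bicoef a b c d p q v.
Proof.
rewrite !bicoefE mulr_sumr; apply: eq_bigr => r /andP[rv rq].
rewrite mulrnAr; congr (_ *+ _).
rewrite [(- b) ^+ _]exprNn [(- d) ^+ _]exprNn -[in (-1) ^+ v](subnK rv) exprD.
by move: (a ^+ _) (b ^+ _) (c ^+ _) (d ^+ _) ((-1) ^+ _) ((-1) ^+ _) => *; ring.
Qed.

Lemma bicoefZ2 t a b c d p q v :
  bicoef a b (t * c) (t * d) p q v = t ^+ q * bicoef a b c d p q v.
Proof.
rewrite /bicoef.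
have -> : (t * c)%:P + (t * d) *: 'X = t%:P * (c%:P + d *: 'X).
  by rewrite mulrDr -polyCM -scalerA -mul_polyC.
by rewrite exprMn -polyC_exp mulrCA coefCM.
Qed.

Lemma bicoefZy t a b c d p q v :
  bicoef a (t * b) c (t * d) p q v = t ^+ v * bicoef a b c d p q v.
Proof.
rewrite !bicoefE mulr_sumr; apply: eq_bigr => r /andP[rv rq].
rewrite mulrnAr; congr (_ *+ _).
rewrite ![(t * _) ^+ _]exprMn -[in t ^+ v](subnK rv) exprD.
by move: (a ^+ _) (b ^+ _) (c ^+ _) (d ^+ _) (t ^+ _) (t ^+ _) => *; ring.
Qed.

Lemma bicoefZ1 t a b c d p q v :
  bicoef (t * a) (t * b) c d p q v = t ^+ p * bicoef a b c d p q v.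
Proof. by rewrite bicoefC bicoefZ2 bicoefC. Qed.

(** The homogeneous form of the definition: both variables may be replaced by arbitrary ring
    elements, in particular by the polynomials [xi] and [eta] of [bicoef_rotation]. *)
Lemma bicoef_eval a b c d p q x y :
  \sum_(v < (p + q).+1) bicoef a b c d p q v * (x ^+ (p + q - v) * y ^+ v) =
  (a * x + b * y) ^+ p * (c * x + d * y) ^+ q.
Proof.
(* [h N P] homogenises [P] in degree [N]. Multiplying [P] by a linear factor multiplies it by the
   value of that factor, provided the degree of [P] is at most [N]. *)
pose h N (P : {poly S}) := \sum_(v < N.+1) P`_v * (x ^+ (N - v) * y ^+ v).
have hS N (P : {poly S}) (e f : S) : (size P <= N.+1)%N ->
    h N.+1 (P * (e%:P + f *: 'X)) = h N P * (e * x + f * y).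
  move=> sP; rewrite /h.
  under eq_bigr do rewrite mulrDr -scalerAr coefD coefZ coefMC coefMX mulrDl.
  rewrite big_split /= big_ord_recr /= nth_default// !mul0r addr0.
  rewrite [X in _ + X]big_ord_recl /= mulr0 mul0r add0r mulrDr !mulr_suml.
  congr (_ + _); apply: eq_bigr => -[v /= vN] _.
    by rewrite subSn// exprS; ring.
  by rewrite /bump /= add1n subSS exprS; ring.
have sz (e f : S) : (size (e%:P + f *: 'X)%R <= 2)%N.
  apply: (leq_trans (size_polyD _ _)); rewrite geq_max.
  rewrite (leq_trans (size_polyC_leq1 _))// (leq_trans (size_scale_leq _ _))//.
  by rewrite size_polyX.
have szm N (P : {poly S}) (e f : S) : (size P <= N.+1)%N -> (size (P * (e%:P + f *: 'X))%R <= N.+2)%N.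
  move=> sP; apply: (leq_trans (size_polyMleq _ _)); have := sz e f; lia.
suff H : (size ((a%:P + b *: 'X) ^+ p * (c%:P + d *: 'X) ^+ q)%R <= (p + q).+1)%N /\
  h (p + q)%N ((a%:P + b *: 'X) ^+ p * (c%:P + d *: 'X) ^+ q) = (a * x + b * y) ^+ p * (c * x + d * y) ^+ q.
  by case: H.
elim: q => [|q [IHs IH]].
  rewrite addn0 !expr0 !mulr1; elim: p => [|p [IHs IH]].
    by rewrite expr0 size_poly1 /h big_ord1 !mulr1 coef1 expr0.
  by rewrite exprSr szm// hS// IH exprSr.
by rewrite exprSr mulrA addnS szm// hS// IH exprSr mulrA.
Qed.

End bihomogeneous.

Lemma rmorph_bicoef (S S' : comNzRingType) (f : {rmorphism S -> S'}) a b c d p q v :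
  f (bicoef a b c d p q v) = bicoef (f a) (f b) (f c) (f d) p q v.
Proof.
rewrite /bicoef -coef_map rmorphM !rmorphXn !rmorphD /= !map_polyC.
by rewrite !linearZ /= !map_polyX.
Qed.

(** After [bicoef_tr] on both sides only an exchange of the two factors remains; cancelling the
    factorials is what requires [numDomainType]. *)
Lemma bicoef_flip (S : numDomainType) (a b c d : S) p q u v : (u + v = p + q)%N ->
  bicoef a b c d p q v = bicoef b a d c p q u.
Proof.
move=> uv.
have nz x y : (x`! * y`!)%:R != 0 :> S by rewrite pnatr_eq0 -lt0n muln_gt0 !fact_gt0.
have vu : (v + u = p + q)%N by rewrite addnC.
apply: (mulIf (nz u v)); rewrite !mulr_natr (bicoef_tr a b c d uv).
by rewrite [(u`! * _)%N]mulnC (bicoef_tr b a d c vu) bicoefC.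
Qed.

(** Values of Krawtchouk polynomials: the change of basis from the monomials in [x + y, x - y] to
    those in [x, y]. *)
Definition kraw (S : comNzRingType) (p q v : nat) : S := bicoef 1 1 1 (-1) p q v.

(* The substitution [xi = 1 + 'i X], [eta = 1 - 'i X] diagonalises the rotation
   [(1, X) |-> (c + s X, c X - s)]. *)
Lemma bicoef_rotation (S : comNzRingType) (i c s e e' : S) (p q v : nat) :
    i ^+ 2 = -1 -> c *+ 2 = e + e' -> (i * s) *+ 2 = e - e' ->
  2 ^+ (p + q) * i ^+ q * bicoef c s (- s) c p q v =
  \sum_(w < (p + q).+1) kraw S p q w * (e' ^+ (p + q - w) * e ^+ w)
     * (i ^+ v * kraw S (p + q - w) w v).
Proof.
move=> i2 ce se.
(* The prefactor is absorbed into the two linear forms, so that no division by 2 occurs in the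
   ring. *)
have -> : 2 ^+ (p + q) * i ^+ q * bicoef c s (- s) c p q v =
    bicoef (2 * c) (2 * s) (2 * i * - s) (2 * i * c) p q v.
  rewrite bicoefZ1 -[2 * i * c]mulrA -[2 * i * _]mulrA bicoefZ2 bicoefZ2 exprD; ring.
rewrite {1}/bicoef.
set xi := e' *: (1%:P + i *: 'X); set eta := e *: (1%:P + (- i) *: 'X).
have -> : (2 * c)%:P + (2 * s) *: 'X = 1%:P * xi + 1%:P * eta.
  rewrite mul1r /xi /eta mul1r; apply/polyP => j.
  rewrite !(coefD, coefZ, coefC, coefX, coefN).
  have s2 : 2 * s = i * e' - i * e.
    by rewrite -mulrBr -opprB -se -mulr_natl; ring: i2.
  have -> : 2 * c = e + e' by rewrite mulr_natl ce.
  by rewrite s2; case: j => [|[|j]] /=; ring.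
have -> : (2 * i * - s)%:P + (2 * i * c) *: 'X = 1%:P * xi + (-1)%:P * eta.
  rewrite mul1r /xi /eta; apply/polyP => j.
  rewrite [RHS]coefD coefCM !(coefD, coefZ, coefC, coefX).
  have -> : 2 * i * c = i * e + i * e'.
    by rewrite mulrAC mulrC [2 * c]mulr_natl ce mulrDr.
  have -> : 2 * i * - s = e' - e.
    by rewrite mulrN -mulrA [2 * _]mulr_natl se opprB.
  by case: j => [|[|j]] /=; ring.
have k1 w : bicoef 1%:P 1%:P 1%:P (-1)%:P p q w = (kraw S p q w)%:P :> {poly S}.
  by rewrite (rmorph_bicoef polyC).
rewrite -bicoef_eval coef_sum; apply: eq_bigr => w _.
rewrite k1 coefCM -mulrA; congr (_ * _).
rewrite /xi /eta !exprZn -scalerAl -scalerAr !coefZ mulrA; congr (_ * _).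
have -> : ((1%:P + i *: 'X) ^+ (p + q - w) * (1%:P + - i *: 'X) ^+ w)`_v =
   bicoef 1 (i * 1) 1 (i * -1) (p + q - w) w v by rewrite mulr1 mulrN1.
by rewrite bicoefZy.
Qed.

(** * Wigner-d functions as matrix entries of half-angle rotations *)

Section rotation_coefficients.
Variable R : realType.
Implicit Types (n : nat) (k l : int) (c s : R).

(** The monomial of weight [k] is [x ^ (n + k) * y ^ (n - k)]; [absz] only converts the exponent to
    [nat], for [|k| <= n]. *)
Definition updeg n k : nat := absz (n%:Z + k).

Lemma updegD n k : (absz k <= n)%N -> (updeg n k + updeg n (- k) = 2 * n)%N.
Proof. rewrite /updeg; lia. Qed.

(** Up to a common factor, the squared norm of the monomial of weight [k] for the rotation-invariant
    inner product on forms. *)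
Definition rotw n k : R := ((updeg n k)`! * (updeg n (- k))`!)%:R.

Lemma rotw_gt0 n k : 0 < rotw n k.
Proof. by rewrite ltr0n muln_gt0 !fact_gt0. Qed.

Lemma rotwN n k : rotw n (- k) = rotw n k.
Proof. by rewrite /rotw opprK mulnC. Qed.

Definition rotcoef n k l c s : R :=
  Num.sqrt (rotw n k) / Num.sqrt (rotw n l)
  * bicoef c s (- s) c (updeg n l) (updeg n (- l)) (updeg n (- k)).

(** The Wigner-d formula with integer powers of [c = cos (b / 2)] and [s = sin (b / 2)] in place of
    the real powers. It makes sense for [c] and [s] of any sign, hence for every angle [b]. *)
Definition halfd n k l c s : R :=
  let a := absz (k - l) in
  let b := absz (k + l) in
  let r := (n - maxn (absz k) (absz l))%N in
  let nu : int := if (l < k)%R then k + l else 0 in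
  (-1) ^ nu * Num.sqrt 'C(2 * n - r, r + a)%:R / Num.sqrt 'C(r + b, b)%:R
  * s ^+ a * c ^+ b * (jacobi R a b r).[c ^+ 2 - s ^+ 2].

Lemma powR_half (x : R) m : 0 <= x -> (x ^+ 2) `^ (m%:R / 2) = x ^+ m.
Proof.
by move=> x0; rewrite -powR_mulrn// -powRrM mulrCA mulfV// mulr1 powR_mulrn.
Qed.

Lemma wignerd_half n k l c s : 0 <= c -> 0 <= s -> c ^+ 2 + s ^+ 2 = 1 ->
  wignerd n k l (c ^+ 2 - s ^+ 2) = halfd n k l c s.
Proof.
move=> c0 s0 cs; rewrite /wignerd /halfd.
have -> : (1 - (c ^+ 2 - s ^+ 2)) / 2 = s ^+ 2 by move: (c ^+ 2) (s ^+ 2) cs => *; lra.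
have -> : (1 + (c ^+ 2 - s ^+ 2)) / 2 = c ^+ 2 by move: (c ^+ 2) (s ^+ 2) cs => *; lra.
by rewrite !powR_half.
Qed.

Lemma exprN1z (z : int) : (-1 : R) ^ z = (-1) ^+ absz z.
Proof.
case: z => m //; rewrite -[LHS]/(((-1) ^+ m.+1)^-1) -exprVn.
by rewrite (_ : (-1)^-1 = -1 :> R) // invrN invr1.
Qed.

Lemma halfdC n k l c s : halfd n l k c s = (-1) ^+ absz (k + l) * halfd n k l c s.
Proof.
rewrite /halfd (addrC l k) (maxnC (absz l)) -(opprB k l) abszN.
rewrite !mulrA; do 5 congr (_ * _).
case: (ltgtP k l) => [kl|lk|->]; rewrite !exprN1z ?mulr1//.
  by rewrite -exprD addnn -mul2n exprM sqrrN !expr1n.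
have -> : absz (l + l) = (2 * absz l)%N by lia.
by rewrite exprM sqrrN !expr1n.
Qed.

Lemma halfdN n k l c s :
  halfd n (- k) (- l) c s = (-1) ^+ absz (k + l) * halfd n k l c s.
Proof.
rewrite -halfdC /halfd ltrN2 !abszN -!opprD !abszN.
have -> : absz (l - k) = absz (k - l) by lia.
rewrite (addrC l k) (maxnC (absz l)).
by do 5 congr (_ * _); case: ltP => //; rewrite !exprN1z abszN.
Qed.

Lemma jacobi_half a b r c s : c ^+ 2 + s ^+ 2 = 1 ->
  (jacobi R a b r).[c ^+ 2 - s ^+ 2] =
  \sum_(m < r.+1) ('C(r + a, r - m) * 'C(r + b, m))%:R
     * ((- s ^+ 2) ^+ m * (c ^+ 2) ^+ (r - m)).
Proof.
move=> cs; rewrite /jacobi horner_sum; apply: eq_bigr => m _.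
rewrite hornerZ hornerM !horner_exp !hornerZ !hornerD hornerN hornerX !hornerC.
have -> : 2^-1 * (c ^+ 2 - s ^+ 2 - 1) = - s ^+ 2 by move: (c ^+ 2) (s ^+ 2) cs => *; lra.
by have -> : 2^-1 * (c ^+ 2 - s ^+ 2 + 1) = c ^+ 2 by move: (c ^+ 2) (s ^+ 2) cs => *; lra.
Qed.

(** Expanding both powers gives the defining sum of the Jacobi polynomial, with [c ^ 2] and
    [- s ^ 2] for [(x + 1) / 2] and [(x - 1) / 2]; the surplus exponents [a] and [b] factor out. *)
Lemma bicoef_jacobi a b v c s : c ^+ 2 + s ^+ 2 = 1 ->
  bicoef c s (- s) c (v + b) (v + a) v =
  (-1) ^+ a * s ^+ a * c ^+ b * (jacobi R a b v).[c ^+ 2 - s ^+ 2].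
Proof.
move=> cs; rewrite jacobi_half// /bicoef coefM mulr_sumr; apply: eq_bigr => m _.
rewrite !coef_linX [LHS]mulrnAl [X in X *+ _ = _]mulrnAr -mulrnA.
rewrite -[LHS]mulr_natl [RHS]mulrCA; congr (_ * _).
have mv : (m <= v)%N by rewrite -ltnS.
have -> : (v + b - m = b + (v - m))%N by lia.
have -> : (v + a - (v - m) = a + m)%N by lia.
rewrite [(- s) ^+ _]exprNn [(- s ^+ 2) ^+ _]exprNn -!exprM !mul2n -!addnn !exprD.
by move: (s ^+ _) (s ^+ _) (c ^+ _) (c ^+ _) ((-1) ^+ _) ((-1) ^+ _) => *; ring.
Qed.

(** In this region the Jacobi degree is [n - k], which is also the index of the extracted
    coefficient. So [bicoef_jacobi] applies directly, and only the binomial normalisation has to be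
    matched with the weights [rotw]. *)
Lemma halfd_rotcoef_ge n k l c s : c ^+ 2 + s ^+ 2 = 1 ->
  (absz k <= n)%N -> (absz l <= absz k)%N -> 0 <= k ->
  halfd n k l c s = rotcoef n k l c s.
Proof.
move=> cs kn lk k0.
pose a := absz (k - l); pose b := absz (k + l); pose v := (n - absz k)%N.
have ul : updeg n l = (v + b)%N by rewrite /updeg; lia.
have vl : updeg n (- l) = (v + a)%N by rewrite /updeg; lia.
have uk : updeg n k = (v + a + b)%N by rewrite /updeg; lia.
have vk : updeg n (- k) = v by rewrite /updeg; lia.
rewrite /rotcoef /rotw ul vl uk vk bicoef_jacobi// /halfd.
have -> : maxn (absz k) (absz l) = absz k by apply/maxn_idPl.
rewrite -/a -/b -/v !mulrA; do 3 congr (_ * _).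
have -> : (2 * n - v = v + a + b)%N by lia.
have -> : (-1) ^ (if l < k then k + l else 0) = (-1) ^+ a :> R.
  case: ltP => kl; rewrite exprN1z -signr_odd -[RHS]signr_odd; congr (_ ^+ _);
    rewrite /a; lia.
rewrite -mulrA mulrC; congr (_ * _).
apply/eqP; rewrite eqr_div ?sqrtr_eq0 -?ltNge ?ltr0n ?bin_gt0 ?leq_addl// -?sqrtrM ?ler0n//; last first.
  by rewrite muln_gt0 !fact_gt0.
apply/eqP; congr Num.sqrt; rewrite -!natrM; congr _%:R.
have := @bin_fact (v + a + b) (v + a) (leq_addr _ _).
have := @bin_fact (v + b) b (leq_addl _ _).
have -> : (v + a + b - (v + a) = b)%N by lia.
have -> : (v + b - b = v)%N by lia.
move=> <- <-.
by move: (v`!) (b`!) ((v + a)`!) 'C(_, _) 'C(_, _) => *; ring.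
Qed.

(** [bicoef_tr] exchanges the indices and replaces the rotation by its inverse, that is [s] by
    [- s]; undoing this costs the sign. *)
Lemma rotcoefC n k l c s : (absz k <= n)%N -> (absz l <= n)%N ->
  rotcoef n l k c s = (-1) ^+ absz (k + l) * rotcoef n k l c s.
Proof.
move=> kn ln; rewrite /rotcoef.
have E : (updeg n k + updeg n (- k) = updeg n l + updeg n (- l))%N.
  by rewrite !updegD.
have := bicoef_tr c (- s) s c E.
have sg : (-1) ^+ absz (k + l) = (-1) ^+ updeg n (- l) * (-1) ^+ updeg n (- k) :> R.
  rewrite -exprD -signr_odd -[RHS]signr_odd /updeg; congr (_ ^+ _); lia.
have -> : bicoef c (- s) s c (updeg n l) (updeg n (- l)) (updeg n (- k)) =
   (-1) ^+ absz (k + l) * bicoef c s (- s) c (updeg n l) (updeg n (- l)) (updeg n (- k)).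
  rewrite sg -mulrA -bicoef_oppy -bicoefZ2.
  by congr bicoef; rewrite mulN1r ?opprK.
rewrite -[_ *+ _]mulr_natr -[X in _ = X -> _]mulr_natr -/(rotw n k) -/(rotw n l) => E'.
have r0 m : Num.sqrt (rotw n m) != 0 by rewrite sqrtr_eq0 -ltNge rotw_gt0.
have rE m : rotw n m = Num.sqrt (rotw n m) * Num.sqrt (rotw n m).
  by rewrite -expr2 sqr_sqrtr// ltW// rotw_gt0.
rewrite (rE k) (rE l) in E'; move: E'; have := r0 k; have := r0 l.
move: (Num.sqrt (rotw n k)) (Num.sqrt (rotw n l)) => x y y0 x0.
move: (bicoef _ _ _ _ _ _ _) (bicoef _ _ _ _ _ _ _) ((-1) ^+ _) => B B' g E'.
have -> : B = g * B' * (x * x) / (y * y) by rewrite E' mulfK// mulf_neq0.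
by field; rewrite y0 x0.
Qed.

Lemma rotcoefN n k l c s : (absz k <= n)%N -> (absz l <= n)%N ->
  rotcoef n (- k) (- l) c s = (-1) ^+ absz (k + l) * rotcoef n k l c s.
Proof.
move=> kn ln; rewrite /rotcoef !rotwN mulrCA; congr (_ * _); rewrite !opprK.
have E : (updeg n (- k) + updeg n k = updeg n l + updeg n (- l))%N.
  by rewrite addnC !updegD.
rewrite bicoefC (bicoef_flip _ _ _ _ E).
have sg : (-1) ^+ absz (k + l) = (-1) ^+ updeg n (- l) * (-1) ^+ updeg n (- k) :> R.
  rewrite -exprD -signr_odd -[RHS]signr_odd /updeg; congr (_ ^+ _); lia.
rewrite sg -mulrA -bicoef_oppy -bicoefZ2.
by congr bicoef; rewrite mulN1r ?opprK.
Qed.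

(** Both sides acquire the same sign when [k] and [l] are exchanged and when both are negated; these
    moves bring every pair into the region [|l| <= k]. *)
Lemma halfd_rotcoef n k l c s : c ^+ 2 + s ^+ 2 = 1 ->
  (absz k <= n)%N -> (absz l <= n)%N ->
  halfd n k l c s = rotcoef n k l c s.
Proof.
move=> cs.
suff H k' l' : (absz k' <= n)%N -> (absz l' <= absz k')%N ->
    halfd n k' l' c s = rotcoef n k' l' c s.
  move=> kn ln; have [lk|/ltnW kl] := leqP (absz l) (absz k); first exact: H.
  by rewrite halfdC rotcoefC// (addrC l k); congr (_ * _); exact: H.
move=> kn lk; have [k0|/ltW k0] := leP 0 k'; first exact: halfd_rotcoef_ge.
have ln := leq_trans lk kn.
rewrite -[k']opprK -[l']opprK halfdN rotcoefN ?abszN//; congr (_ * _).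
by apply: halfd_rotcoef_ge; rewrite ?abszN// oppr_ge0.
Qed.

End rotation_coefficients.

(** * Fourier expansion with Wigner-d values at the right angle *)

Section half_angle_expansion.
Variable R : realType.
Implicit Types (n : nat) (k l j : int) (x : R).
Local Notation C := R[i].

Lemma expi0 : expi (0 : R) = 1.
Proof. by rewrite /expi cos0 sin0. Qed.

Lemma expi_exp x m : expi x ^+ m = expi (m%:R * x).
Proof.
elim: m => [|m IH]; first by rewrite expr0 mul0r expi0.
by rewrite exprS IH -expiD -natr1 mulrDl mul1r addrC.
Qed.

Lemma krawN n k j : (absz k <= n)%N -> (absz j <= n)%N ->
  kraw C (updeg n (- k)) (updeg n k) (updeg n j) =
  (-1) ^+ (updeg n j + updeg n (- k)) *
    kraw C (updeg n k) (updeg n (- k)) (updeg n (- j)).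
Proof.
move=> kn jn; rewrite /kraw bicoefC.
have -> : bicoef 1 (-1) 1 1 (updeg n k) (updeg n (- k)) (updeg n j) =
    (-1) ^+ updeg n j * bicoef 1 1 1 (-1) (updeg n k) (updeg n (- k)) (updeg n j) :> C.
  by rewrite -bicoef_oppy opprK.
rewrite exprD -mulrA; congr (_ * _).
rewrite (@bicoef_flip _ 1 1 1 (-1) _ _ (updeg n (- j))); last first.
  by rewrite addnC !updegD.
by rewrite -bicoefZ2 !mulN1r opprK.
Qed.

(** At the right angle both half-angle values are [1 / sqrt 2], so up to scalars the rotation is the
    substitution defining [kraw]. *)
Lemma wignerd0 n k j : (absz k <= n)%N -> (absz j <= n)%N ->
  wignerd n j k (0 : R) = (Num.sqrt 2)^-1 ^+ (2 * n) * (-1) ^+ updeg n (- k)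
    * (Num.sqrt (rotw R n j) / Num.sqrt (rotw R n k))
    * kraw R (updeg n k) (updeg n (- k)) (updeg n (- j)).
Proof.
move=> kn jn; set h := (Num.sqrt 2)^-1.
have h0 : 0 <= h by rewrite invr_ge0 sqrtr_ge0.
have hh : h ^+ 2 + h ^+ 2 = 1.
  by rewrite exprVn sqr_sqrtr//; lra.
rewrite -(subrr (h ^+ 2)) wignerd_half// halfd_rotcoef// /rotcoef [RHS]mulrAC mulrC.
congr (_ * _); have -> : bicoef h h (- h) h (updeg n k) (updeg n (- k)) (updeg n (- j)) =
   bicoef (h * 1) (h * 1) (- h * 1) (- h * - 1) (updeg n k) (updeg n (- k)) (updeg n (- j)).
  by rewrite !mulr1 mulrN1 opprK.
rewrite bicoefZ1 bicoefZ2 -(updegD kn) exprD [(- h) ^+ _]exprNn /kraw.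
move: (h ^+ _) (h ^+ _) ((-1) ^+ _) (bicoef _ _ _ _ _ _ _) => *; ring.
Qed.

Lemma kraw_real a b d : kraw C a b d = (kraw R a b d)%:C%C.
Proof. by rewrite /kraw (rmorph_bicoef (real_complex R)) rmorphN /= rmorph1. Qed.

(** The matrix with rows [(1, 1)] and [(1, -1)] is symmetric, so [bicoef_tr] becomes the
    self-duality of Krawtchouk values. *)
Lemma kraw_sym n k j : (absz k <= n)%N -> (absz j <= n)%N ->
  kraw R (updeg n j) (updeg n (- j)) (updeg n (- k)) =
  kraw R (updeg n k) (updeg n (- k)) (updeg n (- j)) * Num.sqrt (rotw R n j) ^+ 2 / Num.sqrt (rotw R n k) ^+ 2.
Proof.
have rwE m : Num.sqrt (rotw R n m) ^+ 2 = rotw R n m by rewrite sqr_sqrtr// ltW// rotw_gt0.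
move=> kn jn; rewrite !rwE; have E' : (updeg n k + updeg n (- k) = updeg n j + updeg n (- j))%N.
  by rewrite !updegD.
apply: (canRL (mulfK _)); first by rewrite gt_eqF// rotw_gt0.
by rewrite /rotw !mulr_natr /kraw; exact: bicoef_tr.
Qed.

(** Isolated over an abstract field so that [field] meets only variables: [a1, a2, b1, b2] are
    signs, [hh] is [2 ^ (- n)], [t] is [4 ^ n], and [J, K, L] are square roots of weights. *)
Lemma trig_term_algebra (F : fieldType) (a1 a2 b1 b2 hh t J K L e ik il A B : F) :
  a1 * a2 = b1 * b2 -> t * (hh * hh) = 1 -> il != 0 -> K != 0 -> L != 0 ->
  K / L * (a1 * B * e * (ik * (a2 * (A * (J * J) / (K * K))))) =
  t * il * (ik / il * (hh * b1 * (J / K) * A * (hh * b2 * (J / L) * B) * e)).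
Proof.
move=> sg h2 il0 K0 L0.
transitivity (a1 * a2 * (J * J / (K * L) * e * ik * A * B)); first by field; rewrite K0 L0.
by rewrite sg -[LHS]mul1r -h2; field; rewrite K0 L0 il0.
Qed.

Lemma sign_real m : ((-1) ^+ m : R)%:C%C = (-1) ^+ m.
Proof. by rewrite rmorphXn rmorphN1. Qed.

Lemma inv_sqrt2_exp n :
  (2 : C) ^+ (2 * n) * (((Num.sqrt 2)^-1 ^+ (2 * n))%:C%C * ((Num.sqrt 2)^-1 ^+ (2 * n))%:C%C) = 1.
Proof.
rewrite -rmorphM -exprMn -invfM -expr2 sqr_sqrtr ?ler0n//.
by rewrite rmorphXn fmorphV rmorph_nat -exprMn mulfV ?expr1n// pnatr_eq0.
Qed.

Lemma halfd_trig_term n k l j (e : C) :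
  (absz k <= n)%N -> (absz l <= n)%N -> (absz j <= n)%N ->
  (Num.sqrt (rotw R n k) / Num.sqrt (rotw R n l))%:C%C *
   (kraw C (updeg n (- l)) (updeg n l) (updeg n j) * e *
    ('i%C ^+ updeg n k * kraw C (updeg n (- j)) (updeg n j) (updeg n k))) =
  2 ^+ (2 * n) * 'i%C ^+ updeg n l *
   ('i%C ^ (k - l) * ((wignerd n j k 0 * wignerd n j l (0 : R))%:C%C * e)).
Proof.
move=> kn ln jn; rewrite krawN// (krawN jn kn) !wignerd0// !kraw_real (kraw_sym kn jn).
have -> : ('i%C : C) ^ (k - l) = 'i%C ^+ updeg n k / 'i%C ^+ updeg n l.
  have i0 : ('i%C : C) != 0 by rewrite -sqrf_eq0 sqr_i oppr_eq0 oner_eq0.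
  rewrite (_ : k - l = (updeg n k)%:Z - (updeg n l)%:Z) ?expfzDr//.
    by rewrite -exprnN -!exprnP.
  by rewrite /updeg; lia.
have sg : (-1) ^+ (updeg n j + updeg n (- l)) * (-1) ^+ (updeg n k + updeg n (- j)) =
    (-1) ^+ updeg n (- k) * (-1) ^+ updeg n (- l) :> C.
  rewrite -!exprD -signr_odd -[RHS]signr_odd; congr (_ ^+ _).
  by rewrite /updeg; lia.
have il0 : ('i%C : C) ^+ updeg n l != 0.
  by rewrite expf_neq0// -sqrf_eq0 sqr_i oppr_eq0 oner_eq0.
have y0 m : Num.sqrt (rotw R n m) != 0 by rewrite sqrtr_eq0 -ltNge rotw_gt0.
have h2 := inv_sqrt2_exp n.
have [bk bl] : ((-1) ^+ updeg n (- k))%:C%C = (-1) ^+ updeg n (- k) :> C /\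
    ((-1) ^+ updeg n (- l))%:C%C = (-1) ^+ updeg n (- l) :> C by rewrite !sign_real.
move: (y0 k) (y0 l) h2 bk bl.
move: (Num.sqrt (rotw R n k)) (Num.sqrt (rotw R n l)) (Num.sqrt (rotw R n j)) => K L J.
move: ((Num.sqrt 2)^-1 ^+ (2 * n)) => hh.
move: (kraw _ _ _ _) (kraw _ _ _ _) => X Y K0 L0 h2 ek el.
have cM (x y : R) : (x * y)%:C%C = x%:C%C * y%:C%C by exact: rmorphM.
have cV (x : R) : (x^-1)%:C%C = (x%:C%C)^-1 by exact: fmorphV.
have c0 (x : R) : x != 0 -> x%:C%C != 0 :> C by move=> x0; rewrite fmorph_eq0.
rewrite (expr2 J) (expr2 K) !(cM, cV) ek el.
by apply: trig_term_algebra; [exact: sg|exact: h2|exact: il0|exact: c0|exact: c0].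
Qed.

(** [bicoef_rotation] with [e = expi (x / 2)] gives a sum over eigenvectors, and the two Krawtchouk
    factors of each term are Wigner-d values at 0. The summation index is [w = j + n] for the
    frequency [j]. *)
Lemma halfd_trig n k l x : (absz k <= n)%N -> (absz l <= n)%N ->
  (halfd n (- k) (- l) (cos (x / 2)) (sin (x / 2)))%:C%C =
  'i%C ^ (k - l) * \sum_(w < (2 * n).+1)
    (wignerd n (w%:Z - n%:Z) k 0 * wignerd n (w%:Z - n%:Z) l (0 : R))%:C%C
    * expi ((w%:Z - n%:Z)%:~R * x).
Proof.
move=> kn ln; rewrite (halfd_rotcoef (cos2Dsin2 (x / 2))) ?abszN// /rotcoef !rotwN !opprK.
have pq : (updeg n (- l) + updeg n l = 2 * n)%N by rewrite addnC updegD.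
have i2 : ('i%C : C) ^+ 2 = -1 by exact: sqr_i.
have [cE sE] : (cos (x / 2))%:C%C *+ 2 = expi (x / 2) + expi (- (x / 2)) /\
    ('i%C * (sin (x / 2))%:C%C) *+ 2 = expi (x / 2) - expi (- (x / 2)).
  rewrite /expi cosN sinN; split; apply/eqP;
  by rewrite eq_complex !mulr2n /=; apply/andP; split; apply/eqP; ring.
have := bicoef_rotation (updeg n (- l)) (updeg n l) (updeg n k) i2 cE sE.
have -> : bicoef (cos (x / 2))%:C%C (sin (x / 2))%:C%C (- (sin (x / 2))%:C%C) (cos (x / 2))%:C%C
    (updeg n (- l)) (updeg n l) (updeg n k) =
  (bicoef (cos (x / 2)) (sin (x / 2)) (- sin (x / 2)) (cos (x / 2))
    (updeg n (- l)) (updeg n l) (updeg n k))%:C%C.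
  by rewrite (rmorph_bicoef (real_complex R)) /= rmorphN.
rewrite pq; move: (bicoef _ _ _ _ _ _ _) => B E.
have two0 : (2 : C) ^+ (2 * n) * 'i%C ^+ updeg n l != 0.
  by rewrite mulf_neq0 ?expf_neq0 ?pnatr_eq0// -sqrf_eq0 i2 oppr_eq0 oner_eq0.
rewrite rmorphM; apply: (mulfI two0).
rewrite mulrCA E !mulr_sumr; apply: eq_bigr => -[w /= wN] _.
have wj : w = updeg n (w%:Z - n%:Z) by rewrite /updeg; lia.
have Nwj : (2 * n - w = updeg n (- (w%:Z - n%:Z)))%N by rewrite /updeg; lia.
rewrite Nwj; have -> : expi (- (x / 2)) ^+ updeg n (- (w%:Z - n%:Z)) * expi (x / 2) ^+ w =
    expi ((w%:Z - n%:Z)%:~R * x).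
  rewrite !expi_exp -expiD; congr expi.
  have -> : (updeg n (- (w%:Z - n%:Z)))%:R = 2 * n%:R - w%:R :> R.
    by rewrite -Nwj natrB 1?natrM// -ltnS.
  by rewrite rmorphB /=; field.
have -> : kraw C (updeg n (- l)) (updeg n l) w =
    kraw C (updeg n (- l)) (updeg n l) (updeg n (w%:Z - n%:Z)) by rewrite -wj.
have -> : kraw C (updeg n (- (w%:Z - n%:Z))) w (updeg n k) =
    kraw C (updeg n (- (w%:Z - n%:Z))) (updeg n (w%:Z - n%:Z)) (updeg n k) by rewrite -wj.
by apply: halfd_trig_term => //; lia.
Qed.

End half_angle_expansion.

(** * Orthogonality of Jacobi polynomials *)

Ltac factnz := by rewrite ?nat1r ?pnatr_eq0 -?lt0n ?fact_gt0.

Section jacobi_orthogonality.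
Variable R : realType.
Implicit Types (p q : {poly R}) (a b r n m : nat).

(** The integral over [[0, 1]], defined on coefficients: orthogonality stays within polynomial
    algebra and meets the Lebesgue integral only through the substitution [X = sin (x / 2) ^ 2]. *)
Definition poly_int01 p : R := \sum_(i < size p) p`_i / i.+1%:R.

Lemma poly_int01E p N : (size p <= N)%N ->
  poly_int01 p = \sum_(i < N) p`_i / i.+1%:R.
Proof.
move=> pN; rewrite /poly_int01 (big_ord_widen _ (fun i => p`_i / i.+1%:R) pN).
rewrite big_mkcond; apply: eq_bigr => i _; case: ltnP => // pi.
by rewrite nth_default// mul0r.
Qed.

Lemma poly_int01_is_linear : linear poly_int01.
Proof.
move=> c p q; pose N := maxn (size p) (size q).
have pN : (size p <= N)%N by rewrite leq_maxl.
have qN : (size q <= N)%N by rewrite leq_maxr.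
rewrite (@poly_int01E _ N); last first.
  rewrite (leq_trans (size_polyD _ _))// geq_max qN andbT.
  by rewrite (leq_trans (size_scale_leq _ _)).
rewrite (poly_int01E pN) (poly_int01E qN) scaler_sumr -big_split /=.
by apply: eq_bigr => i _; rewrite coefD coefZ mulrDl -mulrA.
Qed.

HB.instance Definition _ := GRing.isLinear.Build R {poly R} R *%R poly_int01
  poly_int01_is_linear.

(** The coefficient of index 0 is a division by zero, hence 0, so this primitive vanishes at 0. *)
Definition poly_prim p : {poly R} := \poly_(i < (size p).+1) (p`_i.-1 / i%:R).

Lemma deriv_poly_prim p : (poly_prim p)^`() = p.
Proof.
apply/polyP => i; rewrite coef_deriv coef_poly ltnS.
case: ltnP => pi; last by rewrite nth_default// mul0rn.
by rewrite -[LHS]mulr_natr divfK// pnatr_eq0.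
Qed.

Lemma poly_int01_prim p :
  poly_int01 p = (poly_prim p).[1] - (poly_prim p).[0].
Proof.
rewrite horner_coef0 coef_poly /= invr0 mulr0 subr0.
rewrite /poly_prim horner_poly big_ord_recl /= invr0 mulr0 mul0r add0r.
by apply: eq_bigr => i _; rewrite expr1n mulr1.
Qed.

Lemma deriv_eq_horner p q x y : p^`() = q^`() -> p.[x] - p.[y] = q.[x] - q.[y].
Proof.
move=> pq.
have E : p - q = ((p - q)`_0)%:P.
  apply/polyP => -[|i]; rewrite coefC//=.
  have : (p - q)^`()`_i = 0 by rewrite derivB pq subrr coef0.
  by rewrite coef_deriv => /eqP; rewrite mulrn_eq0 /= => /eqP.
have := congr1 (fun u => u.[x]) E; have := congr1 (fun u => u.[y]) E.
by rewrite !hornerD !hornerN !hornerC => ey ex; lra.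
Qed.

Lemma poly_int01_deriv p : poly_int01 p^`() = p.[1] - p.[0].
Proof. by rewrite poly_int01_prim; apply: deriv_eq_horner; rewrite deriv_poly_prim. Qed.

Lemma deriv_Xn_onem m n : deriv ('X^(m.+1) * (1 - 'X) ^+ n.+1 : {poly R}) =
  m.+1%:R *: ('X^m * (1 - 'X) ^+ n.+1) - n.+1%:R *: ('X^(m.+1) * (1 - 'X) ^+ n).
Proof.
rewrite derivM derivXn deriv_exp /= derivB derivX (derivC 1) sub0r.
by rewrite !scaler_nat mulrnAl mulN1r mulNrn mulrN mulrnAr.
Qed.

(** The derivative of [X^(m+1) (1-X)^(n+1)] has integral 0, which trades one power of [1 - X] for
    one power of [X]. *)
Lemma beta_int01 m n :
  poly_int01 ('X^m * (1 - 'X) ^+ n) = (m`! * n`!)%:R / ((m + n).+1)`!%:R.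
Proof.
elim: n m => [|n IH] m.
  have -> : 'X^m * (1 - 'X) ^+ 0 = (m.+1%:R^-1 *: 'X^(m.+1))^`() :> {poly R}.
    rewrite mulr1 derivZ derivXn /= -scalerMnr scalerMnl -[_^-1 *+ _]mulr_natr mulVf ?scale1r//.
  rewrite poly_int01_deriv !hornerZ !hornerXn expr1n expr0n /= mulr1 mulr0 subr0.
  rewrite addn0 muln1 factS natrM.
  by field; factnz.
have := poly_int01_deriv ('X^(m.+1) * (1 - 'X) ^+ n.+1).
rewrite deriv_Xn_onem linearB !linearZ /= IH !hornerM !horner_exp !hornerD hornerN.
rewrite !hornerX !hornerC subrr !expr0n /= mulr0 mul0r subr0 => /eqP.
rewrite addr_eq0 scalerN opprK => /eqP E.
apply: (mulfI (x := m.+1%:R)); first by rewrite pnatr_eq0.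
rewrite [LHS]E -[_ *: _]/(_ * _) addSnnS.
by move: (_^-1) => D; rewrite (factS m) (factS n) !natrM; ring.
Qed.

(** The Jacobi polynomial at [x = 1 - 2 X], so that [X = sin (b / 2) ^ 2] when [x = cos b]. *)
Definition jac01 a b r : {poly R} :=
  \sum_(m < r.+1) ('C(r + a, r - m) * 'C(r + b, m))%:R *:
    ((- 'X) ^+ m * (1 - 'X) ^+ (r - m)).

(** Iterating this relation gives the formula of Rodrigues. *)
Lemma jac01_raise a b r :
  ('X^(a.+1) * (1 - 'X) ^+ b.+1 * jac01 a.+1 b.+1 r)^`() =
  r.+1%:R *: ('X^a * (1 - 'X) ^+ b * jac01 a b r.+1).
Proof.
pose t m := ('X^(a + m) * (1 - 'X) ^+ (b + (r.+1 - m)) : {poly R}).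
have -> : 'X^(a.+1) * (1 - 'X) ^+ b.+1 * jac01 a.+1 b.+1 r =
   \sum_(m < r.+1) ((-1) ^+ m * ('C(r + a.+1, r - m) * 'C(r + b.+1, m))%:R) *:
      ('X^((a + m).+1) * (1 - 'X) ^+ (b + (r - m)).+1).
  rewrite mulr_sumr; apply: eq_bigr => m _.
  rewrite -scalerAr [(-1) ^+ m * _]mulrC -[RHS]scalerA; congr (_ *: _).
  rewrite [(- 'X) ^+ _]exprNn -[RHS]mul_polyC polyC_exp polyCN -!addSn !exprD.
  by move: ('X ^+ _) ('X ^+ _) (_ ^+ b.+1) (_ ^+ (r - m)) ((-1) ^+ _) => *; ring.
rewrite linear_sum /=.
under eq_bigr do rewrite derivZ deriv_Xn_onem scalerBr !scalerA.
rewrite sumrB mulr_sumr scaler_sumr.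
pose K m : R := (-1) ^+ m * ('C(r.+1 + a, r.+1 - m) * 'C(r.+1 + b, m))%:R.
(* The factor [r + 1] is split as [(r + 1 - m) + m]. The two parts match the two terms of the
   product rule, the second one after a shift of [m]. *)
have E m : (m < r.+2)%N ->
   r.+1%:R *: ('X^a * (1 - 'X) ^+ b * (('C(r.+1 + a, r.+1 - m) * 'C(r.+1 + b, m))%:R *:
    ((- 'X) ^+ m * (1 - 'X) ^+ (r.+1 - m)))) =
   (K m * (r.+1 - m)%:R) *: t m + (K m * m%:R) *: t m.
  move=> mr; rewrite -scalerDl -mulrDr -natrD subnK// /K /t.
  rewrite -scalerAr [_ * r.+1%:R]mulrC [(-1) ^+ m * _]mulrC -[RHS]scalerA.
  congr (_ *: _); rewrite -[RHS]scalerA; congr (_ *: _).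
  rewrite [(- 'X) ^+ _]exprNn -[RHS]mul_polyC polyC_exp polyCN !exprD.
  by move: ('X ^+ _) ('X ^+ _) (_ ^+ b) (_ ^+ (r.+1 - m)) ((-1) ^+ _) => *; ring.
under [RHS]eq_bigr do rewrite E ?ltn_ord//.
rewrite big_split /=; congr (_ + _).
  rewrite [RHS]big_ord_recr /= subnn mulr0 scale0r addr0; apply: eq_bigr => -[m /= mr] _.
  rewrite /t subSn// !addnS; congr (_ *: _).
  rewrite /K -!mulrA -!natrM; congr (_ * _%:R).
  rewrite -!addSn subSn//.
  have := mul_bin_left (r.+1 + a) (r - m).
  have -> : (r.+1 + a - (r - m) = (a + m).+1)%N by lia.
  move: 'C(_, _) 'C(_, _) 'C(_, _) => x y z; nia.
rewrite [RHS]big_ord_recl /= mulr0 scale0r add0r -sumrN; apply: eq_bigr => -[m /= mr] _.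
rewrite /bump /= add1n /t subSS !addnS -scaleNr; congr (_ *: _).
rewrite /K exprS mulN1r !mulNr; congr (- _).
rewrite -!mulrA -!natrM; congr (_ * _%:R).
rewrite -!addSn subSS.
have := mul_bin_left (r.+1 + b) m.
have -> : (r.+1 + b - m = (b + (r - m)).+1)%N by lia.
move: 'C(_, _) 'C(_, _) 'C(_, _) => x y z; nia.
Qed.

(** Integration by parts [r] times; the boundary terms vanish because every primitive carries
    positive powers of [X] and of [1 - X]. *)
Lemma jac01_ibp a b r p :
  poly_int01 ('X^a * (1 - 'X) ^+ b * jac01 a b r * p) =
  (-1) ^+ r / r`!%:R * poly_int01 ('X^(a + r) * (1 - 'X) ^+ (b + r) * p^`(r)).
Proof.
elim: r a b p => [|r IH] a b p.
  rewrite /jac01 big_ord1 /= subnn !bin0 scale1r !expr0 !mulr1 !addn0.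
  by rewrite fact0 divr1 mul1r.
have := poly_int01_deriv ('X^(a.+1) * (1 - 'X) ^+ b.+1 * jac01 a.+1 b.+1 r * p).
rewrite derivM jac01_raise linearD /= !hornerM !horner_exp !hornerD !hornerN.
rewrite !hornerX !hornerC subrr !expr0n /= mulr0 !mul0r subr0.
rewrite -scalerAl linearZ /= => /eqP; rewrite addr_eq0 => /eqP E.
apply: (mulfI (x := r.+1%:R)); first by rewrite pnatr_eq0.
rewrite [LHS]E IH -derivSn !addSnnS factS natrM exprS.
by field; factnz.
Qed.

Lemma size_jac01 a b r : (size (jac01 a b r) <= r.+1)%N.
Proof.
apply: (leq_trans (size_sum _ _ _)); apply/bigmax_leqP => -[m /= mr] _.
apply: (leq_trans (size_scale_leq _ _)).
have sX : (size (- 'X : {poly R})%R <= 2)%N by rewrite size_polyN size_polyX.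
have s1X : (size (1 - 'X : {poly R})%R <= 2)%N.
  by rewrite -opprB size_polyN -polyC1 size_XsubC.
have sz (p : {poly R}) i : (size p <= 2)%N -> (size (p ^+ i)%R <= i.+1)%N.
  move=> p2; apply: (leq_trans (size_poly_exp_leq _ _)).
  by rewrite ltnS -[leqRHS]mul1n leq_mul2r; move: p2; case: (size p) => [|[|[|]]]; rewrite ?orbT.
apply: (leq_trans (size_polyMleq _ _)); rewrite -subn1 leq_subLR.
by apply: (leq_trans (leq_add (sz _ m sX) (sz _ (r - m)%N s1X))); lia.
Qed.

Lemma lead_jac01 a b r :
  (jac01 a b r)`_r = (-1) ^+ r * 'C(2 * r + a + b, r)%:R.
Proof.
have -> : (2 * r + a + b = (r + b) + (r + a))%N by lia.
rewrite -binomial.Vandermonde natr_sum mulr_sumr coef_sum; apply: eq_bigr => -[m /= mr] _.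
rewrite coefZ mulrC mulnC; congr (_ * _).
have -> : (- 'X) ^+ m * (1 - 'X) ^+ (r - m) =
    (0%:P + (-1) *: 'X) ^+ m * (1%:P + (-1) *: 'X) ^+ (r - m) :> {poly R}.
  by rewrite add0r !scaleN1r.
rewrite -/(bicoef 0 (-1) 1 (-1) m (r - m) r).
rewrite (bicoef_oppy 0 (1 : R) 1 1).
rewrite (@bicoef_flip _ _ _ _ _ _ _ 0); last by rewrite add0n subnKC.
by rewrite /bicoef coefM big_ord1 !coef_linX /= !bin0 !expr1n !mulr1.
Qed.

Lemma jac01_orth a b r r' : (r' <= r)%N ->
  poly_int01 ('X^a * (1 - 'X) ^+ b * jac01 a b r * jac01 a b r') =
  (r' == r)%:R * (((r + a)`! * (r + b)`!)%:R /
    (r`! * (r + a + b)`! * (2 * r + a + b).+1)%:R).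
Proof.
move=> rr'; rewrite jac01_ibp.
have [->|nrr] := eqVneq r' r; last first.
  rewrite derivn_poly0 ?mulr0 ?linear0 ?mulr0 ?mul0r//.
  by apply: (leq_trans (size_jac01 _ _ _)); rewrite ltn_neqAle nrr.
have -> : (jac01 a b r)^`(r) = (r`!%:R * (jac01 a b r)`_r)%:P.
  apply/polyP => i; rewrite coef_derivn coefC; case: i => [|i] /=.
    by rewrite addn0 ffactnn mulr_natl.
  by rewrite nth_default ?mul0rn// (leq_trans (size_jac01 _ _ _))// addnS ltnS leq_addr.
rewrite [_ * _%:P]mulrC mul_polyC linearZ /= beta_int01 lead_jac01 mul1r.
have F := @bin_fact (2 * r + a + b) r.
have {F} := F ltac:(lia); have -> : (2 * r + a + b - r = r + a + b)%N by lia.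
have -> : (a + r + (b + r) = 2 * r + a + b)%N by lia.
rewrite factS => <-; rewrite (addnC a) (addnC b) !natrM.
rewrite [(-1) ^+ r * _]mulrC.
have : ((-1) ^+ r) * (-1) ^+ r = 1 :> R by rewrite -expr2 sqrr_sign.
move: ((-1) ^+ r) => g gg.
have C0 : 'C(2 * r + a + b, r)%:R != 0 :> R.
  by rewrite pnatr_eq0 -lt0n bin_gt0; lia.
have f0 i : i`!%:R != 0 :> R by rewrite pnatr_eq0 -lt0n fact_gt0.
have N0 : (2 * r + a + b).+1%:R != 0 :> R by rewrite pnatr_eq0.
move: C0 (f0 r) (f0 (r + a + b)%N) N0.
move: (_%:R) (_%:R) (_%:R) (_%:R) => x y z t x0 y0 z0 t0.
by transitivity (g * g * ((r + a)`!%:R * (r + b)`!%:R / (z * y * x)));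
  [field; rewrite x0 y0 z0 t0|rewrite gg mul1r].
Qed.

Lemma binomial_factorial_ratio (a b r : nat) :
  'C(r + a + b, r + a)%:R / 'C(r + b, b)%:R *
  (((r + a)`! * (r + b)`!)%:R / (r`! * (r + a + b)`! * (2 * r + a + b).+1)%:R) =
  (2 * r + a + b).+1%:R^-1 :> R.
Proof.
have F1 := bin_fact (leq_addr b (r + a)); have F2 := bin_fact (leq_addl r b).
rewrite addKn in F1; rewrite addnK in F2.
rewrite -F1 -F2 !natrM.
have C1 : 'C(r + a + b, r + a)%:R != 0 :> R by rewrite pnatr_eq0 -lt0n bin_gt0 leq_addr.
have C2 : 'C(r + b, b)%:R != 0 :> R by rewrite pnatr_eq0 -lt0n bin_gt0 leq_addl.
have f0 i : i`!%:R != 0 :> R by rewrite pnatr_eq0 -lt0n fact_gt0.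
have N0 : (2 * r + a + b).+1%:R != 0 :> R by rewrite pnatr_eq0.
move: C1 C2 N0 (f0 r) (f0 b) (f0 (r + a)%N).
move: (_%:R) (_%:R) (_%:R) (_%:R) (_%:R) (_%:R) => *.
by field; do ?[apply/andP; split].
Qed.

Section halfd_product.
Variables (n n' : nat) (k l : int).
Local Notation a := (absz (k - l)).
Local Notation b := (absz (k + l)).
Local Notation mx := (maxn (absz k) (absz l)).

Definition halfd_norm m : R :=
  Num.sqrt 'C(2 * m - (m - mx), m - mx + a)%:R / Num.sqrt 'C(m - mx + b, b)%:R.

Lemma halfdE m (c s : R) : c ^+ 2 + s ^+ 2 = 1 ->
  halfd m k l c s = (-1) ^+ absz (if (l < k)%R then k + l else 0) * halfd_norm m *
    s ^+ a * c ^+ b * (jac01 a b (m - mx)).[s ^+ 2].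
Proof.
move=> cs; rewrite /halfd /halfd_norm exprN1z.
have -> : (jacobi R a b (m - mx)).[c ^+ 2 - s ^+ 2] = (jac01 a b (m - mx)).[s ^+ 2].
  rewrite jacobi_half// /jac01 horner_sum; apply: eq_bigr => j _.
  rewrite hornerZ hornerM !horner_exp hornerD !hornerN hornerC hornerX.
  by rewrite -cs addrK.
by rewrite !mulrA.
Qed.

Lemma halfdM (c s : R) : c ^+ 2 + s ^+ 2 = 1 ->
  halfd n k l c s * halfd n' k l c s =
  ((halfd_norm n * halfd_norm n') *:
    ('X^a * (1 - 'X) ^+ b * jac01 a b (n - mx) * jac01 a b (n' - mx))).[s ^+ 2].
Proof.
move=> cs; rewrite !halfdE// hornerZ !hornerM !horner_exp hornerD hornerN hornerC hornerX.
have -> : 1 - s ^+ 2 = c ^+ 2 by rewrite -cs addrK.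
have sq (x : R) i : (x ^+ 2) ^+ i = x ^+ i * x ^+ i by rewrite -exprM mul2n -addnn exprD.
rewrite !sq; set g := (-1) ^+ _; have gg : g * g = 1 by rewrite -expr2 sqrr_sign.
rewrite -[RHS]mul1r -gg.
move: g (halfd_norm n) (halfd_norm n') (s ^+ a) (c ^+ b) {gg} => g x y z t.
by move: (jac01 _ _ _).[_] (jac01 _ _ _).[_] => J J'; ring.
Qed.

End halfd_product.

(** On the circle the product is a polynomial [W] in [s ^ 2] alone. Exhibiting [W] lets the relation
    be used twice: with the weight [sin] on [[0, pi]] for Haar measure, and with [|sin|] on a whole
    period for the block bound. *)
Lemma halfd_orth n n' k l :
  (absz k <= n)%N -> (absz l <= n)%N -> (absz k <= n')%N -> (absz l <= n')%N ->
  exists2 W : {poly R}, (forall c s, c ^+ 2 + s ^+ 2 = 1 ->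
      halfd n k l c s * halfd n' k l c s = W.[s ^+ 2]) &
    poly_int01 W = (n == n')%:R / (2 * n + 1)%:R.
Proof.
wlog nn' : n n' / (n' <= n)%N => [wl kn ln kn' ln'|kn ln kn' ln'].
  have [n'n|/ltnW nn'] := leqP n' n; first exact: wl.
  have [W WE Wi] := wl _ _ nn' kn' ln' kn ln; exists W.
    by move=> c s cs; rewrite mulrC WE.
  by rewrite Wi eq_sym; case: eqP => [->//|_]; rewrite !mul0r.
exists ((halfd_norm k l n * halfd_norm k l n') *:
    ('X^(absz (k - l)) * (1 - 'X) ^+ absz (k + l) *
     jac01 (absz (k - l)) (absz (k + l)) (n - maxn (absz k) (absz l)) *
     jac01 (absz (k - l)) (absz (k + l)) (n' - maxn (absz k) (absz l)))).
  by move=> c s; exact: halfdM.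
rewrite linearZ /= jac01_orth; last by rewrite leq_sub2r.
have rr : (n' - maxn (absz k) (absz l) == n - maxn (absz k) (absz l))%N = (n == n').
  by apply/eqP/eqP; lia.
rewrite rr; case: eqP => [nE|_]; last by rewrite !mul0r mulr0.
subst n'; rewrite !mul1r.
have -> : halfd_norm k l n * halfd_norm k l n = halfd_norm k l n ^+ 2 by rewrite expr2.
rewrite /halfd_norm expr_div_n !sqr_sqrtr ?ler0n//.
set r := (n - _)%N; set a := absz (k - l); set b := absz (k + l).
have abm : (a + b = 2 * maxn (absz k) (absz l))%N by rewrite /a /b; lia.
have -> : (2 * n - r = r + a + b)%N by rewrite /r; lia.
have -> : (2 * n + 1 = (2 * r + a + b).+1)%N by rewrite /r; lia.
exact: binomial_factorial_ratio.
Qed.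

End jacobi_orthogonality.

(** * Complex-valued square-integrable functions *)

Section complex_modulus.
Variable R : realType.
Implicit Types x y z : R[i].

Lemma sqmodE z : sqmod z = complex.Re z ^+ 2 + complex.Im z ^+ 2.
Proof.
case: z => a b; rewrite /sqmod /Normc.normc /= sqr_sqrtr//.
by rewrite addr_ge0// sqr_ge0.
Qed.

Lemma sqmod_ge0 z : 0 <= sqmod z.
Proof. by rewrite sqmodE addr_ge0// sqr_ge0. Qed.

Lemma sqmodM x y : sqmod (x * y) = sqmod x * sqmod y.
Proof. by case: x y => [a b] [a' b']; rewrite !sqmodE /=; ring. Qed.

Lemma sqmod0 : sqmod (0 : R[i]) = 0.
Proof. by rewrite sqmodE /= expr0n addr0. Qed.

Lemma sqmod_real (a : R) : sqmod a%:C%C = a ^+ 2.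
Proof. by rewrite sqmodE /= expr0n addr0. Qed.

Lemma sqmod_expi (a : R) : sqmod (expi a) = 1.
Proof. by rewrite sqmodE /expi /= cos2Dsin2. Qed.

Lemma sqmodN z : sqmod (- z) = sqmod z.
Proof. by case: z => a b; rewrite !sqmodE /= !sqrrN. Qed.

Lemma sqmod_le2 x y : sqmod (x + y) <= 2 * sqmod x + 2 * sqmod y.
Proof.
case: x y => [a b] [a' b']; rewrite !sqmodE /= -subr_ge0.
have -> : 2 * (a ^+ 2 + b ^+ 2) + 2 * (a' ^+ 2 + b' ^+ 2) -
  ((a + a') ^+ 2 + (b + b') ^+ 2) = (a - a') ^+ 2 + (b - b') ^+ 2 by ring.
by rewrite addr_ge0// sqr_ge0.
Qed.

Lemma sqmodB_le2 x y : sqmod (x - y) <= 2 * sqmod x + 2 * sqmod y.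
Proof. by rewrite -(sqmodN y); exact: sqmod_le2. Qed.

Lemma mul_conj z : z * (z^*)%C = (sqmod z)%:C%C.
Proof.
case: z => a b; rewrite sqmodE; apply/eqP; rewrite eq_complex /=.
by apply/andP; split; apply/eqP; ring.
Qed.

Lemma abs_Re_mul_conj_le x y : `|complex.Re (x * (y^*)%C)| <= sqmod x + sqmod y.
Proof.
case: x y => [a b] [a' b'] /=; rewrite !sqmodE /= ler_norml.
have := sqr_ge0 (a - a'); have := sqr_ge0 (b - b').
have := sqr_ge0 (a + a'); have := sqr_ge0 (b + b').
by move=> h1 h2 h3 h4; apply/andP; split; nra.
Qed.

Lemma abs_Im_mul_conj_le x y : `|complex.Im (x * (y^*)%C)| <= sqmod x + sqmod y.
Proof.
case: x y => [a b] [a' b'] /=; rewrite !sqmodE /= ler_norml.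
have := sqr_ge0 (a - b'); have := sqr_ge0 (b - a').
have := sqr_ge0 (a + b'); have := sqr_ge0 (b + a').
by move=> h1 h2 h3 h4; apply/andP; split; nra.
Qed.

Lemma ReD x y : complex.Re (x + y) = complex.Re x + complex.Re y.
Proof. by case: x y => [a b] [a' b']. Qed.

Lemma ImD x y : complex.Im (x + y) = complex.Im x + complex.Im y.
Proof. by case: x y => [a b] [a' b']. Qed.

Lemma ReM x y : complex.Re (x * y) =
  complex.Re x * complex.Re y - complex.Im x * complex.Im y.
Proof. by case: x y => [a b] [a' b']. Qed.

Lemma ImM x y : complex.Im (x * y) =
  complex.Re x * complex.Im y + complex.Im x * complex.Re y.
Proof. by case: x y => [a b] [a' b']. Qed.

End complex_modulus.

Section complex_L2.
Context d (T : measurableType d) (R : realType).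
Variables (mu : {measure set T -> \bar R}) (D : set T).
Hypothesis mD : measurable D.
Implicit Types f g h : T -> R[i].

Definition cmeas f := measurable_fun D (fun x => complex.Re (f x)) /\
  measurable_fun D (fun x => complex.Im (f x)).

Definition cintegrable f :=
  mu.-integrable D (EFin \o (fun x => complex.Re (f x))) /\
  mu.-integrable D (EFin \o (fun x => complex.Im (f x))).

Lemma cmeas_eq f g : {in D, f =1 g} -> cmeas f -> cmeas g.
Proof.
move=> fg [mr mi]; split.
  by apply: eq_measurable_fun mr => x Dx; rewrite fg.
by apply: eq_measurable_fun mi => x Dx; rewrite fg.
Qed.

Lemma cmeas_cst (c : R[i]) : cmeas (fun=> c).
Proof. by split; exact: measurable_cst. Qed.

Lemma cmeasD f g : cmeas f -> cmeas g -> cmeas (fun x => f x + g x).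
Proof.
move=> [fr fi] [gr gi]; split.
  by under eq_fun do rewrite ReD; apply: measurable_funD.
by under eq_fun do rewrite ImD; apply: measurable_funD.
Qed.

Lemma cmeasM f g : cmeas f -> cmeas g -> cmeas (fun x => f x * g x).
Proof.
move=> [fr fi] [gr gi]; split.
  under eq_fun do rewrite ReM.
  by apply: measurable_funB; apply: measurable_funM.
under eq_fun do rewrite ImM.
by apply: measurable_funD; apply: measurable_funM.
Qed.

Lemma cmeas_conj f : cmeas f -> cmeas (fun x => (f x)^*%C).
Proof.
move=> [fr fi]; split.
  by apply: eq_measurable_fun fr => x _; case: (f x).
apply: (@eq_measurable_fun _ _ _ _ _ (fun x => - complex.Im (f x))).
  by move=> x _; case: (f x).
by apply: measurable_funN.
Qed.

Lemma cmeasZ (c : R[i]) f : cmeas f -> cmeas (fun x => c * f x).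
Proof. by move=> mf; apply: cmeasM => //; exact: cmeas_cst. Qed.

Lemma cmeasB f g : cmeas f -> cmeas g -> cmeas (fun x => f x - g x).
Proof.
move=> mf mg; apply: cmeasD => //.
by have := cmeasZ (-1) mg; under eq_fun do rewrite mulN1r.
Qed.

Lemma cmeas_sum (I : Type) (s : seq I) (F : I -> T -> R[i]) :
  (forall i, cmeas (F i)) -> cmeas (fun x => \sum_(i <- s) F i x).
Proof.
move=> mF; elim: s => [|i s IH].
  by under eq_fun do rewrite big_nil; exact: cmeas_cst.
by under eq_fun do rewrite big_cons; exact: cmeasD.
Qed.

Lemma cmeas_exp f n : cmeas f -> cmeas (fun x => f x ^+ n).
Proof.
move=> mf; elim: n => [|n IH].
  by under eq_fun do rewrite expr0; exact: cmeas_cst.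
by under eq_fun do rewrite exprS; exact: cmeasM.
Qed.

Lemma measurable_sqmod f : cmeas f -> measurable_fun D (fun x => sqmod (f x)).
Proof.
move=> [fr fi]; under eq_fun do rewrite sqmodE.
by apply: measurable_funD; apply: measurable_funX.
Qed.

Lemma L2_cmeas f : L2 mu D f -> cmeas f.
Proof. by case. Qed.

Lemma sqnormL2_ge0 f : (0 <= sqnormL2 mu D f)%E.
Proof. by apply: integral_ge0 => x _; rewrite lee_fin sqmod_ge0. Qed.

(** Two functions on the right serve both the quadratic triangle inequality and comparisons of
    weighted norms. *)
Lemma le_sqnormL2 (c1 c2 : R) f g h : 0 <= c1 -> 0 <= c2 ->
  cmeas f -> cmeas g -> cmeas h ->
  (forall x, D x -> sqmod (f x) <= c1 * sqmod (g x) + c2 * sqmod (h x)) ->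
  (sqnormL2 mu D f <= c1%:E * sqnormL2 mu D g + c2%:E * sqnormL2 mu D h)%E.
Proof.
move=> c10 c20 mf mg mh fgh; rewrite /sqnormL2.
have mE (u : T -> R) : measurable_fun D u -> measurable_fun D (EFin \o u).
  by move=> ?; apply/measurable_EFinP.
have mS u : cmeas u -> measurable_fun D (fun x => (sqmod (u x))%:E).
  by move=> mu'; apply: mE; exact: measurable_sqmod.
have S0 u x : D x -> (0 <= (sqmod (u x : R[i]))%:E)%E by rewrite lee_fin sqmod_ge0.
have mcS c u : cmeas u -> measurable_fun D (fun x => (c%:E * (sqmod (u x))%:E)%E).
  by move=> mu'; apply: measurable_funeM; exact: mS.
have cS0 (c : R) u x : 0 <= c -> D x -> (0 <= c%:E * (sqmod (u x : R[i]))%:E)%E.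
  by move=> c0 _; rewrite -EFinM lee_fin mulr_ge0// sqmod_ge0.
rewrite -(ge0_integralZl mu mD (mS _ mg) (S0 g)) ?lee_fin//.
rewrite -(ge0_integralZl mu mD (mS _ mh) (S0 h)) ?lee_fin//.
rewrite -ge0_integralD//; try by [exact: mcS|move=> x; exact: cS0].
apply: ge0_le_integral => //.
- exact: S0.
- exact: mS.
- by apply: emeasurable_funD; exact: mcS.
Qed.

Lemma sqnormL2D_le f g : cmeas f -> cmeas g ->
  (sqnormL2 mu D (fun x => f x + g x)%R <= 2%:E * sqnormL2 mu D f + 2%:E * sqnormL2 mu D g)%E.
Proof.
move=> mf mg; apply: le_sqnormL2 => //; first exact: cmeasD.
by move=> x _; exact: sqmod_le2.
Qed.

Lemma sqnormL2Z (c : R[i]) f : cmeas f ->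
  sqnormL2 mu D (fun x => c * f x) = ((sqmod c)%:E * sqnormL2 mu D f)%E.
Proof.
move=> mf; rewrite /sqnormL2 -ge0_integralZl//.
- by apply: eq_integral => x _; rewrite sqmodM.
- by apply/measurable_EFinP; exact: measurable_sqmod.
- by move=> x _; rewrite lee_fin sqmod_ge0.
- by rewrite lee_fin sqmod_ge0.
Qed.

Lemma L2D f g : L2 mu D f -> L2 mu D g -> L2 mu D (fun x => f x + g x).
Proof.
move=> [fr fi lf] [gr gi lg]; have [mr mi] := @cmeasD f g (conj fr fi) (conj gr gi).
split => //; apply: le_lt_trans (sqnormL2D_le (conj fr fi) (conj gr gi)) _.
by rewrite lte_add_pinfty// lte_mul_pinfty.
Qed.

Lemma L2Z (c : R[i]) f : L2 mu D f -> L2 mu D (fun x => c * f x).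
Proof.
move=> [fr fi lf]; have [mr mi] := @cmeasZ c f (conj fr fi).
by split => //; rewrite sqnormL2Z// lte_mul_pinfty// lee_fin sqmod_ge0.
Qed.

Lemma L2_0 : L2 mu D (fun=> 0).
Proof.
split; try exact: measurable_cst.
rewrite /sqnormL2; under eq_integral do rewrite sqmod0.
by rewrite integral0 ltry.
Qed.

Lemma L2_sum (I : Type) (s : seq I) (F : I -> T -> R[i]) :
  (forall i, L2 mu D (F i)) -> L2 mu D (fun x => \sum_(i <- s) F i x).
Proof.
move=> mF; elim: s => [|i s IH].
  by under eq_fun do rewrite big_nil; exact: L2_0.
by under eq_fun do rewrite big_cons; exact: L2D.
Qed.

Lemma L2_sqmod_integrable f : L2 mu D f ->
  mu.-integrable D (EFin \o (fun x => sqmod (f x))).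
Proof.
move=> [fr fi lf]; apply/integrableP; split.
  by apply/measurable_EFinP; exact: measurable_sqmod.
by under eq_integral do rewrite /= ger0_norm ?sqmod_ge0//.
Qed.

Lemma L2_mul_cintegrable f g : L2 mu D f -> L2 mu D g ->
  cintegrable (fun x => f x * (g x)^*%C).
Proof.
move=> Lf Lg; have [mr mi] := cmeasM (L2_cmeas Lf) (cmeas_conj (L2_cmeas Lg)).
have ifg := integrableD mD (L2_sqmod_integrable Lf) (L2_sqmod_integrable Lg).
split; apply: le_integrable ifg => //; try exact/measurable_EFinP.
  move=> x _ /=; rewrite lee_fin (le_trans (abs_Re_mul_conj_le _ _))//.
  exact: ler_norm.
move=> x _ /=; rewrite lee_fin (le_trans (abs_Im_mul_conj_le _ _))//.
exact: ler_norm.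
Qed.

Lemma CintegralD f g : cintegrable f -> cintegrable g ->
  Cintegral mu D (fun x => f x + g x) = Cintegral mu D f + Cintegral mu D g.
Proof.
move=> [fr fi] [gr gi]; rewrite /Cintegral.
under eq_Rintegral do rewrite ReD.
under [X in (_ +i* X)%C]eq_Rintegral do rewrite ImD.
by rewrite !RintegralD.
Qed.

Lemma CintegralZ (c : R[i]) f : cintegrable f ->
  Cintegral mu D (fun x => c * f x) = c * Cintegral mu D f.
Proof.
move=> [fr fi]; rewrite /Cintegral.
under eq_Rintegral do rewrite ReM.
under [X in (_ +i* X)%C]eq_Rintegral do rewrite ImM.
have iZ (a : R) u : mu.-integrable D (EFin \o u) -> mu.-integrable D (EFin \o (fun x => a * u x)).
  by move=> iu; exact: (integrableZl mD a iu).
rewrite RintegralB ?RintegralD ?RintegralZl//; try exact: iZ.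
by case: c.
Qed.

Lemma Cintegral_conj f : cintegrable f ->
  Cintegral mu D (fun x => (f x)^*%C) = ((Cintegral mu D f)^*)%C.
Proof.
move=> [fr fi]; rewrite /Cintegral /=; congr (_ +i* _)%C.
  by apply: eq_Rintegral => x _; case: (f x).
rewrite -mulN1r -RintegralZl//; apply: eq_Rintegral => x _.
by rewrite mulN1r; case: (f x).
Qed.

Lemma innerL2Dl f g h : L2 mu D f -> L2 mu D g -> L2 mu D h ->
  innerL2 mu D (fun x => f x + g x) h = innerL2 mu D f h + innerL2 mu D g h.
Proof.
move=> Lf Lg Lh; rewrite /innerL2 -CintegralD; try exact: L2_mul_cintegrable.
by congr Cintegral; apply/funext => x; rewrite mulrDl.
Qed.

Lemma innerL2Zl (c : R[i]) f h : L2 mu D f -> L2 mu D h ->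
  innerL2 mu D (fun x => c * f x) h = c * innerL2 mu D f h.
Proof.
move=> Lf Lh; rewrite /innerL2 -CintegralZ; last exact: L2_mul_cintegrable.
by congr Cintegral; apply/funext => x; rewrite mulrA.
Qed.

Lemma innerL2_conj f h : L2 mu D f -> L2 mu D h ->
  innerL2 mu D h f = ((innerL2 mu D f h)^*)%C.
Proof.
move=> Lf Lh; rewrite /innerL2 -Cintegral_conj; last exact: L2_mul_cintegrable.
congr Cintegral; apply/funext => x.
by rewrite rmorphM /= conjcK mulrC.
Qed.

Lemma innerL20l h : L2 mu D h -> innerL2 mu D (fun=> 0) h = 0.
Proof.
move=> Lh; rewrite (_ : (fun=> 0) = (fun x => 0 * (fun=> 0) x)).
  by rewrite (innerL2Zl 0 L2_0 Lh) mul0r.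
by apply/funext => x; rewrite mul0r.
Qed.

Lemma innerL2_suml (I : Type) (s : seq I) (F : I -> T -> R[i]) h :
  (forall i, L2 mu D (F i)) -> L2 mu D h ->
  innerL2 mu D (fun x => \sum_(i <- s) F i x) h = \sum_(i <- s) innerL2 mu D (F i) h.
Proof.
move=> LF Lh; elim: s => [|i s IH].
  rewrite big_nil -[RHS](innerL20l Lh); congr innerL2.
  by apply/funext => x; rewrite big_nil.
rewrite big_cons -IH -innerL2Dl//; last exact: L2_sum.
by congr innerL2; apply/funext => x; rewrite big_cons.
Qed.

Lemma sqnormL2_inner f : L2 mu D f ->
  innerL2 mu D f f = (fine (sqnormL2 mu D f))%:C%C.
Proof.
move=> Lf; rewrite /innerL2 /Cintegral /Rintegral /sqnormL2.
congr (_ +i* _)%C.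
  by congr fine; apply: eq_integral => x _; rewrite mul_conj.
by under eq_integral do rewrite mul_conj; rewrite integral0.
Qed.

Lemma sqnormL2_fin f : L2 mu D f -> (fine (sqnormL2 mu D f))%:E = sqnormL2 mu D f.
Proof.
case=> _ _ lf; rewrite fineK// ge0_fin_numE//; exact: sqnormL2_ge0.
Qed.

Section pythagoras.
Context (I : choiceType) (e : I -> T -> R[i]) (c0 : R).
Hypothesis Le : forall i, L2 mu D (e i).
Hypothesis orth_e : forall i j, innerL2 mu D (e i) (e j) = (c0 * (i == j)%:R)%:C%C.

Lemma innerL2_comb (s : seq I) (c : I -> R[i]) i : uniq s ->
  innerL2 mu D (fun x => \sum_(j <- s) c j * e j x) (e i) = (c0%:C%C * c i) *+ (i \in s).
Proof.
move=> us; rewrite innerL2_suml//; last by move=> j; exact: L2Z.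
under eq_bigr do rewrite innerL2Zl// orth_e.
have [is_|ins] := boolP (i \in s).
  rewrite (bigD1_seq i)//= eqxx mulr1 mulrC big1 ?addr0// => j /negPf ->.
  by rewrite mulr0 mulr0.
rewrite big_seq big1// => j js.
by case: eqP => [ji|_]; [rewrite -ji js in ins|rewrite mulr0 mulr0].
Qed.

(** The common squared norm [c0] is kept as a parameter: it is 1 for the Wigner-D functions,
    [2 * pi] and [(2 * pi) ^ 3] for exponentials on one period and on the cell, and 4 for the
    weighted Wigner-d functions. The coefficients [c] are arbitrary, not those of [f]. *)
Lemma pythagoras f (s : seq I) (c : I -> R[i]) : L2 mu D f -> uniq s ->
  sqnormL2 mu D (fun x => f x - \sum_(i <- s) c i * e i x) =
  (fine (sqnormL2 mu D f)
    - \sum_(i <- s) 2 * complex.Re ((c i)^*%C * innerL2 mu D f (e i))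
    + c0 * \sum_(i <- s) sqmod (c i))%:E.
Proof.
move=> Lf us; set h := fun x => \sum_(i <- s) c i * e i x.
have Lh : L2 mu D h by apply: L2_sum => i; exact: L2Z.
pose u := fun x => -1 * h x.
have Lu : L2 mu D u by exact: L2Z.
have uE g : L2 mu D g -> innerL2 mu D u g = -1 * innerL2 mu D h g.
  by move=> Lg; exact: innerL2Zl.
have Lfu : L2 mu D (fun x => f x + u x) by exact: L2D.
rewrite (_ : (fun x => _ - _) = (fun x => f x + u x)); last first.
  by apply/funext => x; rewrite /u mulN1r.
rewrite -[LHS]sqnormL2_fin//; congr EFin.
rewrite -[LHS]/(complex.Re (_%:C%C)) -sqnormL2_inner//.
rewrite (innerL2Dl Lf Lu Lfu) uE// (innerL2_conj Lfu Lf) (innerL2_conj Lfu Lh).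
rewrite (innerL2Dl Lf Lu Lf) (innerL2Dl Lf Lu Lh) !uE//.
rewrite (innerL2_conj Lh Lf) (sqnormL2_inner Lf).
have -> : innerL2 mu D h f = \sum_(i <- s) c i * (innerL2 mu D f (e i))^*%C.
  rewrite innerL2_suml//; last by move=> i; exact: L2Z.
  by apply: eq_bigr => i _; rewrite innerL2Zl// innerL2_conj.
have -> : innerL2 mu D h h = (c0 * \sum_(i <- s) sqmod (c i))%:C%C.
  rewrite {1}/h innerL2_suml//; last by move=> i; exact: L2Z.
  rewrite mulr_sumr rmorph_sum /= big_seq [RHS]big_seq; apply: eq_bigr => i is_.
  rewrite innerL2Zl// innerL2_conj//.
  rewrite innerL2_comb// is_ mulr1n.
  have -> : ((c0%:C * c i)^*)%C = c0%:C%C * ((c i)^*)%C.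
    by rewrite rmorphM; congr (_ * _); exact: conjc_real.
  by rewrite mulrCA mul_conj -rmorphM.
have <- : 2 * complex.Re (\sum_(i <- s) c i * (innerL2 mu D f (e i))^*%C) =
    \sum_(i <- s) 2 * complex.Re ((c i)^*%C * innerL2 mu D f (e i)).
  rewrite -mulr_sumr; congr (_ * _).
  elim: s {us h Lh u Lu uE Lfu} => [|i s IH]; first by rewrite !big_nil.
  rewrite !big_cons ReD IH; congr (_ + _).
  by case: (c i) (innerL2 _ _ _ _) => [a b] [a' b'] /=; ring.
move: (\sum_(i <- s) c i * _) => [a b] /=; ring.
Qed.

Lemma pythagoras0 (s : seq I) (c : I -> R[i]) : uniq s ->
  sqnormL2 mu D (fun x => \sum_(i <- s) c i * e i x) =
  (c0 * \sum_(i <- s) sqmod (c i))%:E.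
Proof.
move=> us; have := pythagoras c L2_0 us.
have -> : sqnormL2 mu D (fun=> 0) = 0%E.
  by rewrite /sqnormL2; under eq_integral do rewrite sqmod0; rewrite integral0.
rewrite big1 => [|i _]; last first.
  by rewrite innerL20l// mulr0 mulr0.
rewrite subrr add0r => <-; apply: eq_integral => x _.
by rewrite sub0r sqmodN.
Qed.

End pythagoras.

End complex_L2.

(** * Integrals of products of functions of separate variables *)

Section fubini_product.
Context d1 d2 (T1 : measurableType d1) (T2 : measurableType d2) (R : realType).
Variables (m1 : {sigma_finite_measure set T1 -> \bar R}).
Variables (m2 : {sigma_finite_measure set T2 -> \bar R}).

Lemma integrable_prod (f : T1 -> R) (g : T2 -> R) :
  m1.-integrable setT (EFin \o f) -> m2.-integrable setT (EFin \o g) ->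
  (m1 \x m2)%E.-integrable setT (EFin \o (fun z => f z.1 * g z.2)).
Proof.
move=> fi gi.
have mf : measurable_fun setT f by apply/measurable_EFinP; exact: measurable_int fi.
have mg : measurable_fun setT g by apply/measurable_EFinP; exact: measurable_int gi.
have mfg : measurable_fun setT (EFin \o (fun z : T1 * T2 => f z.1 * g z.2)).
  by apply/measurable_EFinP; apply: measurable_funM; apply: measurableT_comp.
apply/integrable12ltyP => //=.
under eq_integral => x _.
  under eq_integral do rewrite normrM EFinM.
  rewrite ge0_integralZl//; last first.
    by apply/measurable_EFinP; apply: measurableT_comp.
  over.
rewrite ge0_integralZr//.
- move/integrableP : fi => [_ fi]; move/integrableP : gi => [_ gi].
  by rewrite lte_mul_pinfty// ?integral_ge0// ge0_fin_numE// integral_ge0.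
- by apply/measurable_EFinP; apply: measurableT_comp.
- exact: integral_ge0.
Qed.

Lemma Rintegral_prod (f : T1 -> R) (g : T2 -> R) :
  m1.-integrable setT (EFin \o f) -> m2.-integrable setT (EFin \o g) ->
  (\int[(m1 \x m2)%E]_z (f z.1 * g z.2) = \int[m1]_x f x * \int[m2]_y g y)%R.
Proof.
move=> fi gi; rewrite /Rintegral -integral12_prod_meas1; last exact: integrable_prod.
rewrite /fubini_F /=.
under eq_integral => x _.
  under eq_integral do rewrite EFinM.
  rewrite integralZl// -[X in (_ * X)%E]fineK ?integrable_fin_num//.
  over.
by rewrite integralZr// fineM// integrable_fin_num.
Qed.

Lemma cintegrable_prod (f : T1 -> R[i]) (g : T2 -> R[i]) :
  cintegrable m1 setT f -> cintegrable m2 setT g ->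
  cintegrable (m1 \x m2)%E setT (fun z => f z.1 * g z.2).
Proof.
move=> [fr fi] [gr gi]; split.
  under eq_fun do rewrite ReM.
  exact: (integrableB measurableT (integrable_prod fr gr) (integrable_prod fi gi)).
under eq_fun do rewrite ImM.
exact: (integrableD measurableT (integrable_prod fr gi) (integrable_prod fi gr)).
Qed.

Lemma Cintegral_prod (f : T1 -> R[i]) (g : T2 -> R[i]) :
  cintegrable m1 setT f -> cintegrable m2 setT g ->
  Cintegral (m1 \x m2)%E setT (fun z => f z.1 * g z.2) =
  Cintegral m1 setT f * Cintegral m2 setT g.
Proof.
move=> [fr fi] [gr gi]; rewrite {1}/Cintegral.
under eq_Rintegral do rewrite ReM.
under [X in (_ +i* X)%C]eq_Rintegral do rewrite ImM.
rewrite (RintegralB measurableT (integrable_prod fr gr) (integrable_prod fi gi)).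
rewrite (RintegralD measurableT (integrable_prod fr gi) (integrable_prod fi gr)).
by rewrite (Rintegral_prod fr gr) (Rintegral_prod fi gi) (Rintegral_prod fr gi)
  (Rintegral_prod fi gr).
Qed.

End fubini_product.

Section cintegral_restrict.
Context d (T : measurableType d) (R : realType) (mu : {measure set T -> \bar R}).

(** The product formulas are stated on whole spaces; extension by 0 transports them to boxes. *)
Definition crestrict (D : set T) (f : T -> R[i]) : T -> R[i] :=
  fun x => if x \in D then f x else 0.

Lemma Cintegral_mkcond D f : Cintegral mu D f = Cintegral mu setT (crestrict D f).
Proof.
rewrite /Cintegral Rintegral_mkcond [X in (_ +i* X)%C]Rintegral_mkcond.
by congr (_ +i* _)%C; apply: eq_Rintegral => x _; rewrite /crestrict /patch; case: ifP.
Qed.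

Lemma cintegrable_mkcond D f : measurable D ->
  cintegrable mu D f <-> cintegrable mu setT (crestrict D f).
Proof.
move=> mD.
have E (F : R[i] -> R) : F 0 = 0 ->
    mu.-integrable D (EFin \o (F \o f)) <-> mu.-integrable setT (EFin \o (F \o crestrict D f)).
  move=> F0; rewrite integrable_mkcond//.
  suff -> : (EFin \o (F \o f)) \_ D = EFin \o (F \o crestrict D f) by [].
  by apply/funext => x; rewrite /crestrict /patch /=; case: ifP; rewrite // F0.
by split => -[fr fi]; split; apply/(E (@complex.Re R)) || apply/(E (@complex.Im R)).
Qed.

End cintegral_restrict.

(** * Weighted norms of trigonometric polynomials *)

Section one_dimensional_integrals.
Variable R : realType.
Implicit Types (x a b : R) (k : int).
Local Notation leb := (@lebesgue_measure R).
Local Notation period := (`[0, 2 * pi[%classic : set R).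

Lemma continuous_integrable_itvco (f : R -> R) a b :
  continuous f -> leb.-integrable `[a, b[ (EFin \o f).
Proof.
move=> cf; have if_ : leb.-integrable `[a, b] (EFin \o f).
  apply: continuous_compact_integrable; first exact: segment_compact.
  exact: continuous_subspaceT.
by apply: integrableS if_ => //; exact: subset_itv_co_cc.
Qed.

Lemma FTC_itvco (F f : R -> R) a b : a < b ->
  (forall x, is_derive x (1 : R) F (f x)) -> continuous f ->
  leb.-integrable `[a, b[ (EFin \o f) /\
  (\int[leb]_(x in `[a, b[) f x)%R = F b - F a.
Proof.
move=> ab dF cf.
have ico := @continuous_integrable_itvco f a b cf.
split => //; rewrite Rintegral_itv_bndo_bndc// /Rintegral (@continuous_FTC2 _ _ F)//.
- exact: continuous_subspaceT.
- have cF : continuous F.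
    by move=> x; apply: differentiable_continuous; apply/derivable1_diffP; case: (dF x).
  split; first by move=> x _; case: (dF x).
    by apply: cvg_at_right_filter; exact: cF.
  by apply: cvg_at_left_filter; exact: cF.
- by move=> x _; rewrite derive1E; case: (dF x).
Qed.

Lemma two_pi_gt0 : 0 < 2 * pi :> R.
Proof. by rewrite mulr_gt0// pi_gt0. Qed.

Lemma cos_int_2pi k : cos (k%:~R * (2 * pi)) = 1 :> R /\ sin (k%:~R * (2 * pi)) = 0 :> R.
Proof.
have : expi (k%:~R * (2 * pi)) = expi (k%:~R * 0) :> R[i].
  apply: eq_expi_mul; first by rewrite mulrC mulr_natr cos2pi cos0.
  by rewrite mulrC mulr_natr sin2pi sin0.
by rewrite mulr0 /expi cos0 sin0 => -[-> ->].
Qed.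

Lemma continuous_mulcst a : continuous (fun x : R => a * x).
Proof. by move=> x; apply: cvgM; [exact: cvg_cst|exact: cvg_id]. Qed.

Lemma Cintegral_expi k :
  cintegrable leb period (fun x => expi (k%:~R * x)) /\
  Cintegral leb period (fun x => expi (k%:~R * x)) = (2 * pi * (k == 0)%:R)%:C%C.
Proof.
have tp := two_pi_gt0.
have [->|k0] := eqVneq k 0.
  have d1 x : is_derive x (1 : R) id (1 : R) by exact: is_derive_id.
  have d0 x : is_derive x (1 : R) (cst 0 : R -> R) (0 : R) by exact: is_derive_cst.
  have [i1 e1] := FTC_itvco tp d1 (fun x => @cvg_cst _ _ _ _ _).
  have [i0 e0] := FTC_itvco tp d0 (fun x => @cvg_cst _ _ _ _ _).
  rewrite /cintegrable /Cintegral.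
  have -> : (fun x => complex.Re (expi (0%:~R * x))) = (fun=> 1 : R).
    by apply/funext => x; rewrite mul0r /= cos0.
  have -> : (fun x => complex.Im (expi (0%:~R * x))) = (fun=> 0 : R).
    by apply/funext => x; rewrite mul0r /= sin0.
  by rewrite e1 e0 /= subr0 subrr mulr1.
have kr0 : k%:~R != 0 :> R by rewrite intr_eq0.
have dk x : is_derive x (1 : R) (fun y : R => k%:~R * y) k%:~R.
  by apply: is_derive_eq; rewrite scaler1.
have dsin x : is_derive x (1 : R) (fun y => k%:~R^-1 * sin (k%:~R * y)) (cos (k%:~R * x)).
  have H : is_derive x (1 : R) (k%:~R^-1 \*: (sin \o (fun y => k%:~R * y))) (k%:~R^-1 *: (cos (k%:~R * x) * k%:~R)).
    by apply: is_deriveZ; apply: is_derive1_comp.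
  apply: is_derive_eq.
  by rewrite -[_ *: _]/(_ * _); field.
have dcos x : is_derive x (1 : R) (fun y => - k%:~R^-1 * cos (k%:~R * y)) (sin (k%:~R * x)).
  have H : is_derive x (1 : R) (- k%:~R^-1 \*: (cos \o (fun y => k%:~R * y))) (- k%:~R^-1 *: (- sin (k%:~R * x) * k%:~R)).
    by apply: is_deriveZ; apply: is_derive1_comp.
  apply: is_derive_eq.
  by rewrite -[_ *: _]/(_ * _); field.
have cc : continuous (fun x : R => cos (k%:~R * x)).
  by move=> x; apply: continuous_comp; [exact: continuous_mulcst|exact: continuous_cos].
have cs : continuous (fun x : R => sin (k%:~R * x)).
  by move=> x; apply: continuous_comp; [exact: continuous_mulcst|exact: continuous_sin].
have [i1 e1] := FTC_itvco tp dsin cc; have [i2 e2] := FTC_itvco tp dcos cs.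
have [c2 s2] := cos_int_2pi k.
rewrite /cintegrable /Cintegral /= e1 e2 c2 s2 !mulr0 sin0 cos0.
by rewrite !mulr0 !subrr.
Qed.

Lemma sin2_half x : sin (x / 2) ^+ 2 = (1 - cos x) / 2.
Proof.
have -> : cos x = cos ((x / 2) *+ 2) by rewrite -mulr_natr divfK// pnatr_eq0.
by rewrite cos_mulr2n cos2sin2 -mulr_natr; field.
Qed.

Lemma continuous_horner_half (W : {poly R}) :
  continuous (fun x : R => W.[(1 - cos x) / 2]).
Proof.
move=> x; apply: (@continuous_comp _ _ _ (fun y : R => (1 - cos y) / 2) (horner W)).
  apply: cvgM; last exact: cvg_cst.
  by apply: cvgB; [exact: cvg_cst|exact: continuous_cos].
by apply: differentiable_continuous; apply/derivable1_diffP; exact: derivable_horner.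
Qed.

(** The substitution [X = (1 - cos y) / 2 = sin (y / 2) ^ 2] has derivative [sin y / 2], whence the
    factor 2. *)
Lemma is_derive_prim_half (W : {poly R}) x :
  is_derive x (1 : R) (fun y => 2 * (poly_prim W).[(1 - cos y) / 2])
    (W.[(1 - cos x) / 2] * sin x).
Proof.
have dh : is_derive x (1 : R) (fun y : R => (1 - cos y) / 2) (sin x / 2).
  have H : is_derive x (1 : R) (2^-1 \*: (cst 1 - @cos R)) (2^-1 *: (0 - - sin x)).
    by apply: is_deriveZ; apply: is_deriveB.
  rewrite (_ : (fun y : R => (1 - cos y) / 2) = (2^-1 \*: (cst 1 - @cos R))); last first.
    by apply/funext => y; rewrite mulrC.
  by apply: is_derive_eq; rewrite -[_ *: _]/(_ * _) sub0r opprK mulrC.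
have H : is_derive x (1 : R) (2 \*: (horner (poly_prim W) \o (fun y => (1 - cos y) / 2)))
   (2 *: ((poly_prim W)^`().[(1 - cos x) / 2] * (sin x / 2))).
  by apply: is_deriveZ; apply: is_derive1_comp.
apply: is_derive_eq; rewrite deriv_poly_prim -[_ *: _]/(_ * _).
by field.
Qed.

Lemma continuous_horner_sin (W : {poly R}) :
  continuous (fun x : R => W.[(1 - cos x) / 2] * sin x).
Proof. by move=> x; apply: cvgM; [exact: continuous_horner_half|exact: continuous_sin]. Qed.

Lemma integral_horner_0pi (W : {poly R}) :
  leb.-integrable `[0, pi[ (EFin \o (fun x => W.[sin (x / 2) ^+ 2] * sin x)) /\
  (\int[leb]_(x in `[0, pi[) (W.[sin (x / 2) ^+ 2] * sin x))%R = 2 * poly_int01 W.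
Proof.
rewrite (_ : (fun x => _ * _) = (fun x => W.[(1 - cos x) / 2] * sin x)); last first.
  by apply/funext => x; rewrite sin2_half.
have [i e] := FTC_itvco (pi_gt0 R) (is_derive_prim_half W) (@continuous_horner_sin W).
split; first exact: i.
rewrite e cospi cos0 subrr mul0r opprK poly_int01_prim -mulrBr.
by have -> : (1 + 1) / 2 = 1 :> R by field.
Qed.

(** On [[pi, 2 * pi[] the sine is nonpositive and [(1 - cos x) / 2] runs back from 1 to 0, so the
    second half contributes as much as the first. *)
Lemma integral_horner_abs_sin (W : {poly R}) :
  leb.-integrable period (EFin \o (fun x => W.[sin (x / 2) ^+ 2] * `|sin x|)) /\
  (\int[leb]_(x in period) (W.[sin (x / 2) ^+ 2] * `|sin x|))%R = 4 * poly_int01 W.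
Proof.
have [i1 e1] := integral_horner_0pi W.
have pp : pi < 2 * pi :> R by have := pi_gt0 R; lra.
have [i2 e2] := FTC_itvco pp (is_derive_prim_half W) (@continuous_horner_sin W).
have e : period = `[0, pi[%classic `|` `[pi, 2 * pi[%classic.
  by apply: itv_bndbnd_setU; rewrite bnd_simp ?pi_ge0// ltW.
have s1 : {in `[0, pi[%classic, (fun x => W.[sin (x / 2) ^+ 2] * sin x) =1
    (fun x => W.[sin (x / 2) ^+ 2] * `|sin x|)}.
  move=> x; rewrite inE /= in_itv /= => /andP[x0 xp].
  by rewrite ger0_norm// sin_ge0_pi// x0 ltW.
have s2 : {in `[pi, 2 * pi[%classic, (fun x => - 1 * (W.[(1 - cos x) / 2] * sin x)) =1
    (fun x => W.[sin (x / 2) ^+ 2] * `|sin x|)}.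
  move=> x; rewrite inE /= in_itv /= => /andP[x0 xp].
  have sx : sin x <= 0.
    have -> : x = (x - pi) + pi by rewrite subrK.
    rewrite sinDpi oppr_le0 sin_ge0_pi//; apply/andP; split; lra.
  by rewrite sin2_half ler0_norm// mulrN mulN1r.
have cW : continuous (fun x : R => W.[sin (x / 2) ^+ 2] * `|sin x|).
  rewrite (_ : (fun x => _ * _) = (fun x => W.[(1 - cos x) / 2] * `|sin x|)).
    move=> x; apply: cvgM; first exact: continuous_horner_half.
    exact: (continuous_comp (@continuous_sin R x) (@norm_continuous _ R^o _)).
  by apply/funext => x; rewrite sin2_half.
have j := @continuous_integrable_itvco _ 0 (2 * pi) cW.
split; first exact: j.
rewrite e in j *; rewrite Rintegral_setU//; last first.
  by apply/disj_setPS => x [] /=; rewrite !in_itv /= => /andP[_ xp] /andP[px _]; lra.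
have r1 := eq_Rintegral leb s1; have r2 := eq_Rintegral leb s2.
rewrite -r1 e1 -r2.
rewrite RintegralZl// e2 poly_int01_prim (_ : 2 * pi = pi *+ 2) ?mulr_natl//.
rewrite cos2pi cospi subrr mul0r opprK.
have -> : (1 + 1) / 2 = 1 :> R by field.
ring.
Qed.

(** Wallis integrals: the recursion integrates the derivative of [sin * cos ^ (2 m + 1)] over a
    period. *)
Lemma integral_cos_even m : (\int[leb]_(x in period) (cos x ^+ (2 * m)))%R =
  2 * pi * \prod_(i < m) ((2 * i + 1)%:R / (2 * i + 2)%:R).
Proof.
elim: m => [|m IH].
  have d1 x : is_derive x (1 : R) id (1 : R) by exact: is_derive_id.
  have [i1 e1] := FTC_itvco two_pi_gt0 d1 (fun x => @cvg_cst _ _ _ _ _).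
  under eq_Rintegral do rewrite muln0 expr0.
  by rewrite e1 big_ord0 mulr1 subr0.
have cX p : continuous (fun x : R => cos x ^+ p).
  by move=> x; apply: (@continuous_comp _ _ _ (@cos R) (fun y => y ^+ p)); [exact: continuous_cos|exact: exprn_continuous].
have iX p : leb.-integrable period (EFin \o (fun x => cos x ^+ p)).
  exact: continuous_integrable_itvco.
have d x : is_derive x (1 : R) (fun y => sin y * cos y ^+ (2 * m).+1)
    ((2 * m + 2)%:R * cos x ^+ (2 * m.+1) - (2 * m + 1)%:R * cos x ^+ (2 * m)).
  have H := is_deriveM (is_derive_sin x) (is_deriveX (2 * m).+1 (is_derive_cos x)).
  rewrite (_ : (fun y => _) = (@sin R * (@cos R ^+ (2 * m).+1))); last first.
    by apply/funext => y; rewrite !fctE.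
  apply: is_derive_eq; rewrite -![_ *: _]/(_ * _) !fctE /=.
  have -> : (2 * m.+1 = (2 * m).+2)%N by lia.
  rewrite !exprS (natrD _ (2 * m) 2) (natrD _ (2 * m) 1) -natr1.
  have := cos2Dsin2 x; rewrite !expr2.
  move: (cos x) (sin x) (cos x ^+ (2 * m)) ((2 * m)%:R) => c s' p q cs.
  have -> : s' * ((q + 1) * p * - s') + c * p * c = (c * c) * p - (q + 1) * p * (s' * s') by ring.
  have -> : s' * s' = 1 - c * c by rewrite -cs; ring.
  ring.
have cd : continuous (fun x : R => (2 * m + 2)%:R * cos x ^+ (2 * m.+1) - (2 * m + 1)%:R * cos x ^+ (2 * m)).
  by move=> x; apply: cvgB; apply: cvgM; [exact: cvg_cst|exact: cX|exact: cvg_cst|exact: cX].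
have [_] := FTC_itvco two_pi_gt0 d cd.
have -> : sin (2 * pi) = 0 :> R by rewrite mulr_natl sin2pi.
rewrite sin0 !mul0r subr0.
have iZ (a : R) p : leb.-integrable period (EFin \o (fun x => a * cos x ^+ p)).
  by apply: (integrableZl _ a (iX p)); exact: measurable_itv.
rewrite RintegralB// !RintegralZl//.
rewrite IH big_ord_recr /= => /eqP; rewrite subr_eq0 => /eqP E.
have h0 : (2 * m + 2)%:R != 0 :> R by rewrite pnatr_eq0 addn2.
by apply: (mulfI h0); rewrite E; field.
Qed.

(** The left-hand side decreases with [m], because [(2m + 1)(2m + 3) <= (2m + 2) ^ 2]. *)
Lemma prod_wallis_le m :
  (\prod_(i < m) ((2 * i + 1)%:R / (2 * i + 2)%:R)) ^+ 2 * (2 * m + 1)%:R <= 1 :> R.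
Proof.
elim: m => [|m IH]; first by rewrite big_ord0 expr1n mul1r.
rewrite big_ord_recr /= exprMn; apply: le_trans IH.
rewrite -mulrA ler_wpM2l ?sqr_ge0// expr_div_n.
rewrite mulrAC ler_pdivrMr ?exprn_gt0 ?ltr0n ?addn2//.
rewrite expr2 -mulrA ler_wpM2l ?ler0n// -natrX -natrM ler_nat; nia.
Qed.

End one_dimensional_integrals.

(** * Cauchy-Schwarz inequality with positive weights *)

Section weighted_cauchy_schwarz.
Variable R : realType.

Lemma sqrD_weighted (a b p q : R) : 0 < p -> 0 < q ->
  (a + b) ^+ 2 <= (p + q) * (a ^+ 2 / p + b ^+ 2 / q).
Proof.
move=> p0 q0; rewrite -subr_ge0.
have -> : (p + q) * (a ^+ 2 / p + b ^+ 2 / q) - (a + b) ^+ 2 =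
    (q * a - p * b) ^+ 2 / (p * q) by field; rewrite !gt_eqF.
by rewrite divr_ge0 ?sqr_ge0// mulr_ge0// ltW.
Qed.

Lemma sqmodD_weighted (x y : R[i]) (p q : R) : 0 < p -> 0 < q ->
  sqmod (x + y) <= (p + q) * (sqmod x / p + sqmod y / q).
Proof.
move=> p0 q0; rewrite !sqmodE ReD ImD.
apply: le_trans (lerD (sqrD_weighted _ _ p0 q0) (sqrD_weighted _ _ p0 q0)) _.
by rewrite -mulrDr !mulrDl addrACA.
Qed.

Lemma sqmod_sum_weighted (I : Type) (s : seq I) (z : I -> R[i]) (r : I -> R) :
  (forall i, 0 < r i) ->
  sqmod (\sum_(i <- s) z i) <= (\sum_(i <- s) r i) * \sum_(i <- s) sqmod (z i) / r i.
Proof.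
move=> r0; elim: s => [|i s IH]; first by rewrite !big_nil sqmod0 mul0r.
(* The two-term inequality divides by the weight of the rest of the list, which is 0 for a
   singleton; that case is treated apart. *)
case: s => [|j s] in IH *.
  by rewrite !big_seq1 mulrCA mulfV ?mulr1// gt_eqF.
rewrite big_cons [in leRHS]big_cons (big_cons _ _ i (_ :: _) _ (fun i => sqmod _ / _)).
set S := \sum_(i <- _) z i in IH *; set P := \sum_(i <- _) r i in IH *.
set Q := \sum_(i <- _) (_ / _) in IH *.
have P0 : 0 < P by rewrite /P big_cons ltr_pwDl// sumr_ge0// => ? _; exact: ltW.
apply: le_trans (sqmodD_weighted _ _ (r0 i) P0) _.
rewrite ler_wpM2l ?addr_ge0 ?(ltW P0) ?(ltW (r0 i))// lerD2l.
by rewrite ler_pdivrMr// mulrC.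
Qed.

Lemma sqmod_sum_size (I : Type) (s : seq I) (z : I -> R[i]) :
  sqmod (\sum_(i <- s) z i) <= (size s)%:R * \sum_(i <- s) sqmod (z i).
Proof.
have := @sqmod_sum_weighted I s z (fun=> 1) (fun=> ltr01).
rewrite big_const_seq count_predT iter_addr_0.
by under [X in _ * X]eq_bigr do rewrite divr1.
Qed.

End weighted_cauchy_schwarz.

(** * Removing the weight |sin| from the norm of a trigonometric polynomial *)

Section trigonometric_polynomials.
Variable R : realType.
Implicit Types (x : R) (j k l : int) (n N : nat).
Local Notation leb := (@lebesgue_measure R).
Local Notation period := (`[0, 2 * pi[%classic : set R).
Local Notation C := R[i].

Let mP : measurable (period : set (measurableTypeR R)).
Proof. exact: measurable_itv. Qed.

Definition chi j (x : measurableTypeR R) : C := expi (j%:~R * x).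

Lemma expiN x : expi (- x) = ((expi x)^*)%C.
Proof. by rewrite /expi cosN sinN. Qed.

Lemma L2_bounded_itv (f : measurableTypeR R -> C) (B : R) : cmeas period f ->
  (forall x, sqmod (f x) <= B) -> L2 leb period f.
Proof.
move=> mf fB; case: (mf) => mr mi; split => //.
have B0 : 0 <= B by apply: le_trans (fB 0); exact: sqmod_ge0.
apply: (@le_lt_trans _ _ (\int[leb]_(x in period) B%:E)%E).
  apply: ge0_le_integral => //; try by move=> x _; rewrite lee_fin ?sqmod_ge0.
    by apply/measurable_EFinP; exact: measurable_sqmod.
have cB : continuous (fun _ : R => B) by move=> x; exact: cvg_cst.
have /integrableP[_] := continuous_integrable_itvco 0 (2 * pi) cB.
by under eq_integral do rewrite /= ger0_norm//.
Qed.

Lemma continuous_cmeas (f : R -> R) (D : set (measurableTypeR R)) : continuous f ->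
  measurable D -> cmeas D (fun x : measurableTypeR R => (f x)%:C%C : C).
Proof.
move=> cf mD; split => /=; last exact: measurable_cst.
by apply: measurable_funTS; exact: continuous_measurable_fun.
Qed.

Lemma cmeas_chi j : cmeas period (chi j).
Proof.
have [[mr mi] _] := Cintegral_expi R j.
by split; apply/measurable_EFinP; [exact: measurable_int mr|exact: measurable_int mi].
Qed.

Lemma L2_chi j : L2 leb period (chi j).
Proof.
by apply: (@L2_bounded_itv _ 1); [exact: cmeas_chi|move=> x; rewrite sqmod_expi].
Qed.

Lemma chi_orth j k :
  innerL2 leb period (chi j) (chi k) = (2 * pi * (j == k)%:R)%:C%C.
Proof.
rewrite /innerL2 (_ : (fun x => _) = chi (j - k)); last first.
  by apply/funext => x; rewrite /chi -expiN -expiD rmorphB /= mulrBl.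
by rewrite /chi (Cintegral_expi R (j - k)).2 subr_eq0.
Qed.

(** Multiplication by this factor turns the norm with weight [|sin|] into a plain norm, to which
    [pythagoras] applies. *)
Definition sqrt_abs_sin (x : measurableTypeR R) : C := (Num.sqrt `|sin x|)%:C%C.

Lemma sqmod_sqrt_abs_sin x : sqmod (sqrt_abs_sin x) = `|sin x|.
Proof. by rewrite sqmod_real sqr_sqrtr. Qed.

Lemma cmeas_sqrt_abs_sin : cmeas period sqrt_abs_sin.
Proof.
apply: continuous_cmeas => // x.
apply: (@continuous_comp _ _ _ (fun x : R => `|sin x|) Num.sqrt).
  exact: (continuous_comp (@continuous_sin R x) (@norm_continuous _ R^o _)).
exact: sqrt_continuous.
Qed.

(* The pointwise inequality [1 <= sqrt M |sin| + cos ^ (2 M)] compares the plain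
   norm with the norm weighted by [|sin|]. *)
Lemma one_le_sin_cos (M : nat) x :
  1 <= Num.sqrt M%:R * `|sin x| + cos x ^+ (2 * M).
Proof.
set y := `|sin x|; have y0 : 0 <= y by exact: normr_ge0.
have y2 : y ^+ 2 = sin x ^+ 2 by rewrite /y real_normK// num_real.
have y1 : y ^+ 2 <= 1 by rewrite y2 -(cos2Dsin2 x) lerDr sqr_ge0.
rewrite exprM cos2sin2 -y2.
have bern : forall m : nat, 1 - m%:R * y ^+ 2 <= (1 - y ^+ 2) ^+ m.
  elim=> [|m IH]; first by rewrite mul0r subr0 expr0.
  rewrite [(1 - _) ^+ _]exprS; apply: (@le_trans _ _ ((1 - y ^+ 2) * (1 - m%:R * y ^+ 2))).
    2: by apply: ler_wpM2l => //; rewrite subr_ge0.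
  rewrite -natr1; have : 0 <= m%:R * (y ^+ 2 * y ^+ 2) by rewrite !mulr_ge0// ?sqr_ge0.
  move: (y ^+ 2) (m%:R) => u v; nra.
(* Bernoulli bounds the cosine term below by [1 - t ^ 2], and [t ^ 2 <= t] when [t <= 1]; for
   [t >= 1] the sine term alone suffices. *)
set t := Num.sqrt M%:R * y.
have t0 : 0 <= t by rewrite mulr_ge0// sqrtr_ge0.
have [t1|/ltW t1] := leP t 1.
  have : t ^+ 2 <= t by rewrite expr2 ler_piMl.
  rewrite /t exprMn sqr_sqrtr// -/t => h; have := bern M; lra.
by rewrite -[leLHS]addr0 lerD// exprn_ge0// subr_ge0.
Qed.

(** The inequality [one_le_sin_cos] is multiplied by the squared modulus of the polynomial and
    integrated. In the cosine term that modulus is replaced by its uniform bound, the number of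
    frequencies times the sum of squared coefficients. *)
Lemma trig_poly_weighted_bound (s : seq int) (c : int -> C) (M : nat) : uniq s ->
  2 * pi * (\sum_(j <- s) sqmod (c j)) <=
  Num.sqrt M%:R * fine (sqnormL2 leb period
     (fun x => (\sum_(j <- s) c j * chi j x) * sqrt_abs_sin x))
  + (size s)%:R * (\sum_(j <- s) sqmod (c j)) *
    (2 * pi * \prod_(i < M) ((2 * i + 1)%:R / (2 * i + 2)%:R)).
Proof.
move=> us; set S := \sum_(j <- s) _.
pose g (x : measurableTypeR R) := \sum_(j <- s) c j * chi j x.
have S0 : 0 <= S by apply: sumr_ge0 => j _; exact: sqmod_ge0.
have mg : cmeas period g.
  by apply: cmeas_sum => j; apply: cmeasZ; exact: cmeas_chi.
have gB x : sqmod (g x) <= (size s)%:R * S.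
  apply: le_trans (sqmod_sum_size _ _) _; rewrite ler_wpM2l// ler_sum// => j _.
  by rewrite sqmodM sqmod_expi mulr1.
have ng : sqnormL2 leb period g = (2 * pi * S)%:E.
  exact: (pythagoras0 mP L2_chi chi_orth).
pose cM (x : measurableTypeR R) : C := (cos x ^+ M)%:C%C.
have mcM : cmeas period cM.
  apply: continuous_cmeas => // x; apply: (@continuous_comp _ _ _ (@cos R) (fun y => y ^+ M)).
    exact: continuous_cos.
  exact: exprn_continuous.
have ncM : sqnormL2 leb period cM =
    (2 * pi * \prod_(i < M) ((2 * i + 1)%:R / (2 * i + 2)%:R))%:E.
  rewrite -integral_cos_even /sqnormL2 /Rintegral fineK.
    by apply: eq_integral => x _; rewrite sqmod_real -exprM mulnC.
  have cc : continuous (fun x : R => cos x ^+ (2 * M)).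
    move=> x; apply: (@continuous_comp _ _ _ (@cos R) (fun y => y ^+ (2 * M))).
      exact: continuous_cos.
    exact: exprn_continuous.
  exact: (integrable_fin_num mP (continuous_integrable_itvco 0 (2 * pi) cc)).
have Lgs : L2 leb period (fun x => g x * sqrt_abs_sin x).
  apply: (@L2_bounded_itv _ ((size s)%:R * S)).
    exact: cmeasM mg cmeas_sqrt_abs_sin.
  move=> x; rewrite sqmodM sqmod_sqrt_abs_sin; apply: le_trans (gB x).
  rewrite ler_piMr ?sqmod_ge0// ler_norml sin_geN1 sin_le1//.
rewrite -lee_fin EFinD [X in (_ <= X + _)%E]EFinM (sqnormL2_fin Lgs).
rewrite [X in (_ <= _ + X)%E]EFinM -ncM -ng.
apply: le_sqnormL2 => //.
- exact: mulr_ge0.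
- exact: L2_cmeas Lgs.
move=> x _; rewrite sqmodM sqmod_sqrt_abs_sin sqmod_real -exprM (mulnC M).
apply: (@le_trans _ _ (sqmod (g x) * (Num.sqrt M%:R * `|sin x| + cos x ^+ (2 * M)))).
  by rewrite -[leLHS]mulr1 ler_wpM2l ?sqmod_ge0// one_le_sin_cos.
by rewrite mulrDr mulrCA lerD// ler_wpM2r// exprM exprn_ge0// sqr_ge0.
Qed.

End trigonometric_polynomials.

(** * The matrix operator on degrees below N *)

Section block_bound.
Variable R : realType.
Implicit Types (x : R) (j k l : int) (n N : nat).
Local Notation leb := (@lebesgue_measure R).
Local Notation period := (`[0, 2 * pi[%classic : set R).
Local Notation C := R[i].

Let mP : measurable (period : set (measurableTypeR R)).
Proof. exact: measurable_itv. Qed.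

(** Entry of the matrix operator without the power of the imaginary unit; the value 0 below the
    summation range lets all sums start at 0 and run over common boxes. *)
Definition dfsker n k j l : R :=
  if (maxn (maxn (absz k) (absz l)) (absz j) <= n)%N
  then Num.sqrt (2 * n + 1)%:R * wignerd n j k 0 * wignerd n j l 0 else 0.

Lemma dfsker_out n k j l : (n < maxn (maxn (absz k) (absz l)) (absz j))%N ->
  dfsker n k j l = 0.
Proof. by rewrite /dfsker ltnNge => /negPf ->. Qed.

Definition freqs N : seq int := [seq w%:Z - N%:Z | w <- index_iota 0 (2 * N).+1].

Lemma uniq_freqs N : uniq (freqs N).
Proof. by rewrite map_inj_uniq ?iota_uniq// => a b; lia. Qed.

Lemma size_freqs N : size (freqs N) = (2 * N).+1.
Proof. by rewrite size_map size_iota subn0. Qed.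

Lemma mem_freqs N j : (j \in freqs N) = (absz j <= N)%N.
Proof.
apply/mapP/idP => [[w]|jN].
  by rewrite mem_index_iota => /andP[_ wN] ->; lia.
by exists (absz (j + N%:Z)); [rewrite mem_index_iota; lia|lia].
Qed.

(** The signs of [k] and [l] follow the operator, which reads the coefficient of index [(-k, -l)]
    for the frequencies [k, l]. *)
Definition halfd_tilde n k l x : R :=
  Num.sqrt (2 * n + 1)%:R * halfd n (- k) (- l) (cos (x / 2)) (sin (x / 2)).

Lemma halfd_tilde_freqs n N k l x : (n <= N)%N ->
  (absz k <= n)%N -> (absz l <= n)%N ->
  (halfd_tilde n k l x)%:C%C =
  'i%C ^ (k - l) * \sum_(j <- freqs N) (dfsker n k j l)%:C%C * expi (j%:~R * x).
Proof.
move=> nN kn ln; rewrite /halfd_tilde rmorphM /= halfd_trig// mulrCA; congr (_ * _).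
rewrite big_map.
rewrite (@big_cat_nat _ _ _ (N - n)%N)//=; last by lia.
rewrite (@big_cat_nat _ _ _ (N + n).+1 (N - n)%N)//=; try lia.
rewrite [X in _ = X + _]big_nat [X in _ = X + _]big1 => [|w /andP[_ wN]]; last first.
  by rewrite dfsker_out ?mul0r//; lia.
rewrite add0r [X in _ = _ + X]big_nat [X in _ = _ + X]big1 => [|w /andP[wN _]]; last first.
  by rewrite dfsker_out ?mul0r//; lia.
rewrite addr0 -{1}[(N - n)%N]add0n big_addn.
have -> : ((N + n).+1 - (N - n) = (2 * n).+1)%N by lia.
rewrite big_mkord mulr_sumr; apply: eq_bigr => -[w /= wn] _.
have -> : (w + (N - n))%:Z - N%:Z = w%:Z - n%:Z by lia.
rewrite /dfsker ifT; last by lia.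
by rewrite [LHS]mulrA -rmorphM /= mulrA.
Qed.

Lemma sqr_i_expz (m : int) : sqmod (('i%C : C) ^ m) = 1.
Proof.
have h (p : nat) : sqmod (('i%C : C) ^+ p) = 1.
  elim: p => [|p IH]; first by rewrite expr0 sqmodE /= expr1n expr0n addr0.
  by rewrite exprS sqmodM IH mulr1 sqmodE /= expr0n expr1n add0r.
case: m => p; first exact: h.
have i0 : ('i%C : C) ^+ p.+1 != 0 by rewrite expf_neq0// -sqrf_eq0 sqr_i oppr_eq0 oner_eq0.
have := congr1 (@sqmod R) (mulfV i0); rewrite sqmodM h mul1r.
by rewrite -[X in _ = X]/(sqmod (1%:C%C)) sqmod_real expr1n.
Qed.

Definition halfd_weighted k l n (x : measurableTypeR R) : C :=
  (if (maxn (absz k) (absz l) <= n)%N then halfd_tilde n k l x else 0)%:C%C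
    * sqrt_abs_sin x.

(** Each half of the period contributes [2 / (2 n + 1)] to the squared norm of [halfd]; the
    normalising factor [2 n + 1] leaves the constant 4, independent of [n, k, l]. *)
Lemma halfd_weighted_int k l n n' : (maxn (absz k) (absz l) <= n)%N ->
  (maxn (absz k) (absz l) <= n')%N ->
  cintegrable leb period (fun x => halfd_weighted k l n x * (halfd_weighted k l n' x)^*%C) /\
  innerL2 leb period (halfd_weighted k l n) (halfd_weighted k l n') = (4 * (n == n')%:R)%:C%C.
Proof.
move=> kln kln'; rewrite /innerL2.
have [||||W WE Wi] := @halfd_orth R n n' (- k) (- l); try by rewrite abszN; lia.
pose K := Num.sqrt (2 * n + 1)%:R * Num.sqrt (2 * n' + 1)%:R : R.
have E : (fun x => halfd_weighted k l n x * (halfd_weighted k l n' x)^*%C) =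
    (fun x => (K * (W.[sin (x / 2) ^+ 2] * `|sin x|))%:C%C).
  apply/funext => x; rewrite /halfd_weighted kln kln' -(WE _ _ (cos2Dsin2 (x / 2))).
  have cr (a b : R) : ((a%:C * b%:C)^*)%C = (a%:C * b%:C)%C.
    by rewrite -rmorphM; exact: conjc_real.
  rewrite cr -!rmorphM /=; congr (_%:C)%C.
  have ss : Num.sqrt `|sin x| * Num.sqrt `|sin x| = `|sin x| by rewrite -expr2 sqr_sqrtr.
  by rewrite -[X in _ = _ * (_ * X)]ss /halfd_tilde /K; ring.
rewrite E.
have [iW eW] := integral_horner_abs_sin W.
have iK : leb.-integrable period (EFin \o (fun x => K * (W.[sin (x / 2) ^+ 2] * `|sin x|))).
  by apply: (integrableZl _ K iW); exact: mP.
split; first by split => //=; exact: integrable0.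
rewrite /Cintegral /= RintegralZl// eW Wi.
have -> : (\int[leb]_(x in period) (0 : R))%R = 0 by rewrite /Rintegral integral0.
congr (_%:C)%C; rewrite /K; case: eqP => [<-|_]; last by rewrite !mul0r !mulr0.
have v0 : (2 * n + 1)%:R != 0 :> R by rewrite pnatr_eq0 addn1.
by rewrite -expr2 sqr_sqrtr// mulr1 mul1r mulrCA mulfV ?mulr1.
Qed.

Lemma continuous_halfd_tilde n k l : continuous (halfd_tilde n k l).
Proof.
have ch : continuous (fun x : R => x / 2) by move=> x; apply: cvgM; [exact: cvg_id|exact: cvg_cst].
have cc : continuous (fun x : R => cos (x / 2)).
  by move=> x; apply: (@continuous_comp _ _ _ (fun x : R => x / 2) (@cos R)); [exact: ch|exact: continuous_cos].
have cs : continuous (fun x : R => sin (x / 2)).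
  by move=> x; apply: (@continuous_comp _ _ _ (fun x : R => x / 2) (@sin R)); [exact: ch|exact: continuous_sin].
have cX (f : R -> R) m : continuous f -> continuous (fun x => f x ^+ m).
  by move=> cf x; apply: (@continuous_comp _ _ _ f (fun y : R => y ^+ m)); [exact: cf|exact: exprn_continuous].
move=> x; rewrite /halfd_tilde /halfd.
apply: cvgM; first exact: cvg_cst.
apply: cvgM; last first.
  apply: (@continuous_comp _ _ _ (fun x : R => cos (x / 2) ^+ 2 - sin (x / 2) ^+ 2) (horner (jacobi R _ _ _))).
    by apply: cvgB; apply: cX.
  by apply: differentiable_continuous; apply/derivable1_diffP; exact: derivable_horner.
apply: cvgM; last by apply: cX.
by apply: cvgM; [exact: cvg_cst|apply: cX].
Qed.

Lemma cmeas_halfd_weighted k l n : cmeas period (halfd_weighted k l n).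
Proof.
apply: cmeasM; last exact: cmeas_sqrt_abs_sin.
case: (maxn _ _ <= n)%N; last exact: cmeas_cst.
by apply: continuous_cmeas => //; exact: continuous_halfd_tilde.
Qed.

Lemma L2_halfd_weighted k l n : (maxn (absz k) (absz l) <= n)%N ->
  L2 leb period (halfd_weighted k l n).
Proof.
move=> kln; have [mr mi] := cmeas_halfd_weighted k l n; split => //.
have [[/integrableP[_ +] _] _] := halfd_weighted_int kln kln.
move=> h; apply: le_lt_trans h; rewrite le_eqVlt; apply/orP; left; apply/eqP.
by apply: eq_integral => x _; rewrite /comp mul_conj /= ger0_norm ?sqmod_ge0.
Qed.

(** For fixed [k, l] the inner sums are, up to a power of the imaginary unit, the Fourier
    coefficients of the combination of the [halfd_tilde n k l] with coefficients [c n].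
    Orthogonality gives its norm with weight [|sin|], and [trig_poly_weighted_bound] removes the
    weight. *)
Lemma dfsker_block k l N (c : nat -> C) :
  \sum_(j <- freqs N) sqmod (\sum_(0 <= n < N) (dfsker n k j l)%:C%C * c n) <=
  3 * (2 * N).+1%:R * \sum_(0 <= n < N) sqmod (c n).
Proof.
pose mx := maxn (absz k) (absz l).
pose G j := \sum_(0 <= n < N) (dfsker n k j l)%:C%C * c n.
pose T := \sum_(0 <= n < N) sqmod (c n).
pose S := \sum_(j <- freqs N) sqmod (G j).
have T0 : 0 <= T by apply: sumr_ge0 => n _; exact: sqmod_ge0.
have S0 : 0 <= S by apply: sumr_ge0 => n _; exact: sqmod_ge0.
(* The weighted functions vanish below degree [mx] instead of having squared norm 4, so the
   orthogonal family is indexed by [p = n - mx]. *)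
have shift (V : nmodType) (F : nat -> V) : (forall n, (n < mx)%N -> F n = 0) ->
    \sum_(0 <= n < N) F n = \sum_(p <- index_iota 0 (N - mx)) F (mx + p)%N.
  move=> F0; have [mN|Nm] := leqP mx N.
    rewrite (@big_cat_nat _ _ _ mx)//= big_nat big1 => [|n /andP[_ nm]]; last exact: F0.
    by rewrite add0r -{1}[mx]add0n big_addn; apply: eq_bigr => p _; rewrite addnC.
  have -> : (N - mx = 0)%N by lia.
  rewrite [RHS]big_geq// big_nat big1 // => n /andP[_ nN]; apply: F0.
  exact: ltn_trans nN Nm.
have gE (x : measurableTypeR R) : (\sum_(j <- freqs N) G j * chi j x) * sqrt_abs_sin x =
    ('i%C ^ (k - l))^-1 *
    \sum_(p <- index_iota 0 (N - mx)) c (mx + p)%N * halfd_weighted k l (mx + p) x.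
  have i0 : ('i%C : C) ^ (k - l) != 0.
    by rewrite expfz_neq0// -sqrf_eq0 sqr_i oppr_eq0 oner_eq0.
  apply: (mulfI i0); rewrite [RHS]mulrA mulfV// mul1r.
  rewrite -(shift _ (fun n => c n * halfd_weighted k l n x)); last first.
    by move=> n nm; rewrite /halfd_weighted leqNgt nm mul0r mulr0.
  rewrite mulrA; under [RHS]eq_bigr do rewrite /halfd_weighted mulrA.
  rewrite -mulr_suml; congr (_ * _).
  under eq_bigr do rewrite /G mulr_suml.
  rewrite exchange_big /= mulr_sumr; rewrite [RHS]big_nat [LHS]big_nat.
  apply: eq_bigr => n /andP[_ nN]; case: leqP => mn.
    rewrite (@halfd_tilde_freqs n N)//; try by move: mn; rewrite geq_max => /andP[].
      rewrite mulrCA; congr (_ * _); rewrite mulr_sumr; apply: eq_bigr => j _.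
      by rewrite /chi; ring.
    exact: ltnW.
  rewrite mulr0 big1 ?mulr0// => j _.
  by rewrite dfsker_out ?mul0r// (leq_trans mn)// leq_max leqnn.
have Le p : L2 leb period (halfd_weighted k l (mx + p)).
  by apply: L2_halfd_weighted; exact: leq_addr.
have orth p q : innerL2 leb period (halfd_weighted k l (mx + p)) (halfd_weighted k l (mx + q)) =
    (4 * (p == q)%:R)%:C%C.
  by rewrite (halfd_weighted_int _ _).2 ?leq_addr// eqn_add2l.
have nE : sqnormL2 leb period (fun x => (\sum_(j <- freqs N) G j * chi j x) * sqrt_abs_sin x) =
    (4 * \sum_(p <- index_iota 0 (N - mx)) sqmod (c (mx + p)%N))%:E.
  have pyt := pythagoras0 mP Le orth (fun p => c (mx + p)%N) (iota_uniq 0 (N - mx - 0)).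
  have Ls : L2 leb period (fun x => \sum_(p <- index_iota 0 (N - mx)) c (mx + p)%N * halfd_weighted k l (mx + p) x).
    by apply: L2_sum => // p; apply: L2Z.
  rewrite -pyt (_ : (fun x => _) = (fun x => ('i%C ^ (k - l))^-1 *
    \sum_(p <- index_iota 0 (N - mx)) c (mx + p)%N * halfd_weighted k l (mx + p) x)).
    rewrite sqnormL2Z//; last exact: L2_cmeas Ls.
    by rewrite invr_expz sqr_i_expz mul1e.
  by apply/funext => x; exact: gE.
set T' := \sum_(p <- index_iota 0 (N - mx)) sqmod (c (mx + p)%N) in nE.
have T'T : T' <= T.
  have -> : T' = \sum_(0 <= n < N) (if (mx <= n)%N then sqmod (c n) else 0).
    rewrite shift; first by apply: eq_bigr => p _; rewrite leq_addr.
    by move=> n nm; rewrite leqNgt nm.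
  by apply: ler_sum => n _; case: ifP => // _; exact: sqmod_ge0.
(* With this [M] the Wallis product is at most [1 / (2 P)], so the cosine term is at most [pi * S],
   half of the left-hand side. Since [sqrt M <= 3 / 2 * P], this leaves [pi * S <= 6 * P * T], and
   [pi >= 2] gives the constant 3. *)
pose P := (2 * N).+1; pose M := (2 * P ^ 2)%N.
have := @trig_poly_weighted_bound R (freqs N) G M (uniq_freqs N).
rewrite nE [fine _]/= size_freqs -/P -/S.
set W := \prod_(i < M) _ => bnd.
have W0 : 0 <= W by apply: prodr_ge0 => i _; rewrite divr_ge0.
have P0 : 0 < P%:R :> R by rewrite ltr0n.
have WP : W * (2 * P%:R) <= 1.
  have WP0 : 0 <= W * (2 * P%:R) by rewrite !mulr_ge0// ltW.
  rewrite -(expr_le1 (n := 2))//.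
  apply: le_trans (prod_wallis_le R M); rewrite exprMn ler_wpM2l ?sqr_ge0//.
  rewrite -natrM -natrX ler_nat /M; lia.
have sM : Num.sqrt M%:R <= 3 / 2 * P%:R :> R.
  rewrite -[leRHS]ger0_norm ?mulr_ge0// -sqrtr_sqr ler_sqrt ?sqr_ge0//.
  rewrite exprMn /M natrM natrX ler_wpM2r ?sqr_ge0//; lra.
have p2 : 2 <= pi :> R by have := @pihalf_ge1 R; lra.
have PT0 : 0 <= P%:R * T by rewrite mulr_ge0// ltW.
have b1 : Num.sqrt M%:R * (4 * T') <= 3 / 2 * P%:R * (4 * T).
  by apply: ler_pM => //; rewrite ?sqrtr_ge0 ?mulr_ge0//; [apply: sumr_ge0 => p _; exact: sqmod_ge0|lra].
have b2 : P%:R * S * (2 * pi * W) <= pi * S.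
  have -> : P%:R * S * (2 * pi * W) = pi * S * (W * (2 * P%:R)) by ring.
  by rewrite -[leRHS]mulr1 ler_wpM2l// mulr_ge0// ltW// pi_gt0.
have b3 : 2 * S <= pi * S by rewrite ler_wpM2r.
rewrite -/T -/S in bnd *.
have -> : 3 * P%:R * T = 3 * (P%:R * T) by rewrite mulrA.
move: bnd b1 b2 b3.
have -> : 3 / 2 * P%:R * (4 * T) = 6 * (P%:R * T) by field.
have -> : 2 * pi * S = 2 * (pi * S) by rewrite mulrA.
lra.
Qed.

End block_bound.

(** * Boundedness of the matrix operator *)

Lemma ler_sum_uniq (R : realType) (I : eqType) (s1 s2 : seq I) (F : I -> R) :
  uniq s1 -> uniq s2 -> (forall i, 0 <= F i) ->
  (forall i, i \in s1 -> i \notin s2 -> F i = 0) ->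
  \sum_(i <- s1) F i <= \sum_(i <- s2) F i.
Proof.
move=> u1 u2 F0 F12.
have -> : \sum_(i <- s1) F i = \sum_(i <- [seq j <- s1 | j \in s2]) F i.
  rewrite big_filter [RHS]big_mkcond [LHS]big_seq [RHS]big_seq.
  by apply: eq_bigr => i i1; case: (boolP (i \in s2)) => //; exact: F12.
rewrite (perm_big [seq j <- s2 | j \in s1]); last first.
  by apply: uniq_perm; rewrite ?filter_uniq// => i; rewrite !mem_filter andbC.
rewrite big_filter big_mkcond; apply: ler_sum => i _.
by case: ifP => _; rewrite ?lexx ?F0.
Qed.

Section real_esum.
Context (I : choiceType) (R : realType).
Variable a : I -> R.
Hypothesis a0 : forall i, 0 <= a i.
Local Notation S := (\esum_(i in [set: I]) (a i)%:E)%E.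

Lemma sum_le_esum (s : seq I) : uniq s -> ((\sum_(i <- s) a i)%:E <= S)%E.
Proof.
move=> us; apply: esum_ge; exists [set` s]; first by split.
rewrite fsbig_finite//= sumEFin lee_fin le_eqVlt; apply/orP; left; apply/eqP.
apply: perm_big; apply: uniq_perm => // i.
by rewrite in_fset_set// mem_setE.
Qed.

Lemma esum_le_sum (B : R) :
  (forall s : seq I, uniq s -> \sum_(i <- s) a i <= B) -> (S <= B%:E)%E.
Proof.
move=> sB; apply: ub_ereal_sup => _ [A [finA _] <-].
by rewrite fsbig_finite//= sumEFin lee_fin; exact: sB.
Qed.

Lemma esum_fineK : (S < +oo)%E -> (fine S)%:E = S.
Proof.
by move=> Soo; rewrite fineK// ge0_fin_numE// esum_ge0// => i _; rewrite lee_fin.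
Qed.

Lemma sum_le_fine_esum (s : seq I) : (S < +oo)%E -> uniq s ->
  \sum_(i <- s) a i <= fine S.
Proof. by move=> Soo us; rewrite -lee_fin esum_fineK// sum_le_esum. Qed.

(** A finite set whose sum is within [e] of the supremum works: adjoining disjoint terms cannot
    exceed the supremum. *)
Lemma esum_tail (e : R) : (S < +oo)%E -> 0 < e ->
  exists2 s0 : seq I, uniq s0 & forall s : seq I, uniq s ->
    (forall i, i \in s -> i \notin s0) -> \sum_(i <- s) a i <= e.
Proof.
move=> Soo e0.
have Sfin : S \is a fin_num by rewrite -(esum_fineK Soo).
have [_ [A [finA _] <-]] := ub_ereal_sup_adherent e0 Sfin.
rewrite -/(esum _ _) fsbig_finite//= sumEFin => SA.
exists (fset_set A) => // s us sA.
have := sum_le_esum (s := fset_set A ++ s).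
rewrite cat_uniq fset_uniq us andbT /= => /(_ _) h.
have {}h := h ltac:(by apply/hasPn => i /sA).
rewrite big_cat /= in h.
move: SA h; rewrite -(esum_fineK Soo) -EFinB lte_fin lee_fin; lra.
Qed.

End real_esum.

(** * Summation over dyadic blocks of degrees *)

Section dyadic.
Variable R : realType.
Variable s : R.
Hypothesis s_gt : 2^-1 < s.

Definition hsw (n : nat) : R := (1 + n * (n + 1))%:R `^ s.

Lemma hsw_ge0 n : 0 <= hsw n.
Proof. exact: powR_ge0. Qed.

(** Ratio between the growth 2 of the block constant and the growth [4 ^ s] of the Sobolev weight
    from one dyadic block to the next; it is below 1 exactly when [s > 1/2]. *)
Let rho : R := 2 / (4 `^ s).

Let four_gt0 : 0 < 4 `^ s :> R. Proof. exact: powR_gt0. Qed.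

Let rho_gt0 : 0 < rho. Proof. by rewrite divr_gt0. Qed.

Let rho_lt1 : rho < 1.
Proof.
rewrite ltr_pdivrMr// mul1r.
have E : 4 `^ (2^-1) = 2 :> R.
  by rewrite powR12_sqrt// (_ : 4 = 2 ^+ 2) ?sqrtr_sqr ?ger0_norm// -natrX.
have t0 : 0 < s - 2^-1 by rewrite subr_gt0.
have -> : s = 2^-1 + (s - 2^-1) by rewrite addrC subrK.
rewrite powRD; last by apply/implyP => _; rewrite pnatr_eq0.
have one : 1 `^ (s - 2^-1) = 1 :> R by rewrite powR1.
rewrite E -[ltLHS]mulr1 ltr_pM2l// -[ltLHS]one.
by apply: gt0_ltr_powR => //; rewrite ?nnegrE// ltr1n.
Qed.

(** The left-hand side is [(4 ^ b) ^ s], and [4 ^ b <= (n + 1) ^ 2 <= 2 * (1 + n * (n + 1))]. *)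
Lemma hsw_block n b : (trunc_log 2 n.+1 = b)%N ->
  (2 ^ b)%:R / rho ^+ b <= 2 `^ s * hsw n.
Proof.
move=> nb; have : (2 ^ b <= n.+1)%N by rewrite -nb; apply: trunc_logP.
move=> bn; rewrite /rho expr_div_n natrX invf_div mulrCA mulfV ?mulr1; last first.
  by rewrite expf_neq0// pnatr_eq0.
rewrite -powR_mulrn ?powR_ge0// powRAC powR_mulrn// /hsw -powRM//.
have s0 : 0 <= s by move: s_gt; lra.
apply: ge0_ler_powR => //; rewrite ?nnegrE ?mulr_ge0 ?exprn_ge0//.
rewrite -natrX -natrM ler_nat.
have : (2 ^ b * 2 ^ b <= n.+1 * n.+1)%N by exact: leq_mul.
rewrite -expnD addnn -mul2n expnM -[(2 ^ 2)%N]/4%N => h; apply: (leq_trans h); nia.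
Qed.

Lemma sum_geo_le N : \sum_(0 <= b < N) rho ^+ b <= (1 - rho)^-1.
Proof.
have r1 : 0 < 1 - rho by rewrite subr_gt0.
rewrite -[leRHS]mul1r ler_pdivlMr// mulrC big_mkord -opprB mulNr -subrX1 opprB.
by rewrite gerBl exprn_ge0// ltW.
Qed.

Lemma dfsker_block_sub k l N (c : nat -> R[i]) (js : seq int) : uniq js ->
  \sum_(j <- js) sqmod (\sum_(0 <= n < N) (dfsker R n k j l)%:C%C * c n) <=
  3 * (2 * N).+1%:R * \sum_(0 <= n < N) sqmod (c n).
Proof.
move=> uj; apply: le_trans (dfsker_block k l N c).
apply: ler_sum_uniq => //; first exact: uniq_freqs.
  by move=> j; exact: sqmod_ge0.
move=> j _; rewrite mem_freqs -ltnNge => Nj.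
rewrite big_nat big1 ?sqmod0// => n /andP[_ nN].
by rewrite dfsker_out ?mul0r//; lia.
Qed.

(** The number 15 comes from [3 * (2 * 2 ^ (b + 1) + 1) <= 15 * 2 ^ b], the power of 2 from
    [hsw_block], and the denominator from the sum of the geometric weights. *)
Definition dfs_const : R := 15 * 2 `^ s / (1 - rho).

Lemma dfs_const_ge0 : 0 <= dfs_const.
Proof. by rewrite divr_ge0 ?mulr_ge0 ?powR_ge0// subr_ge0 ltW. Qed.

(* Dyadic blocks in [n] are summed by a Cauchy-Schwarz inequality with geometric
   weights [rho ^ b]; [rho < 1] because [s > 1/2]. *)
Lemma dfsker_bound k l N (c : nat -> R[i]) (js : seq int) : uniq js ->
  \sum_(j <- js) sqmod (\sum_(0 <= n < N) (dfsker R n k j l)%:C%C * c n) <=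
  dfs_const * \sum_(0 <= n < N) hsw n * sqmod (c n).
Proof.
move=> uj.
(* The successor puts degree 0 into block 0; block [b] consists of the [n] with
   [2 ^ b <= n + 1 < 2 ^ (b + 1)]. *)
pose blk n := trunc_log 2 n.+1.
have blkN n : (n < N)%N -> (blk n < N.+1)%N.
  move=> nN; rewrite ltnS; have := @trunc_logP 2 n.+1 isT isT; rewrite -/(blk n).
  move=> h; have := ltn_expl (blk n) (ltnSn 1); lia.
have split_blk (V : nmodType) (F : nat -> V) : \sum_(0 <= n < N) F n =
    \sum_(0 <= b < N.+1) \sum_(0 <= n < N | blk n == b) F n.
  rewrite [RHS](exchange_big_dep xpredT)//= big_nat [RHS]big_nat; apply: eq_bigr => n /andP[_ nN].
  rewrite big_mkcond (bigD1_seq (blk n)) ?iota_uniq ?mem_index_iota//=; last exact: blkN.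
  by rewrite eqxx big1 ?addr0// => b; rewrite eq_sym => /negPf ->.
(* Cutting the coefficients to block [b] makes [dfsker_block_sub] applicable with the bound
   [2 ^ (b + 1)] on degrees, whatever [N] is. *)
pose cb b n := if (blk n == b) && (n < N)%N then c n else 0.
pose z b j := \sum_(0 <= n < 2 ^ b.+1) (dfsker R n k j l)%:C%C * cb b n.
have widen (V : nmodType) b (F : nat -> V) :
    \sum_(0 <= n < N | blk n == b) F n =
    \sum_(0 <= n < 2 ^ b.+1) (if (blk n == b) && (n < N)%N then F n else 0).
  rewrite -big_mkcond /= (big_nat_widen 0 N (N + 2 ^ b.+1)) ?leq_addr//.
  rewrite [RHS](big_nat_widen 0 _ (N + 2 ^ b.+1)) ?leq_addl//.
  apply: eq_bigl => n; case: eqP => //= nb; case: (n < N)%N => //=.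
  have := @trunc_log_ltn 2 n.+1 isT; rewrite -/(blk n) nb => h; apply/esym; lia.
have zE j : \sum_(0 <= n < N) (dfsker R n k j l)%:C%C * c n = \sum_(0 <= b < N.+1) z b j.
  rewrite split_blk; apply: eq_bigr => b _; rewrite widen; apply: eq_bigr => n _.
  by rewrite /cb; case: ifP; rewrite ?mulr0.
have step1 j : sqmod (\sum_(0 <= n < N) (dfsker R n k j l)%:C%C * c n) <=
    (1 - rho)^-1 * \sum_(0 <= b < N.+1) sqmod (z b j) / rho ^+ b.
  rewrite zE; apply: le_trans (sqmod_sum_weighted _ _ _) _; first by move=> b; exact: exprn_gt0 rho_gt0.
  apply: ler_wpM2r; last exact: sum_geo_le.
  by apply: sumr_ge0 => b _; rewrite divr_ge0 ?sqmod_ge0// exprn_ge0// ltW.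
apply: le_trans (ler_sum _ (fun j _ => step1 j)) _.
rewrite -mulr_sumr exchange_big /= /dfs_const mulrAC -mulrA -[leRHS]mulrA mulrC [leRHS]mulrA.

rewrite [leRHS]mulrA ler_wpM2r ?invr_ge0 ?subr_ge0 ?(ltW rho_lt1)// split_blk mulr_sumr.
apply: ler_sum => b _; rewrite -mulr_suml.
apply: le_trans (ler_wpM2r _ (dfsker_block_sub k l (2 ^ b.+1) (cb b) uj)) _.
  by rewrite invr_ge0 exprn_ge0// ltW.
rewrite (_ : \sum_(0 <= n < 2 ^ b.+1) sqmod (cb b n) = \sum_(0 <= n < N | blk n == b) sqmod (c n)); last first.
  by rewrite widen; apply: eq_bigr => n _; rewrite /cb; case: ifP; rewrite ?sqmod0.
rewrite [leLHS]mulrAC [leLHS]mulr_sumr [leRHS]mulr_sumr; apply: ler_sum => n /eqP nb.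
rewrite [leRHS]mulrA ler_wpM2r ?sqmod_ge0//.
apply: (@le_trans _ _ (15 * (2 ^ b)%:R / rho ^+ b)).
  rewrite ler_wpM2r ?invr_ge0 ?exprn_ge0 ?(ltW rho_gt0)//.
  rewrite -!natrM ler_nat expnS; have := expn_gt0 2 b; lia.
by rewrite -!mulrA ler_wpM2l// hsw_block.
Qed.

End dyadic.

(** * Convergence of complex sequences through squared moduli *)

Section complex_sequences.
Variable R : realType.
Implicit Types (u : nat -> R[i]^o) (l : R[i]).

(** Convergence with a real tolerance: the norm of [R[i]] takes values in [R[i]], whereas all
    estimates here are on the real number [sqmod]. *)
Definition cconv u l := forall e : R, 0 < e ->
  exists m0, forall m, (m0 <= m)%N -> sqmod (u m - l) <= e.

Lemma cconv_cvg u l : cconv u l -> u @ \oo --> (l : R[i]^o).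
Proof.
move=> ul; apply/cvgrPdist_lt => e e0.
have [r r0 ->] : exists2 r : R, 0 < r & e = r%:C%C.
  by case: e e0 => a b; rewrite ltcE /= => /andP[/eqP bE a0]; exists a; rewrite ?bE // -bE.
have [m0 um0] := ul (r ^+ 2 / 2) ltac:(by rewrite divr_gt0// exprn_gt0).
exists m0 => // m /= /um0 h.
rewrite distrC (_ : `|_| = (Normc.normc (u m - l))%:C%C)// ltcR.
have N0 : 0 <= Normc.normc (u m - l) by case: (u m - l) => a b; exact: sqrtr_ge0.
rewrite -(ltr_pXn2r (n := 2)) ?nnegrE ?(ltW r0)//.
apply: le_lt_trans h _; rewrite ltr_pdivrMr// ltr_pMr ?exprn_gt0//.
by rewrite ltr1n.
Qed.

Lemma cconv_lim u l : cconv u l -> limn u = l.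
Proof. by move/cconv_cvg/cvg_lim; apply; exact: norm_hausdorff. Qed.

Lemma real_cauchy_cvg (v : nat -> R) :
  (forall e : R, 0 < e -> exists m0, forall m, (m0 <= m)%N -> `|v m - v m0| <= e) ->
  exists l : R, v @ \oo --> l.
Proof.
move=> cv; suff : cvgn v by move=> /cvg_ex.
apply/cauchy_cvgP/cauchy_exP => e e0.
have [m0 vm0] := cv (e / 2) ltac:(by rewrite divr_gt0).
exists (v m0); exists m0 => // m /= /vm0 h; rewrite /ball /= distrC.
by apply: le_lt_trans h _; rewrite ltr_pdivrMr// ltr_pMr// ltr1n.
Qed.

Lemma sqmod_Re_le (z : R[i]) : complex.Re z ^+ 2 <= sqmod z.
Proof. by rewrite sqmodE lerDl sqr_ge0. Qed.

Lemma sqmod_Im_le (z : R[i]) : complex.Im z ^+ 2 <= sqmod z.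
Proof. by rewrite sqmodE lerDr sqr_ge0. Qed.

Lemma cauchy_cconv u :
  (forall e : R, 0 < e -> exists m0, forall m, (m0 <= m)%N -> sqmod (u m - u m0) <= e) ->
  exists l, cconv u l.
Proof.
move=> cu.
have part (F : R[i] -> R) : (forall x y, F (x - y) = F x - F y) ->
    (forall z, F z ^+ 2 <= sqmod z) -> exists l : R, (fun m => F (u m)) @ \oo --> l.
  move=> FB Fle; apply: real_cauchy_cvg => e e0.
  have [m0 um0] := cu (e ^+ 2) ltac:(by rewrite exprn_gt0).
  exists m0 => m /um0 h; rewrite -FB -(@ler_pXn2r _ 2) ?nnegrE ?(ltW e0)//.
  by rewrite real_normK ?num_real//; exact: le_trans (Fle _) h.
have ReB (x y : R[i]) : complex.Re (x - y) = complex.Re x - complex.Re y by case: x y => [? ?] [? ?].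
have ImB (x y : R[i]) : complex.Im (x - y) = complex.Im x - complex.Im y by case: x y => [? ?] [? ?].
have [a ua] := part (@complex.Re R) ReB sqmod_Re_le.
have [b ub] := part (@complex.Im R) ImB sqmod_Im_le.
exists (a +i* b)%C => e e0.
have e2 : 0 < Num.sqrt (e / 2) by rewrite sqrtr_gt0 divr_gt0.
have /cvgrPdist_le /(_ _ e2) [m1 _ h1] := ua; have /cvgrPdist_le /(_ _ e2) [m2 _ h2] := ub.
exists (maxn m1 m2) => m; rewrite geq_max => /andP[/h1 /= k1 /h2 /= k2].
rewrite sqmodE ReB ImB /=.
have sq (x : R) : `|x| <= Num.sqrt (e / 2) -> x ^+ 2 <= e / 2.
  move=> h; rewrite -[leRHS]sqr_sqrtr ?divr_ge0 ?(ltW e0)//.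
  by rewrite -[leLHS]real_normK ?num_real// ler_pXn2r ?nnegrE// (ltW e2).
rewrite [leRHS](splitr e); apply: lerD.
  by apply: sq; rewrite distrC.
by apply: sq; rewrite distrC.
Qed.

End complex_sequences.

(** * The series of the operator, its linearity and its bound *)

Section dfs_operator.
Variable R : realType.
Variable s : R.
Hypothesis s_gt : 2^-1 < s.
Implicit Types (fhat ghat : Jinf -> R[i]) (q : int * int * int).
Local Notation K := (dfs_const s).

Lemma DFS_partial_sumE fhat k j l m : DFS_partial_sum fhat (k, j, l) m =
  \sum_(0 <= n < m) (dfsker R n k j l)%:C%C * Defs.coef0 fhat n (- k) (- l).
Proof.
rewrite /DFS_partial_sum (big_nat_widenl _ 0)//; set mx := maxn _ _.
rewrite big_mkcond; apply: eq_bigr => n _ /=.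
by rewrite /dfsker -/mx; case: leqP => // _; rewrite mul0r.
Qed.

Lemma sqnorm_hsE fhat : sqnorm_hs s fhat =
  (\esum_(p in [set: Jinf]) (hsw s (\val p).1.1 * sqmod (fhat p))%:E)%E.
Proof. by []. Qed.

Let hsa_ge0 fhat (p : Jinf) : 0 <= hsw s (\val p).1.1 * sqmod (fhat p).
Proof. by rewrite mulr_ge0 ?hsw_ge0 ?sqmod_ge0. Qed.

Lemma coef0_sum_le fhat (T : seq (nat * int * int)) : hs s fhat -> uniq T ->
  \sum_(t <- T) hsw s t.1.1 * sqmod (Defs.coef0 fhat t.1.1 t.1.2 t.2) <=
  fine (sqnorm_hs s fhat).
Proof.
move=> hf uT.
pose T' : seq Jinf := pmap insub T.
have -> : \sum_(t <- T) hsw s t.1.1 * sqmod (Defs.coef0 fhat t.1.1 t.1.2 t.2) =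
   \sum_(p <- T') hsw s (\val p).1.1 * sqmod (fhat p).
  rewrite /T'; elim: (T) => [|[[n k] l] T0 IH]; first by rewrite !big_nil.
  rewrite big_cons IH /Defs.coef0 /=; case: insubP => [p _ pE|_] /=.
    by rewrite big_cons pE.
  by rewrite sqmod0 mulr0 add0r.
by apply: (sum_le_fine_esum (hsa_ge0 fhat) hf); exact: pmap_sub_uniq.
Qed.

(** The finite set [Q] is enlarged to a product of pairs [(k, l)] and frequencies [j]. For each pair
    [dfsker_bound] controls all [j] at once, and distinct pairs involve disjoint sets of
    coefficients, so the bounds add up to one Sobolev norm, uniformly in [m]. *)
Lemma DFS_partial_sum_bound fhat (Q : seq (int * int * int)) m : hs s fhat -> uniq Q ->
  \sum_(q <- Q) sqmod (DFS_partial_sum fhat q m) <= K * fine (sqnorm_hs s fhat).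
Proof.
move=> hf uQ.
pose KL := undup [seq (q.1.1, q.2) | q <- Q]; pose J := undup [seq q.1.2 | q <- Q].
pose Full := [seq (kl.1, j, kl.2) | kl <- KL, j <- J].
apply: (@le_trans _ _ (\sum_(q <- Full) sqmod (DFS_partial_sum fhat q m))).
  apply: ler_sum_uniq => //.
  - by apply: allpairs_uniq; rewrite ?undup_uniq// => -[[? ?] ?] [[? ?] ?] _ _ [-> -> ->].
  - by move=> q; exact: sqmod_ge0.
  move=> [[k j] l] qQ /negP[]; apply/allpairsP; exists ((k, l), j); split => //=.
    by rewrite mem_undup; apply/mapP; exists (k, j, l).
  by rewrite mem_undup; apply/mapP; exists (k, j, l).
rewrite big_allpairs_dep.
apply: (@le_trans _ _ (\sum_(kl <- KL) K * \sum_(0 <= n < m)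
    hsw s n * sqmod (Defs.coef0 fhat n (- kl.1) (- kl.2)))).
  apply: ler_sum => kl _.
  under [leLHS]eq_bigr do rewrite DFS_partial_sumE.
  by apply: dfsker_bound => //; exact: undup_uniq.
rewrite -mulr_sumr ler_wpM2l ?dfs_const_ge0//.
pose T := [seq (n, - kl.1, - kl.2) | kl <- KL, n <- index_iota 0 m].
apply: le_trans (coef0_sum_le (T := T) hf _); first by rewrite big_allpairs_dep.
apply: allpairs_uniq; rewrite ?undup_uniq ?iota_uniq// => -[[k l] n] [[k' l'] n'] _ _ /=.
by move=> [-> /oppr_inj -> /oppr_inj ->].
Qed.

(** Differences of partial sums are partial sums of such a tail, so the uniform bound gives Cauchy
    sequences here and remainder estimates on the torus later. *)
Definition htail m fhat : Jinf -> R[i] := fun p => if (m <= (\val p).1.1)%N then fhat p else 0.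

Lemma coef0_htail m fhat n k l :
  Defs.coef0 (htail m fhat) n k l = if (m <= n)%N then Defs.coef0 fhat n k l else 0.
Proof.
rewrite /Defs.coef0; case: insubP => [p _ pE|_] /=; last by case: ifP.
by rewrite /htail pE.
Qed.

Lemma DFS_partial_sum_htail fhat q m m' : (m <= m')%N ->
  DFS_partial_sum (htail m fhat) q m' = DFS_partial_sum fhat q m' - DFS_partial_sum fhat q m.
Proof.
case: q => [[k j] l] mm'; rewrite !DFS_partial_sumE.
rewrite (@big_cat_nat _ _ _ m 0 m')//= (@big_cat_nat _ _ _ m 0 m')//=.
rewrite big_nat big1 ?add0r => [|n /andP[_ nm]]; last first.
  by rewrite coef0_htail leqNgt nm mulr0.
rewrite addrAC subrr add0r [LHS]big_nat [RHS]big_nat; apply: eq_bigr => n /andP[mn _].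
by rewrite coef0_htail mn.
Qed.

Lemma htail_sum_le m fhat (u : seq Jinf) :
  \sum_(p <- u) hsw s (\val p).1.1 * sqmod (htail m fhat p) =
  \sum_(p <- [seq p <- u | (m <= (\val p).1.1)%N]) hsw s (\val p).1.1 * sqmod (fhat p).
Proof.
rewrite big_filter [RHS]big_mkcond; apply: eq_bigr => p _.
by rewrite /htail; case: ifP => // _; rewrite sqmod0 mulr0.
Qed.

Lemma sqnorm_htail_le m fhat : hs s fhat ->
  (sqnorm_hs s (htail m fhat) <= sqnorm_hs s fhat)%E.
Proof.
move=> hf; rewrite !sqnorm_hsE -[leRHS](esum_fineK (hsa_ge0 fhat) hf).
apply: esum_le_sum => u uu; rewrite htail_sum_le.
by apply: (sum_le_fine_esum (hsa_ge0 fhat) hf); exact: filter_uniq.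
Qed.

Lemma hs_htail m fhat : hs s fhat -> hs s (htail m fhat).
Proof. by move=> hf; exact: le_lt_trans (sqnorm_htail_le m hf) hf. Qed.

Lemma htail_small fhat (e : R) : hs s fhat -> 0 < e ->
  exists m0, forall m, (m0 <= m)%N -> fine (sqnorm_hs s (htail m fhat)) <= e.
Proof.
move=> hf e0; have [s0 us0 hs0] := esum_tail (hsa_ge0 fhat) hf e0.
exists (\max_(p <- s0) (\val p).1.1).+1 => m mm.
rewrite -lee_fin (esum_fineK (hsa_ge0 _)); last exact: hs_htail.
apply: esum_le_sum => u uu; rewrite htail_sum_le; apply: hs0; first exact: filter_uniq.
move=> p; rewrite mem_filter => /andP[mp _]; apply/negP => ps0.
have h : ((\val p).1.1 <= \max_(p <- s0) (\val p).1.1)%N.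
  exact: (@leq_bigmax_seq _ s0 xpredT (fun p : Jinf => (\val p).1.1) p ps0 isT).
by have := leq_trans mm mp; rewrite ltnNge h.
Qed.

Lemma fine_hs_ge0 fhat : 0 <= fine (sqnorm_hs s fhat).
Proof. by apply: fine_ge0; apply: esum_ge0 => p _; rewrite lee_fin hsa_ge0. Qed.

Lemma DFS_partial_sum_cauchy fhat q (e : R) : hs s fhat -> 0 < e ->
  exists m0, forall m, (m0 <= m)%N ->
    sqmod (DFS_partial_sum fhat q m - DFS_partial_sum fhat q m0) <= e.
Proof.
move=> hf e0.
have K1 : 0 < K + 1 by rewrite ltr_wpDl// dfs_const_ge0.
have [m0 hm0] := htail_small hf (divr_gt0 e0 K1).
exists m0 => m m0m; rewrite -DFS_partial_sum_htail//.
have := @DFS_partial_sum_bound (htail m0 fhat) [:: q] m (hs_htail m0 hf) isT.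
rewrite big_seq1 => h; apply: le_trans h _.
have := hm0 m0 (leqnn _); rewrite ler_pdivlMr// mulrC; apply: le_trans.
by rewrite ler_wpM2r ?fine_hs_ge0// lerDl.
Qed.

Lemma DFS_partial_sum_cconv fhat q : hs s fhat ->
  cconv (DFS_partial_sum fhat q) (limn (DFS_partial_sum fhat q)).
Proof.
move=> hf; have [l ul] := cauchy_cconv (fun e e0 => DFS_partial_sum_cauchy q hf e0).
by rewrite (cconv_lim ul).
Qed.

Lemma DFS_partial_sum_cvg fhat q : hs s fhat -> cvgn (DFS_partial_sum fhat q).
Proof.
by move=> hf; apply: cvgP; apply: cconv_cvg; exact: DFS_partial_sum_cconv.
Qed.

Lemma cconvD (u v : nat -> R[i]^o) (a l l' : R[i]) : cconv u l -> cconv v l' ->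
  cconv (fun m => a * u m + v m) (a * l + l').
Proof.
move=> ul vl e e0.
have a0 : 0 < 2 * sqmod a + 1 by rewrite ltr_wpDl// mulr_ge0// sqmod_ge0.
have [m1 h1] := ul (e / 2 / (2 * sqmod a + 1)) ltac:(by rewrite !divr_gt0).
have [m2 h2] := vl (e / 2 / 2) ltac:(by rewrite !divr_gt0).
exists (maxn m1 m2) => m; rewrite geq_max => /andP[/h1 k1 /h2 k2].
have -> : a * u m + v m - (a * l + l') = a * (u m - l) + (v m - l') by ring.
apply: le_trans (sqmod_le2 _ _) _; rewrite sqmodM.
move: k1; rewrite ler_pdivlMr// mulrDr mulr1 => k1.
have := sqmod_ge0 (u m - l); move: k2 k1.
move: (sqmod (u m - l)) (sqmod (v m - l')) (sqmod a) => x y z; nra.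
Qed.

Lemma coef0D (a : R[i]) fhat ghat n k l :
  Defs.coef0 (fun p => a * fhat p + ghat p) n k l = a * Defs.coef0 fhat n k l + Defs.coef0 ghat n k l.
Proof. by rewrite /Defs.coef0; case: insubP => //= _; rewrite mulr0 addr0. Qed.

Lemma DFS_hat_linear (a : R[i]) fhat ghat q : hs s fhat -> hs s ghat ->
  DFS_hat (fun p => a * fhat p + ghat p) q = a * DFS_hat fhat q + DFS_hat ghat q.
Proof.
case: q => [[k j] l] hf hg; rewrite /DFS_hat mulrCA -mulrDr; congr (_ * _).
apply: cconv_lim.
rewrite (_ : DFS_partial_sum _ _ = fun m => a * DFS_partial_sum fhat (k, j, l) m + DFS_partial_sum ghat (k, j, l) m).
  by apply: cconvD; exact: DFS_partial_sum_cconv.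
apply/funext => m; rewrite !DFS_partial_sumE mulr_sumr -big_split /=.
by apply: eq_bigr => n _; rewrite coef0D; ring.
Qed.

Lemma sqmod_DFS_hat fhat q : sqmod (DFS_hat fhat q) = sqmod (limn (DFS_partial_sum fhat q)).
Proof. by case: q => [[k j] l]; rewrite /DFS_hat sqmodM sqr_i_expz mul1r. Qed.

(** A finite set of components is approximated by partial sums of one common length; the factor 2 is
    the price of the quadratic triangle inequality. *)
Lemma DFS_hat_sum_le fhat (Q : seq (int * int * int)) : hs s fhat -> uniq Q ->
  \sum_(q <- Q) sqmod (DFS_hat fhat q) <= 2 * K * fine (sqnorm_hs s fhat).
Proof.
move=> hf uQ; apply/ler_addgt0Pr => e e0.
(* The errors [2 * d], one for each element of [Q], add up to at most [e]; the successor keeps the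
   denominator nonzero. *)
pose d := e / (2 * (size Q).+1%:R).
have d0 : 0 < d by rewrite divr_gt0// mulr_gt0.
have [m hm] : exists m, forall q, q \in Q ->
    sqmod (DFS_partial_sum fhat q m - limn (DFS_partial_sum fhat q)) <= d.
  move: (d) d0 => d' d0'.
  suff [m0 h] : exists m0, forall m, (m0 <= m)%N -> forall q, q \in Q ->
    sqmod (DFS_partial_sum fhat q m - limn (DFS_partial_sum fhat q)) <= d'.
    by exists m0; exact: h.
  elim: (Q) => [|q Q' [m1 h1]]; first by exists 0%N.
  have [m2 h2] := DFS_partial_sum_cconv q hf d0'.
  exists (maxn m1 m2) => m; rewrite geq_max => /andP[/h1 k1 /h2 k2] q'.
  by rewrite inE => /predU1P[->//|]; exact: k1.
apply: (@le_trans _ _ (\sum_(q <- Q) (2 * sqmod (DFS_partial_sum fhat q m) + 2 * d))).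
  rewrite big_seq [leRHS]big_seq; apply: ler_sum => q /hm h; rewrite sqmod_DFS_hat.
  have -> : limn (DFS_partial_sum fhat q) = DFS_partial_sum fhat q m -
    (DFS_partial_sum fhat q m - limn (DFS_partial_sum fhat q)) by rewrite opprB addrC subrK.
  by apply: le_trans (sqmodB_le2 _ _) _; rewrite lerD2l ler_wpM2l.
rewrite big_split /= -mulr_sumr lerD//.
  by rewrite -mulrA ler_wpM2l// DFS_partial_sum_bound.
rewrite big_const_seq count_predT iter_addr_0 -[_ *+ size Q]mulr_natl /d.
have -> : (size Q)%:R * (2 * (e / (2 * (size Q).+1%:R))) = e * ((size Q)%:R / (size Q).+1%:R) :> R.
  by field; rewrite nat1r pnatr_eq0.
by rewrite ler_piMr ?(ltW e0)// ler_pdivrMr// mul1r ler_nat.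
Qed.

Lemma DFS_hat_l2_bound fhat : hs s fhat -> l2 (DFS_hat fhat) /\
  (sqnorm_l2 (DFS_hat fhat) <= ((Num.sqrt (2 * K)) ^+ 2)%:E * sqnorm_hs s fhat)%E.
Proof.
have K0 : 0 <= 2 * K by rewrite mulr_ge0// dfs_const_ge0.
move=> hf; rewrite sqr_sqrtr//.
have H : (sqnorm_l2 (DFS_hat fhat) <= (2 * K)%:E * sqnorm_hs s fhat)%E.
  rewrite sqnorm_hsE -(esum_fineK (hsa_ge0 fhat) hf) -EFinM.
  rewrite /sqnorm_l2 /sqnorm_wl2; apply: esum_le_sum => Q uQ.
  by under eq_bigr do rewrite mul1r; exact: DFS_hat_sum_le.
split => //; rewrite /l2; apply: le_lt_trans H _.
by rewrite lte_mul_pinfty// lee_fin.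
Qed.

(** The image of the tail is the remainder of the series, which makes its [l2] norm small together
    with the Sobolev norm of the tail. *)
Lemma DFS_hat_htail fhat k j l m : hs s fhat ->
  DFS_hat (htail m fhat) (k, j, l) =
  DFS_hat fhat (k, j, l) - 'i%C ^ (k - l) * DFS_partial_sum fhat (k, j, l) m.
Proof.
move=> hf; rewrite /DFS_hat -mulrBr; congr (_ * _); apply: cconv_lim => e e0.
have [m0 h] := DFS_partial_sum_cconv (k, j, l) hf e0.
exists (maxn m m0) => m'; rewrite geq_max => /andP[mm' /h].
rewrite DFS_partial_sum_htail//.
by move: (DFS_partial_sum fhat _ m) => x; rewrite opprB addrA subrK.
Qed.

End dfs_operator.

(** * Haar measure and Euler angles *)

Section image_density.
Local Open Scope ereal_scope.
Context d1 d2 (T1 : measurableType d1) (T2 : measurableType d2) (R : realType).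
Variables (mu : {measure set T1 -> \bar R}) (nu : {measure set T2 -> \bar R}).
Variables (h : T1 -> T2) (D : set T1) (g : T1 -> R).
Hypothesis mh : measurable_fun setT h.
Hypothesis mD : measurable D.
Hypothesis mg : measurable_fun setT g.
Hypothesis g0 : forall x, D x -> (0 <= g x)%R.
Hypothesis nuE : forall A, measurable A -> nu A = \int[mu]_(x in D `&` h @^-1` A) (g x)%:E.

Import HBNNSimple.

(** Change of variables for an image of a measure with density: the hypothesis on [nu] is the case
    of indicators, simple functions follow by linearity, and monotone convergence gives the rest. *)
Lemma ge0_integral_image_density (f : T2 -> \bar R) : (forall y, 0 <= f y) ->
  measurable_fun setT f ->
  \int[nu]_y f y = \int[mu]_(x in D) (f (h x) * (g x)%:E).
Proof.
move=> f0 mf; pose q := nnsfun_approx measurableT mf.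
have mgE : measurable_fun D (EFin \o g) by apply: measurable_funTS; apply/measurable_EFinP.
have mqh n : measurable_fun D (fun x => (q n (h x))%:E).
  apply: measurable_funTS; apply/measurable_EFinP.
  by apply: (measurableT_comp _ mh); exact/measurable_funP.
have -> : \int[nu]_y f y = lim (\int[nu]_y (EFin \o q n) y @[n --> \oo]).
  have fE x : f x = lim ((EFin \o q n) x @[n --> \oo]).
    by apply/esym/cvg_lim => //; apply: cvg_nnsfun_approx.
  under eq_integral => x _ do rewrite fE.
  apply: monotone_convergence => //.
  - by move=> n; apply/measurable_EFinP; exact/measurable_funP.
  - by move=> n x Ex //=; rewrite lee_fin.
  - by move=> x Ex a b ab; rewrite lee_fin; exact/lefP/nd_nnsfun_approx.
have -> : \int[mu]_(x in D) (f (h x) * (g x)%:E) =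
    lim (\int[mu]_(x in D) ((q n (h x))%:E * (g x)%:E) @[n --> \oo]).
  have fg x : f (h x) * (g x)%:E = lim (((q n (h x))%:E * (g x)%:E) @[n --> \oo]).
    apply/esym/cvg_lim => //; apply: cvgeZr => //.
    exact: (cvg_nnsfun_approx measurableT mf (fun x _ => f0 x) (x := h x)).
  under eq_integral => x _ do rewrite fg.
  apply: monotone_convergence => //.
  - by move=> n; apply: emeasurable_funM.
  - by move=> n x Dx; rewrite -EFinM lee_fin mulr_ge0// g0.
  - move=> x Dx a b ab; rewrite -!EFinM lee_fin ler_wpM2r ?g0//.
    exact/lefP/nd_nnsfun_approx.
suff suf n : \int[mu]_(x in D) ((q n (h x))%:E * (g x)%:E) = \int[nu]_y (EFin \o q n) y.
  by congr (lim _); congr (_ @ \oo); apply/funext => n; rewrite suf.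
transitivity (\int[nu]_y (\sum_(r \in range (q n)) (r * \1_(q n @^-1` [set r]) y)%:E)); last first.
  by apply: eq_integral => t tE; rewrite /= fimfunE -fsumEFin.
have mq r : measurable (q n @^-1` [set r]) by exact: measurable_funPTI.
have indich r : measurable_fun setT (fun y => (r * \1_(q n @^-1` [set r]) y)%:E).
  by apply/measurable_EFinP; exact: measurable_funM.
rewrite ge0_integral_fsum//; last by move=> m y Ey; exact: nnfun_muleindic_ge0.
transitivity (\int[mu]_(x in D) (\sum_(r \in range (q n))
    (r * \1_(q n @^-1` [set r]) (h x))%:E * (g x)%:E)).
  apply: eq_integral => x; rewrite inE => Dx.
  rewrite -ge0_mule_fsuml => [|y]; last exact: nnfun_muleindic_ge0.
  by rewrite fsumEFin // -(fimfunE _ (h x)).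
rewrite ge0_integral_fsum//; last 2 first.
  - move=> r; apply: emeasurable_funM => //; apply: measurable_funTS.
    exact: (measurableT_comp (indich r) mh).
  - by move=> r x Dx; apply: mule_ge0; [exact: nnfun_muleindic_ge0|rewrite lee_fin g0].
apply: eq_fsbigr => r rqn.
have r0 : (0 <= r)%R by move: rqn; rewrite inE => -[y _ <-].
under eq_integral do rewrite EFinM -muleA.
under [RHS]eq_integral do rewrite EFinM.
have mhq : measurable (h @^-1` (q n @^-1` [set r])) by rewrite -[X in measurable X]setTI; exact: mh.
have mI : measurable_fun D (fun x => (\1_(q n @^-1` [set r]) (h x))%:E * (g x)%:E).
  apply: emeasurable_funM => //; apply: measurable_funTS; apply/measurable_EFinP.
  by apply: (measurableT_comp _ mh); exact: measurable_indic.
have I0 x : D x -> 0 <= (\1_(q n @^-1` [set r]) (h x))%:E * (g x)%:E.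
  by move=> Dx; rewrite -EFinM lee_fin mulr_ge0 ?g0.
rewrite (ge0_integralZl mu mD mI I0) ?lee_fin//.
rewrite [RHS]ge0_integralZl//; last by apply/measurable_EFinP.
congr (_ * _).
rewrite integral_indic// setIT nuE// integral_mkcondr.
apply: eq_integral => x _; rewrite /patch indicE.
have -> : (x \in h @^-1` (q n @^-1` [set r])) = (h x \in q n @^-1` [set r]).
  by apply/idP/idP; rewrite !inE.
by case: (_ \in _); rewrite ?mul1e ?mul0e.
Qed.

Lemma integral_image_density (f : T2 -> \bar R) : measurable_fun setT f ->
  \int[nu]_y f y = \int[mu]_(x in D) (f (h x) * (g x)%:E).
Proof.
move=> mf; rewrite [LHS]integralE [RHS]integralE.
rewrite !ge0_integral_image_density//; [|exact: measurable_funeneg|exact: measurable_funepos].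
have maxM (a : \bar R) (b : R) : (0 <= b)%R -> maxe (a * b%:E) 0 = maxe a 0 * b%:E.
  move=> b0; have [a0|/ltW a0] := leP 0 a.
    by rewrite !max_l// mule_ge0.
  by rewrite !max_r ?mul0e// mule_le0_ge0.
congr (_ - _); apply: eq_integral => x; rewrite inE => Dx.
  by rewrite !funeposE maxM ?g0.
by rewrite !funenegE -mulNe maxM ?g0.
Qed.

End image_density.

Section haar_integral.
Variable R : realType.
Local Notation domain := (@euler_domain R).

Lemma measurable_domain : measurable domain.
Proof. by apply: measurableX => //; exact: measurableX. Qed.

Lemma measurable_density : measurable_fun setT (@euler_density R).
Proof.
apply: measurable_funM => //.
apply: (measurableT_comp (continuous_measurable_fun (@continuous_sin R))).
exact: (measurableT_comp measurable_snd).
Qed.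

Lemma density_ge0 t : domain t -> 0 <= euler_density t.
Proof.
move=> [[_ +] _]; rewrite /= in_itv /= => /andP[b0 bpi].
apply: divr_ge0; last by rewrite mulr_ge0// sqr_ge0.
by apply: sin_ge0_pi; rewrite b0.
Qed.

Lemma haar_integral (f : SO3 R -> \bar R) : measurable_fun setT f ->
  (\int[@haar R]_A f A = \int[@lebesgue3 R]_(t in domain) (f (euler t) * (euler_density t)%:E))%E.
Proof.
apply: integral_image_density; [exact: measurable_euler|exact: measurable_domain|
  exact: measurable_density|exact: density_ge0|by []].
Qed.

Lemma haar_Cintegral (F : SO3 R -> R[i]) : cmeas setT F ->
  Cintegral (@haar R) setT F =
  Cintegral (@lebesgue3 R) domain (fun t => F (euler t) * (euler_density t)%:C%C).
Proof.
move=> [mr mi]; rewrite /Cintegral /Rintegral !haar_integral; try exact/measurable_EFinP.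
congr (_ +i* _)%C; congr fine; apply: eq_integral => t _.
  by rewrite ReM /= mulr0 subr0 EFinM.
by rewrite ImM /= mulr0 add0r EFinM.
Qed.

Lemma haar_sqnormL2 (F : SO3 R -> R[i]) : cmeas setT F ->
  sqnormL2 (@haar R) setT F =
  (\int[@lebesgue3 R]_(t in domain) (sqmod (F (euler t)) * euler_density t)%:E)%E.
Proof.
move=> mF; rewrite /sqnormL2 haar_integral//.
by apply/measurable_EFinP; exact: measurable_sqmod.
Qed.

End haar_integral.

(** * Every rotation has Euler angles *)

Section euler_surjective.
Variable R : realType.

Lemma polar_angle (x y : R) : x ^+ 2 + y ^+ 2 = 1 -> exists t, cos t = x /\ sin t = y.
Proof.
move=> xy; have x1 : -1 <= x <= 1.
  by rewrite -ler_norml -(@expr_le1 _ 2)// real_normK ?num_real// -xy lerDl sqr_ge0.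
have s2 : sin (acos x) ^+ 2 = y ^+ 2.
  by rewrite sin2cos2 acosK ?in_itv// -xy addrC addKr.
have /eqP := s2; rewrite eqf_sqr => /orP[/eqP sy|/eqP sy].
  by exists (acos x); rewrite acosK ?in_itv.
by exists (- acos x); rewrite cosN sinN acosK ?in_itv// sy opprK.
Qed.

Lemma matrix3P (A B : 'M[R]_3) :
  [/\ A 0 0 = B 0 0, A 0 1 = B 0 1 & A 0 ord_max = B 0 ord_max] ->
  [/\ A 1 0 = B 1 0, A 1 1 = B 1 1 & A 1 ord_max = B 1 ord_max] ->
  [/\ A ord_max 0 = B ord_max 0, A ord_max 1 = B ord_max 1 &
      A ord_max ord_max = B ord_max ord_max] -> A = B.
Proof.
move=> [a1 a2 a3] [b1 b2 b3] [c1 c2 c3]; apply/matrixP => i j.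
have o3 (k : 'I_3) : [\/ k = 0, k = 1 | k = ord_max].
  by case: k => [[|[|[|//]]] h]; [apply: Or31|apply: Or32|apply: Or33]; exact: val_inj.
by case: (o3 i) => ->; case: (o3 j) => ->.
Qed.

Lemma euler_entries (t : angles R) : let A := \val (euler t) in
  let a := t.1.1 in let b := t.1.2 in let c := t.2 in
  [/\ [/\ A 0 0 = cos b * (cos a * cos c) - sin a * sin c,
          A 0 1 = - (cos b * (cos a * sin c)) - sin a * cos c &
          A 0 ord_max = sin b * cos a],
      [/\ A 1 0 = cos b * (sin a * cos c) + cos a * sin c,
          A 1 1 = - (cos b * (sin a * sin c)) + cos a * cos c &
          A 1 ord_max = sin b * sin a] &
      [/\ A ord_max 0 = - (sin b * cos c), A ord_max 1 = sin b * sin c &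
          A ord_max ord_max = cos b]].
Proof.
rewrite /=; split; split; rewrite /= mxE !big_ord_recl big_ord0 /=
  ![(Rz _ *m Ry _) _ _]mxE !big_ord_recl !big_ord0 !mxE /=; ring.
Qed.

(** Entries become values of a function on [nat], so that ordinals with equal values but different
    proofs are identified by computation. *)
Lemma mx3_nat (A : 'M[R]_3) : exists f : nat -> nat -> R, forall i j : 'I_3, A i j = f i j.
Proof. by exists (fun i j => A (inord i) (inord j)) => i j; rewrite !inord_val. Qed.

Lemma orth3 (A : 'M[R]_3) : A *m A^T = 1%:M -> forall i j : 'I_3,
  A i 0 * A j 0 + A i 1 * A j 1 + A i ord_max * A j ord_max = (i == j)%:R.
Proof.
move=> AA i j; have /matrixP/(_ i j) := AA.
rewrite !mxE !big_ord_recl big_ord0 !mxE addr0 addrA => <-.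
by have [f fE] := mx3_nat A; rewrite !fE.
Qed.

Lemma det3 (A : 'M[R]_3) : \det A =
  A 0 0 * (A 1 1 * A ord_max ord_max - A 1 ord_max * A ord_max 1)
  - A 0 1 * (A 1 0 * A ord_max ord_max - A 1 ord_max * A ord_max 0)
  + A 0 ord_max * (A 1 0 * A ord_max 1 - A 1 1 * A ord_max 0).
Proof.
rewrite (expand_det_row _ ord0) !big_ord_recl big_ord0 /cofactor.
rewrite !(expand_det_row _ ord0) !big_ord_recl !big_ord0 /cofactor !det_mx11 !mxE.
by have [f fE] := mx3_nat A; rewrite !fE /= /bump /=; ring.
Qed.

Lemma SO3_stab_e3 (B : 'M[R]_3) : B *m B^T = 1%:M -> \det B = 1 ->
  B 0 ord_max = 0 -> B 1 ord_max = 0 -> B ord_max ord_max = 1 -> exists t, B = Rz t.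
Proof.
move=> /orth3 o /eqP; rewrite det3 => /eqP + B02 B12 B22; rewrite B02 B12 B22 => d.
have := o ord_max ord_max; have := o 0 0; have := o 1 1; rewrite eqxx B02 B12 B22 => o1 o0 o2.
have [B20 B21] : B ord_max 0 = 0 /\ B ord_max 1 = 0.
  have h : B ord_max 0 ^+ 2 + B ord_max 1 ^+ 2 = 0.
    by move: o2; rewrite eqxx /= !expr2 => o2; lra.
  move/eqP: h; rewrite paddr_eq0 ?sqr_ge0// !sqrf_eq0.
  by case/andP => /eqP -> /eqP ->.
rewrite B20 B21 in d.
(* The left-hand side is the sum of the squared norms of the first two rows minus twice the
   determinant, [1 + 1 - 2]. *)
have h : (B 0 0 - B 1 1) ^+ 2 + (B 0 1 + B 1 0) ^+ 2 = 0.
  by move: o0 o1 d; rewrite eqxx /= !expr2 => o0 o1 d; lra.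
move/eqP: h; rewrite paddr_eq0 ?sqr_ge0// !sqrf_eq0 => /andP[/eqP h1 /eqP h2].
have E11 : B 1 1 = B 0 0 by lra.
have E01 : B 0 1 = - B 1 0 by lra.
have [t [ct st]] : exists t, cos t = B 0 0 /\ sin t = B 1 0.
  by apply: polar_angle; move: o0; rewrite E01 eqxx /= !expr2 => o0; lra.
exists t; apply: matrix3P; split; rewrite ?B02 ?B12 ?B22 ?B20 ?B21 ?E11 ?E01 -?ct -?st;
  by rewrite !mxE.
Qed.

(** The angles [a, b] are polar coordinates of the third column; [Rz a *m Ry b] has the same third
    column, so its inverse times [A] fixes the third axis and is some [Rz t]. Surjectivity
    guarantees that the choice made by [euler_angles] is never its default value. *)
Lemma euler_surj (A : SO3 R) : exists t : angles R, 0 <= t.1.2 <= pi /\ euler t = A.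
Proof.
case: A => A HA; have := HA; rewrite /is_SO3 => /andP[/eqP AA /eqP dA].
have AtA : A^T *m A = 1%:M by apply: mulmx1C.
have o := orth3 (A := A^T); rewrite trmxK in o; have {}o := o AtA.
have := o ord_max ord_max; rewrite eqxx !mxE mulr1n => col.
have x1 : -1 <= A ord_max ord_max <= 1.
  rewrite -ler_norml -(@expr_le1 _ 2)// real_normK ?num_real//.
  have := sqr_ge0 (A 0 ord_max); have := sqr_ge0 (A 1 ord_max); rewrite !expr2; lra.
pose b := acos (A ord_max ord_max).
have cb : cos b = A ord_max ord_max by rewrite acosK ?in_itv.
have b0 : 0 <= b <= pi by rewrite acos_ge0// acos_lepi.
have sb2 : sin b ^+ 2 = A 0 ord_max ^+ 2 + A 1 ord_max ^+ 2.
  by rewrite sin2cos2 cb !expr2; lra.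
have [a [ca sa]] : exists a, sin b * cos a = A 0 ord_max /\ sin b * sin a = A 1 ord_max.
  (* On the axis the angle [a] is undetermined and 0 is taken. *)
  have [s0|s0] := eqVneq (sin b) 0.
    exists 0; rewrite s0 !mul0r; move/eqP: sb2; rewrite s0 expr0n eq_sym /=.
    by rewrite paddr_eq0 ?sqr_ge0// !sqrf_eq0 => /andP[/eqP -> /eqP ->].
  have [a [ca sa]] : exists a, cos a = A 0 ord_max / sin b /\ sin a = A 1 ord_max / sin b.
    apply: polar_angle; rewrite !expr_div_n -mulrDl -sb2 mulfV// expf_neq0//.
  by exists a; rewrite ca sa ![sin b * _]mulrC !divfK.
have [P PE] : exists P, P = Rz a *m Ry b by exists (Rz a *m Ry b).
pose B := P^T *m A.
have soM : is_SO3 P by rewrite PE; exact: is_SO3M (is_SO3_Rz a) (is_SO3_Ry b).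
have /andP[/eqP PP /eqP dP] := soM.
have BB : B *m B^T = 1%:M.
  rewrite /B trmx_mul trmxK mulmxA -[_ *m A *m _]mulmxA AA mulmx1; exact: mulmx1C.
have dB : \det B = 1 by rewrite /B det_mulmx det_tr dP dA mulr1.
have PB : P *m B = A by rewrite /B mulmxA PP mul1mx.
have BE i : B i ord_max = P 0 i * A 0 ord_max + P 1 i * A 1 ord_max
   + P ord_max i * A ord_max ord_max.
  rewrite /B mxE !big_ord_recl big_ord0 !(mxE _ _ i) addr0 addrA.
  by have [f fE] := mx3_nat P; have [f' fE'] := mx3_nat A; rewrite !fE !fE'.
have cs := cos2Dsin2 a; have cs' := cos2Dsin2 b.
have e i j : P i j = Rz a i 0 * Ry b 0 j + Rz a i 1 * Ry b 1 j
    + Rz a i ord_max * Ry b ord_max j.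
  rewrite PE mxE !big_ord_recl big_ord0 addr0 addrA.
  by have [f fE] := mx3_nat (Rz a); have [f' fE'] := mx3_nat (Ry b); rewrite !fE !fE'.
have [t tB] : exists t, B = Rz t.
  apply: SO3_stab_e3 => //; rewrite BE !e -ca -sa -cb !mxE /=; rewrite !expr2 in cs cs'.
  - rewrite (_ : _ + _ + _ = sin b * cos b * (cos a * cos a + sin a * sin a) - sin b * cos b).
      by rewrite cs mulr1 subrr.
    by ring.
  - by ring.
  rewrite (_ : _ + _ + _ = sin b * sin b * (cos a * cos a + sin a * sin a) + cos b * cos b).
    by rewrite cs mulr1 addrC.
  by ring.
exists (a, b, t); split => //; apply: val_inj => /=.
by rewrite -PE -tB PB.
Qed.

Lemma euler_anglesK (A : SO3 R) :
  0 <= (euler_angles A).1.2 <= pi /\ euler (euler_angles A) = A.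
Proof.
exact: (xgetPex (0, 0, 0) (P := [set t : angles R | 0 <= t.1.2 <= pi /\ euler t = A]) (euler_surj A)).
Qed.

Lemma measurable_SO3_entry (i j : 'I_3) :
  measurable_fun [set: SO3 R] (fun A : SO3 R => \val A i j : R).
Proof.
apply: (measurability _ (RGenOInfty.measurableE R)) => _ [_ [x ->] <-].
rewrite setTI.
apply: sub_sigma_algebra.
exists ((fun M : 'M[R]_3 => M i j) @^-1` `]x, +oo[%classic); last by [].
apply: open_comp; last exact: interval_open.
by move=> M _; exact: coord_continuous.
Qed.

End euler_surjective.

(** * Half-angle coordinates on the rotation group *)

Section spinor_coordinates.
Variable R : realType.
Local Notation C := R[i].
Implicit Types (t : angles R) (k l : int).

(** [spinX] and [spinY] are Cayley-Klein parameters. Adding [2 * pi] to an outer angle changes the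
    sign of both, so only their monomials of even degree descend to the rotation group. *)
Definition spinX t : C := (cos (t.1.2 / 2))%:C%C * expi (- ((t.1.1 + t.2) / 2)).
Definition spinY t : C := (sin (t.1.2 / 2))%:C%C * expi (- ((t.1.1 - t.2) / 2)).

(** Conjugation in place of inversion for negative exponents keeps the expression polynomial and
    defined at [z = 0]. *)
Definition sgpow (z : C) k : C := (if 0 <= k then z else (z^*)%C) ^+ absz k.

(** The total degree [|k + l| + |k - l|] is even. This factor carries the outer angles and the
    half-angle powers of a Wigner-D function; the remaining factor is a polynomial in [cos b]. *)
Definition spinw k l t : C := sgpow (spinX t) (k + l) * sgpow (spinY t) (k - l).

Lemma conjcM (x y : C) : ((x * y)^*)%C = (x^*)%C * (y^*)%C.
Proof. by case: x y => [a b] [a' b']; apply/eqP; rewrite eq_complex /=; apply/andP; split; apply/eqP; ring. Qed.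

Lemma conjc_expi (r x : R) : ((r%:C * expi x)^*)%C = r%:C%C * expi (- x).
Proof. by rewrite conjcM -expiN; congr (_ * _); exact: conjc_real. Qed.

Lemma sgpow_expi (r x : R) k : sgpow (r%:C%C * expi (- x)) k =
  (r ^+ absz k)%:C%C * expi (- (k%:~R * x)).
Proof.
rewrite /sgpow; case: k => m.
  rewrite -[0 <= _]/true -[absz _]/m exprMn rmorphXn /=; congr (_ * _).
  by rewrite expi_exp mulrN.
rewrite -[0 <= _]/false -[absz _]/(m.+1).
rewrite conjc_expi opprK.
rewrite exprMn rmorphXn /=; congr (_ * _).
by rewrite expi_exp NegzE mulrNz mulNr opprK.
Qed.

Lemma spinwE k l t : spinw k l t =
  (cos (t.1.2 / 2) ^+ absz (k + l) * sin (t.1.2 / 2) ^+ absz (k - l))%:C%C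
  * expi (- (k%:~R * t.1.1)) * expi (- (l%:~R * t.2)).
Proof.
rewrite /spinw !sgpow_expi rmorphM /= mulrACA -!mulrA; do 2 congr (_ * _).
by rewrite -!expiD !rmorphD rmorphN /=; congr expi; field.
Qed.

Lemma half_angle_trig (b : R) :
  [/\ cos (b / 2) ^+ 2 = (1 + cos b) / 2, sin (b / 2) ^+ 2 = (1 - cos b) / 2 &
      cos (b / 2) * sin (b / 2) = sin b / 2].
Proof.
have bE : b = (b / 2) *+ 2 by rewrite -[RHS]mulr_natr divfK// pnatr_eq0.
have h1 : cos b = 2 * cos (b / 2) ^+ 2 - 1 by rewrite {1}bE cos_mulr2n mulr2n; ring.
have h2 : sin b = 2 * (cos (b / 2) * sin (b / 2)) by rewrite {1}bE sin_mulr2n mulr2n; ring.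
split; last by rewrite h2; field.
  by rewrite h1; field.
by rewrite sin2cos2 h1; field.
Qed.

Lemma wignerd_cos n k l (b : R) : 0 <= b <= pi ->
  wignerd n k l (cos b) = halfd n k l (cos (b / 2)) (sin (b / 2)).
Proof.
move=> /andP[b0 bpi].
have [h1 h2 _] := half_angle_trig b.
have cE : cos b = cos (b / 2) ^+ 2 - sin (b / 2) ^+ 2 by rewrite h1 h2; field.
have hb : 0 <= b / 2 <= pi / 2 by rewrite divr_ge0//= ler_pM2r.
have c0 : 0 <= cos (b / 2).
  apply: cos_ge0_pihalf; move: hb => /andP[hb1 hb2]; rewrite hb2 andbT.
  by apply: le_trans hb1; rewrite oppr_le0 divr_ge0// pi_ge0.
have s0 : 0 <= sin (b / 2).
  apply: sin_ge0_pi; move: hb => /andP[-> hb2] /=; apply: le_trans hb2 _.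
  by have := pi_ge0 R; lra.
by rewrite cE wignerd_half ?cos2Dsin2.
Qed.

Lemma wignerD_angles_spinw n k l : (absz k <= n)%N -> (absz l <= n)%N ->
  exists2 K : R, K != 0 & forall t, 0 <= t.1.2 <= pi ->
  wignerD_angles n k l t = K%:C%C * (spinw k l t *
    ((jacobi R (absz (k - l)) (absz (k + l)) (n - maxn (absz k) (absz l))).[cos t.1.2])%:C%C).
Proof.
move=> kn ln; pose a := absz (k - l); pose b := absz (k + l).
pose r := (n - maxn (absz k) (absz l))%N.
exists (Num.sqrt (2 * n + 1)%:R * ((-1) ^ (if (l < k)%R then k + l else 0)
    * Num.sqrt 'C(2 * n - r, r + a)%:R / Num.sqrt 'C(r + b, b)%:R)).
  have sq0 m : (0 < m)%N -> Num.sqrt m%:R != 0 :> R by rewrite sqrtr_eq0 -ltNge ltr0n.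
  rewrite !mulf_neq0 ?invr_eq0 ?sq0 ?bin_gt0 ?addn1// ?exprN1z ?signr_eq0//.
    by rewrite /r /a; lia.
  exact: leq_addl.
move=> t /andP[b0 bpi].
have [h1 h2 _] := half_angle_trig t.1.2.
have cE : cos (t.1.2 / 2) ^+ 2 - sin (t.1.2 / 2) ^+ 2 = cos t.1.2 by rewrite h1 h2; field.
rewrite /wignerD_angles spinwE wignerd_cos ?b0// /halfd cE -/a -/b -/r.
rewrite !rmorphM /=.
move: (expi _) (expi _) => e1 e2; ring.
Qed.

(** The products of two parameters, taken here up to conjugation, are linear in the entries of the
    rotation. This gives both measurability and membership of the entries in the span. *)
Lemma spin_entries t : let A := \val (euler t) in
  [/\ spinX t * spinX t = ((A 0 0 + A 1 1) / 2 +i* ((A 0 1 - A 1 0) / 2))%C,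
      spinY t * spinY t = ((A 1 1 - A 0 0) / 2 +i* ((A 1 0 + A 0 1) / 2))%C,
      spinX t * spinY t = (A 0 ord_max / 2 +i* (- A 1 ord_max / 2))%C &
      spinX t * (spinY t)^*%C = (- A ord_max 0 / 2 +i* (- A ord_max 1 / 2))%C].
Proof.
move=> A; have [[-> -> ->] [-> -> ->] [-> -> _]] := euler_entries t.
have [h1 h2 h3] := half_angle_trig t.1.2.
have pr (x y : R) (z w : C) : x%:C%C * z * (y%:C%C * w) = (x * y)%:C%C * (z * w).
  by rewrite rmorphM mulrACA.
have YC : (spinY t)^*%C = (sin (t.1.2 / 2))%:C%C * expi ((t.1.1 - t.2) / 2).
  by rewrite /spinY conjc_expi opprK.
rewrite YC /spinX /spinY !pr -!expiD -!expr2 h1 h2 h3.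
have -> : - ((t.1.1 + t.2) / 2) - (t.1.1 + t.2) / 2 = - (t.1.1 + t.2) by field.
have -> : - ((t.1.1 - t.2) / 2) - (t.1.1 - t.2) / 2 = - (t.1.1 - t.2) by field.
have -> : - ((t.1.1 + t.2) / 2) - (t.1.1 - t.2) / 2 = - t.1.1 by field.
have -> : - ((t.1.1 + t.2) / 2) + (t.1.1 - t.2) / 2 = - t.2 by field.
rewrite /expi !cosN !sinN cosD cosB sinD sinB.
by split; apply/eqP; rewrite eq_complex /=; apply/andP; split; apply/eqP; field.
Qed.

Definition spinw_SO3 k l (A : SO3 R) : C := spinw k l (euler_angles A).

Lemma cmeas_entries (c0 c1 c2 c3 : R) (i j i' j' m1 n1 m2 n2 : 'I_3) :
  cmeas [set: SO3 R] (fun A : SO3 R =>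
   ((c0 * \val A i j + c1 * \val A i' j') +i* (c2 * \val A m1 n1 + c3 * \val A m2 n2))%C).
Proof.
by split => /=; apply: measurable_funD; apply: measurable_funM => //; exact: measurable_SO3_entry.
Qed.

Lemma cmeas_even_monomial (f g : SO3 R -> C) a b :
  cmeas setT (fun A => f A * f A) -> cmeas setT (fun A => g A * g A) ->
  cmeas setT (fun A => f A * g A) -> ~~ odd (a + b) ->
  cmeas setT (fun A => f A ^+ a * g A ^+ b).
Proof.
move=> ff gg fg ab.
have ob : odd b = odd a by move: ab; rewrite oddD; case: odd; case: odd.
have dbl (z : C) m : z ^+ m = z ^+ odd m * (z * z) ^+ m./2.
  by rewrite -{1}(odd_double_half m) exprD -mul2n exprM expr2.
have E A : f A ^+ a * g A ^+ b =
    (f A * f A) ^+ a./2 * (g A * g A) ^+ b./2 * (f A * g A) ^+ odd a.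
  rewrite (dbl (f A) a) (dbl (g A) b) ob [(f A * g A) ^+ _]exprMn.
  by move: (_ ^+ odd a) (_ ^+ odd a) (_ ^+ a./2) (_ ^+ b./2) => *; ring.
rewrite (_ : (fun A => _) = (fun A => (f A * f A) ^+ a./2 * (g A * g A) ^+ b./2 * (f A * g A) ^+ odd a)).
  by apply: cmeasM; [apply: cmeasM|]; apply: cmeas_exp.
by apply/funext => A; exact: E.
Qed.

(** [euler_angles] is a mere choice function; measurability is obtained by rewriting even monomials
    through products of two parameters, hence through matrix entries. The four cases are the signs
    of [k + l] and [k - l]. *)
Lemma cmeas_spinw k l : cmeas setT (spinw_SO3 k l).
Proof.
have ent := fun A : SO3 R => spin_entries (euler_angles A).
have eA (A : SO3 R) : euler (euler_angles A) = A := (euler_anglesK A).2.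
have mX : cmeas [set: SO3 R] (fun A => spinX (euler_angles A) * spinX (euler_angles A)).
  apply: cmeas_eq (cmeas_entries 2^-1 2^-1 2^-1 (-2^-1) 0 0 1 1 0 1 1 0) => A _.
  have [-> _ _ _] := ent A; rewrite eA.
  by apply/eqP; rewrite eq_complex /=; apply/andP; split; apply/eqP; field.
have mY : cmeas [set: SO3 R] (fun A => spinY (euler_angles A) * spinY (euler_angles A)).
  apply: cmeas_eq (cmeas_entries 2^-1 (-2^-1) 2^-1 2^-1 1 1 0 0 1 0 0 1) => A _.
  have [_ -> _ _] := ent A; rewrite eA.
  by apply/eqP; rewrite eq_complex /=; apply/andP; split; apply/eqP; field.
have mXY : cmeas [set: SO3 R] (fun A => spinX (euler_angles A) * spinY (euler_angles A)).
  apply: cmeas_eq (cmeas_entries 2^-1 0 (-2^-1) 0 0 ord_max 0 0 1 ord_max 0 0) => A _.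
  have [_ _ -> _] := ent A; rewrite eA.
  by apply/eqP; rewrite eq_complex /=; apply/andP; split; apply/eqP; field.
have mXYc : cmeas [set: SO3 R] (fun A => spinX (euler_angles A) * (spinY (euler_angles A))^*%C).
  apply: cmeas_eq (cmeas_entries (-2^-1) 0 (-2^-1) 0 ord_max 0 0 0 ord_max 1 0 0) => A _.
  have [_ _ _ ->] := ent A; rewrite eA.
  by apply/eqP; rewrite eq_complex /=; apply/andP; split; apply/eqP; field.
have cj (F : SO3 R -> C) (G : SO3 R -> C) : cmeas [set: SO3 R] F -> (forall A, (F A)^*%C = G A) -> cmeas setT G.
  by move=> mF FG; apply: cmeas_eq (cmeas_conj mF) => A _; rewrite FG.
rewrite /spinw_SO3 /spinw /sgpow.
have od : ~~ odd (absz (k + l) + absz (k - l)) by lia.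
case: (0 <= k + l); case: (0 <= k - l); apply: cmeas_even_monomial => //.
- by apply: cj mY _ => A; rewrite conjcM.
- by apply: cj mX _ => A; rewrite conjcM.
- by apply: cj mXYc _ => A; rewrite conjcM conjcK.
- by apply: cj mX _ => A; rewrite conjcM.
- by apply: cj mY _ => A; rewrite conjcM.
- by apply: cj mXY _ => A; rewrite conjcM.
Qed.

Definition cos_SO3 (A : SO3 R) : R := \val A ord_max ord_max.

Lemma cos_SO3E (A : SO3 R) : cos_SO3 A = cos (euler_angles A).1.2.
Proof.
have [_ e] := euler_anglesK A; rewrite /cos_SO3 -[in LHS]e.
by have [_ _ [_ _ ->]] := euler_entries (euler_angles A).
Qed.

Definition spinpoly k l (p : {poly R}) (A : SO3 R) : C :=
  spinw_SO3 k l A * (p.[cos_SO3 A])%:C%C.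

Lemma cmeas_spinpoly k l p : cmeas setT (spinpoly k l p).
Proof.
apply: cmeasM; first exact: cmeas_spinw.
split => /=; last exact: measurable_cst.
have mh : measurable_fun setT (horner p : R -> R).
  apply: continuous_measurable_fun => x.
  by apply: differentiable_continuous; apply/derivable1_diffP; exact: derivable_horner.
exact: (measurableT_comp mh (measurable_SO3_entry _ _)).
Qed.

Lemma basisD_spinpoly (p : Jinf) : exists2 K : R, K != 0 &
  let: (n, k, l) := \val p in basisD p =
   (fun A : SO3 R => K%:C%C * spinpoly k l (jacobi R (absz (k - l)) (absz (k + l)) (n - maxn (absz k) (absz l))) A).
Proof.
case: p => [[[n k] l] /= knl]; have /andP[kn ln] := knl.
have [K K0 KE] := wignerD_angles_spinw kn ln; exists K => //.
apply/funext => A; rewrite /basisD /= /wignerD KE; last exact: (euler_anglesK A).1.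
by rewrite /spinpoly cos_SO3E.
Qed.

Lemma cmeas_basisD (p : Jinf) : cmeas setT (@basisD R p).
Proof.
have [K _] := basisD_spinpoly p; case: (\val p) => [[n k] l] ->.
by apply: cmeasZ; exact: cmeas_spinpoly.
Qed.

End spinor_coordinates.

(** * Orthonormality of the Wigner-D functions *)

Section sigma_finite_product.
Context d1 d2 (T1 : measurableType d1) (T2 : measurableType d2) (R : realType).
Variables (m1 : {sigma_finite_measure set T1 -> \bar R}).
Variables (m2 : {sigma_finite_measure set T2 -> \bar R}).

Lemma product_sigma_finite : sigma_finite setT (m1 \x m2)%E.
Proof.
have /sigma_finiteP[F [TF ndF Foo]] := sigma_finiteT m1.
have /sigma_finiteP[G [TG ndG Goo]] := sigma_finiteT m2.
exists (fun n => F n `*` G n) => [|n]; last first.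
  have [mF Fn] := Foo n; have [mG Gn] := Goo n; split; first exact: measurableX.
  by rewrite product_measure1E// lte_mul_pinfty// ge0_fin_numE.
apply/seteqP; split => [[x y] _|//].
have [i _ Fi] : (\bigcup_n F n) x by rewrite -TF.
have [j _ Gj] : (\bigcup_n G n) y by rewrite -TG.
exists (maxn i j) => //; split => /=.
  by apply: (subsetPset _ _ (ndF _ _ (leq_maxl i j))).
by apply: (subsetPset _ _ (ndG _ _ (leq_maxr i j))).
Qed.

(** Packaged so that a product of two measures can serve as the first factor of the triple
    product. *)
Definition sigma_finite_product : {sigma_finite_measure set (T1 * T2)%type -> \bar R} :=
  HB.pack_for {sigma_finite_measure set (T1 * T2)%type -> \bar R} (m1 \x m2)%E
    (Measure_isSigmaFinite.Build _ _ _ (m1 \x m2)%E product_sigma_finite).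

End sigma_finite_product.

Section triple_product.
Context d1 d2 d3 (T1 : measurableType d1) (T2 : measurableType d2) (T3 : measurableType d3).
Context (R : realType).
Variables (m1 : {sigma_finite_measure set T1 -> \bar R}).
Variables (m2 : {sigma_finite_measure set T2 -> \bar R}).
Variables (m3 : {sigma_finite_measure set T3 -> \bar R}).

Lemma Cintegral_prod3 (u : T1 -> R[i]) (v : T2 -> R[i]) (w : T3 -> R[i]) :
  cintegrable m1 setT u -> cintegrable m2 setT v -> cintegrable m3 setT w ->
  Cintegral ((m1 \x m2) \x m3)%E setT (fun t => u t.1.1 * v t.1.2 * w t.2) =
  Cintegral m1 setT u * Cintegral m2 setT v * Cintegral m3 setT w.
Proof.
move=> iu iv iw.
pose m12 := sigma_finite_product m1 m2.
have iuv : cintegrable m12 setT (fun z => u z.1 * v z.2) by exact: cintegrable_prod.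
by have := Cintegral_prod iuv iw; rewrite (Cintegral_prod iu iv).
Qed.

Lemma cintegrable_prod3 (u : T1 -> R[i]) (v : T2 -> R[i]) (w : T3 -> R[i]) :
  cintegrable m1 setT u -> cintegrable m2 setT v -> cintegrable m3 setT w ->
  cintegrable ((m1 \x m2) \x m3)%E setT (fun t => u t.1.1 * v t.1.2 * w t.2).
Proof.
move=> iu iv iw; pose m12 := sigma_finite_product m1 m2.
have iuv : cintegrable m12 setT (fun z => u z.1 * v z.2) by exact: cintegrable_prod.
exact: (cintegrable_prod iuv iw).
Qed.

End triple_product.

Section orthonormality.
Variable R : realType.
Local Notation C := R[i].
Local Notation leb := (@lebesgue_measure R).
Local Notation period := (`[0, 2 * pi[%classic : set R).
Implicit Types (k l : int).

Lemma crestrict_prod3 (A B D : set (measurableTypeR R)) (u v w : measurableTypeR R -> C) :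
  crestrict (A `*` B `*` D) (fun t : angles R => u t.1.1 * v t.1.2 * w t.2) =
  (fun t => crestrict A u t.1.1 * crestrict B v t.1.2 * crestrict D w t.2).
Proof.
apply/funext => -[[x y] z] /=; rewrite /crestrict /=.
case: (boolP ((x, y, z) \in A `*` B `*` D)) => [|/negP h].
  by rewrite inE /= => -[[hA hB] hD]; rewrite !mem_set.
case: ifP => hA; last by rewrite !mul0r.
case: ifP => hB; last by rewrite mulr0 mul0r.
case: ifP => hD; last by rewrite mulr0.
by exfalso; apply: h; rewrite inE /=; split; [split|]; rewrite -in_setE.
Qed.

Lemma lebesgue3_cintegrable_prod (A B D : set (measurableTypeR R))
    (u v w : measurableTypeR R -> C) :
  measurable A -> measurable B -> measurable D ->
  cintegrable leb A u -> cintegrable leb B v -> cintegrable leb D w ->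
  cintegrable (@lebesgue3 R) (A `*` B `*` D) (fun t => u t.1.1 * v t.1.2 * w t.2).
Proof.
move=> mA mB mD /(cintegrable_mkcond _ _ mA) iu /(cintegrable_mkcond _ _ mB) iv /(cintegrable_mkcond _ _ mD) iw.
apply/cintegrable_mkcond; first by apply: measurableX => //; exact: measurableX.
by rewrite crestrict_prod3; exact: cintegrable_prod3 iu iv iw.
Qed.

Lemma lebesgue3_Cintegral_prod (A B D : set (measurableTypeR R))
    (u v w : measurableTypeR R -> C) :
  measurable A -> measurable B -> measurable D ->
  cintegrable leb A u -> cintegrable leb B v -> cintegrable leb D w ->
  Cintegral (@lebesgue3 R) (A `*` B `*` D) (fun t => u t.1.1 * v t.1.2 * w t.2) =
  Cintegral leb A u * Cintegral leb B v * Cintegral leb D w.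
Proof.
move=> mA mB mD /(cintegrable_mkcond _ _ mA) iu /(cintegrable_mkcond _ _ mB) iv /(cintegrable_mkcond _ _ mD) iw.
rewrite [LHS]Cintegral_mkcond [Cintegral _ A u]Cintegral_mkcond.
rewrite [Cintegral _ B v]Cintegral_mkcond [Cintegral _ D w]Cintegral_mkcond.
rewrite -(Cintegral_prod3 iu iv iw).
by congr Cintegral; exact: crestrict_prod3.
Qed.

(** The value combines [2 / (2 n + 1)] from the substitution, the normalisation [2 n + 1] and the
    Haar constant [1 / (8 pi ^ 2)]; the two outer integrals later supply the missing [(2 pi) ^ 2].
    Integrability is asserted for all indices because it is needed also when the outer integrals
    vanish. *)
Lemma wignerd_angular_integral n n' k l k' l' :
  let v := fun b : measurableTypeR R => (halfd_tilde n (- k) (- l) b * halfd_tilde n' (- k') (- l') b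
     * (sin b / (8 * pi ^+ 2)))%:C%C in
  cintegrable leb `[0, pi] v /\
  ((absz k <= n)%N -> (absz l <= n)%N -> (absz k <= n')%N -> (absz l <= n')%N ->
   k = k' -> l = l' -> Cintegral leb `[0, pi] v = ((n == n')%:R / (4 * pi ^+ 2))%:C%C).
Proof.
move=> v; pose f (b : R) := halfd_tilde n (- k) (- l) b * halfd_tilde n' (- k') (- l') b
     * (sin b / (8 * pi ^+ 2)).
have cf : continuous f.
  move=> x; apply: cvgM; last by apply: cvgM; [exact: continuous_sin|exact: cvg_cst].
  by apply: cvgM; exact: continuous_halfd_tilde.
have if_ : leb.-integrable `[0, pi] (EFin \o f).
  apply: continuous_compact_integrable; first exact: segment_compact.
  exact: continuous_subspaceT.
split; first by split => //=; exact: integrable0.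
move=> kn ln kn' ln' kk' ll'; subst k' l'.
rewrite /Cintegral /=; have -> : (\int[leb]_(x in `[0, pi]) (0 : R))%R = 0.
  by rewrite /Rintegral integral0.
congr (_%:C)%C.
have [W WE Wi] := @halfd_orth R n n' k l kn ln kn' ln'.
pose K := Num.sqrt (2 * n + 1)%:R * Num.sqrt (2 * n' + 1)%:R / (8 * pi ^+ 2) : R.
have fE : f = (fun x => K * (W.[sin (x / 2) ^+ 2] * sin x)).
  apply/funext => x; rewrite /f /halfd_tilde !opprK -(WE _ _ (cos2Dsin2 (x / 2))) /K; ring.
have [iW eW] := integral_horner_0pi W.
have ifo : leb.-integrable `[0, pi[ (EFin \o f).
  by apply: continuous_integrable_itvco.
rewrite -[LHS]/(\int[leb]_(x in `[0, pi]) f x)%R -Rintegral_itv_bndo_bndc// fE.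
rewrite RintegralZl// eW Wi /K; case: eqP => [<-|_]; last by rewrite !mul0r !mulr0.
have v0 : (2 * n + 1)%:R != 0 :> R by rewrite pnatr_eq0 addn1.
have p0 : pi != 0 :> R by rewrite gt_eqF// pi_gt0.
rewrite -expr2 sqr_sqrtr//; move: p0 v0; move: (pi : R) (2 * n + 1)%:R => p z p0 z0.
by field; rewrite z0 p0.
Qed.

Lemma chi_conj j j' (x : measurableTypeR R) : chi j x * (chi j' x)^*%C = chi (j - j') x.
Proof. by rewrite /chi -expiN -expiD rmorphB /= mulrBl. Qed.

Lemma basisD_euler (p : Jinf) (t : angles R) : 0 <= t.1.2 <= pi ->
  basisD p (euler t) = chi (- (\val p).1.2) t.1.1
   * (halfd_tilde (\val p).1.1 (- (\val p).1.2) (- (\val p).2) t.1.2)%:C%C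
   * chi (- (\val p).2) t.2.
Proof.
move=> bt; rewrite /basisD wignerD_euler// /wignerD_angles wignerd_cos// /halfd_tilde !opprK /chi.
by rewrite !rmorphN /= !mulNr; move: (halfd _ _ _ _ _) => w; rewrite rmorphM /=; ring.
Qed.

Lemma cint_chi j : cintegrable leb period (chi j).
Proof. exact: (Cintegral_expi R j).1. Qed.

Lemma basisD_mul_euler (p q : Jinf) (t : angles R) : @euler_domain R t ->
  basisD p (euler t) * (basisD q (euler t))^*%C * (euler_density t)%:C%C =
  chi ((\val q).1.2 - (\val p).1.2) t.1.1
  * (halfd_tilde (\val p).1.1 (- (\val p).1.2) (- (\val p).2) t.1.2
     * halfd_tilde (\val q).1.1 (- (\val q).1.2) (- (\val q).2) t.1.2
     * (sin t.1.2 / (8 * pi ^+ 2)))%:C%C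
  * chi ((\val q).2 - (\val p).2) t.2.
Proof.
move=> Dt; have bt : 0 <= t.1.2 <= pi by move: Dt => [[_ +] _]; rewrite /= in_itv.
rewrite !basisD_euler// !conjcM.
have cr (a : R) : (a%:C^*)%C = a%:C%C by exact: conjc_real.
have chE (a b : int) (x : measurableTypeR R) : chi (a - b) x = chi (- b) x * (chi (- a) x)^*%C.
  by have := chi_conj (- b) (- a) x; rewrite opprK addrC => <-.
rewrite cr !chE /euler_density !rmorphM /=; ring.
Qed.

Lemma basisD_orth (p q : Jinf) :
  innerL2 (@haar R) setT (basisD p) (basisD q) = (1 * (p == q)%:R)%:C%C.
Proof.
have mpq : cmeas setT (fun A => basisD p A * (@basisD R q A)^*%C).
  by apply: cmeasM; [|apply: cmeas_conj]; exact: cmeas_basisD.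
rewrite /innerL2 haar_Cintegral// mul1r.
move: (valP p) (valP q); rewrite /Jinf_pred => /andP[kn ln] /andP[kn' ln'].
set n := (\val p).1.1 in kn ln *; set k := (\val p).1.2 in kn *; set l := (\val p).2 in ln *.
set n' := (\val q).1.1 in kn' ln' *; set k' := (\val q).1.2 in kn' *; set l' := (\val q).2 in ln' *.
pose v := fun b : measurableTypeR R => (halfd_tilde n (- k) (- l) b * halfd_tilde n' (- k') (- l') b
     * (sin b / (8 * pi ^+ 2)))%:C%C.
have [iv ev] := wignerd_angular_integral n n' k l k' l'.
have E : Cintegral (@lebesgue3 R) (@euler_domain R)
    (fun t => basisD p (euler t) * (basisD q (euler t))^*%C * (euler_density t)%:C%C) =
  Cintegral (@lebesgue3 R) (@euler_domain R) (fun t => chi (k' - k) t.1.1 * v t.1.2 * chi (l' - l) t.2).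
  rewrite Cintegral_mkcond [RHS]Cintegral_mkcond; congr Cintegral; apply/funext => t.
  by rewrite /crestrict; case: ifP => //; rewrite inE => Dt; exact: basisD_mul_euler.
rewrite E lebesgue3_Cintegral_prod//; try exact: cint_chi.
rewrite !(Cintegral_expi R _).2.
have [kk|kk] := eqVneq (k' - k) 0; last first.
  rewrite mulr0 mul0r mul0r; case: eqP => // pq; case/eqP: kk.
  by rewrite /k' /k pq subrr.
have [ll|ll] := eqVneq (l' - l) 0; last first.
  rewrite mulr0 mulr0; case: eqP => // pq; case/eqP: ll.
  by rewrite /l' /l pq subrr.
have {}kk : k = k' by apply/esym/eqP; rewrite -subr_eq0 kk.
have {}ll : l = l' by apply/esym/eqP; rewrite -subr_eq0 ll.
rewrite ev//; last 2 first.
- by rewrite kk.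
- by rewrite ll.
have -> : (p == q) = (n == n').
  rewrite -(inj_eq val_inj) /= [\val p]surjective_pairing [\val q]surjective_pairing.
  rewrite [(\val p).1]surjective_pairing [(\val q).1]surjective_pairing.
  by rewrite -/n -/n' -/k -/k' -/l -/l' kk ll !xpair_eqE !eqxx !andbT.
rewrite -!rmorphM /= !mulr1; congr (_%:C)%C.
have p0 : pi != 0 :> R by rewrite gt_eqF// pi_gt0.
by move: p0; move: (pi : R) => z z0; field; rewrite z0.
Qed.

Lemma L2_basisD (p : Jinf) : L2 (@haar R) setT (@basisD R p).
Proof.
have [mr mi] := cmeas_basisD R p; split => //.
have [iv _] := wignerd_angular_integral (\val p).1.1 (\val p).1.1 (\val p).1.2 (\val p).2 (\val p).1.2 (\val p).2.
have mp : measurable (period : set (measurableTypeR R)) by exact: measurable_itv.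
have mq : measurable (`[0, pi]%classic : set (measurableTypeR R)) by exact: measurable_itv.
have [ir _] := lebesgue3_cintegrable_prod mp mq mp (cint_chi ((\val p).1.2 - (\val p).1.2)) iv (cint_chi ((\val p).2 - (\val p).2)).
rewrite haar_sqnormL2//.
move/integrableP : ir => [_]; apply: le_lt_trans; rewrite le_eqVlt; apply/orP; left; apply/eqP.
apply: eq_integral => t; rewrite inE => Dt.
transitivity (`|complex.Re (basisD p (euler t) * (basisD p (euler t))^*%C * (euler_density t)%:C%C)|%:E); last by rewrite (basisD_mul_euler p p Dt).
rewrite mul_conj -rmorphM [complex.Re _]/= ger0_norm// mulr_ge0 ?sqmod_ge0//; exact: density_ge0.
Qed.

End orthonormality.

(** * Approximation by an algebra of bounded functions *)

Import HBNNSimple.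

(** * A cubic iteration converging to the sign function *)

Section smoothstep.
Variable R : realType.
Implicit Types x : R.

(** A polynomial map of [[-1, 1]] that fixes [-1], 0 and 1, where 0 repels and both ends attract. *)
Definition smoothstep x : R := 3 / 2 * x - 1 / 2 * x ^+ 3.

Lemma smoothstepN x : smoothstep (- x) = - smoothstep x.
Proof. by rewrite /smoothstep; ring. Qed.

Lemma smoothstep0 : smoothstep 0 = 0.
Proof. by rewrite /smoothstep; ring. Qed.

Lemma iter_smoothstepN n x : iter n smoothstep (- x) = - iter n smoothstep x.
Proof. by elim: n => //= n ->; exact: smoothstepN. Qed.

Lemma iter_smoothstep0 n : iter n smoothstep 0 = 0.
Proof. by elim: n => //= n ->; exact: smoothstep0. Qed.

(** The distance [1 - y] is multiplied by [(1 - y) (2 + y) / 2], which is at most [1 - x / 2] since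
    the iterates [y] never fall below [x]. *)
Lemma iter_smoothstep_pos n x : 0 < x <= 1 ->
  x <= iter n smoothstep x <= 1 /\ 1 - iter n smoothstep x <= (1 - x / 2) ^+ n.
Proof.
move=> /andP[x0 x1]; elim: n => [|n [/andP[h1 h2] h3]] /=.
  by rewrite lexx x1 expr0; split => //; lra.
set y := iter n smoothstep x in h1 h2 h3 *.
have y0 : 0 < y by lra.
have e1 : smoothstep y - y = y * ((1 - y) * (1 + y)) / 2 by rewrite /smoothstep; field.
have e2 : 1 - smoothstep y = (1 - y) * ((1 - y) * (2 + y) / 2) by rewrite /smoothstep; field.
have p1 : 0 <= (1 - y) * (1 + y) by apply: mulr_ge0; lra.
have p2 : 0 <= (1 - y) * (2 + y) / 2 by apply: divr_ge0 => //; apply: mulr_ge0; lra.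
have p3 : (1 - y) * (2 + y) / 2 <= 1 - x / 2 by nra.
have p4 : 0 <= y * ((1 - y) * (1 + y)) / 2 by apply: divr_ge0 => //; apply: mulr_ge0 => //; exact: ltW.
split; last by rewrite e2 exprSr ler_pM//; lra.
apply/andP; split; first by lra.
by rewrite -subr_ge0 e2 mulr_ge0//; lra.
Qed.

Lemma iter_smoothstep_bound n x : `|x| <= 1 -> `|iter n smoothstep x| <= 1.
Proof.
rewrite !ler_norml => /andP[x1 x2]; have [x0|x0|->] := ltgtP x 0.
- have /(iter_smoothstep_pos n)[/andP[h1 h2] _] : 0 < - x <= 1 by apply/andP; split; lra.
  rewrite iter_smoothstepN in h1 h2; apply/andP; split; lra.
- have /(iter_smoothstep_pos n)[/andP[h1 h2] _] : 0 < x <= 1 by apply/andP; split; lra.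
  by apply/andP; split; lra.
- by rewrite iter_smoothstep0; apply/andP; split; lra.
Qed.

Lemma cvg_iter_smoothstep x : `|x| <= 1 ->
  iter n smoothstep x @[n --> \oo] --> Num.sg x.
Proof.
have pos y : 0 < y <= 1 -> iter n smoothstep y @[n --> \oo] --> (1 : R).
  move=> y01; have /andP[y0 y1] := y01.
  have c0 : (1 - (1 - y / 2) ^+ n) @[n --> \oo] --> (1 : R).
    rewrite -[X in _ --> X]subr0; apply: cvgB; first exact: cvg_cst.
    by apply: cvg_expr; rewrite ger0_norm; lra.
  apply: squeeze_cvgr; [|exact: c0|exact: cvg_cst]; near=> n.
  have [/andP[_ h2] h3] := iter_smoothstep_pos n y01.
  by apply/andP; split; lra.
rewrite ler_norml => /andP[x1 x2]; have [x0|x0|->] := ltgtP x 0.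
- rewrite ltr0_sg// -[x]opprK; under eq_fun do rewrite iter_smoothstepN.
  by apply: cvgN; apply: pos; apply/andP; split; lra.
- by rewrite gtr0_sg//; apply: pos; apply/andP; split; lra.
- by rewrite sgr0; under eq_fun do rewrite iter_smoothstep0; exact: cvg_cst.
Unshelve. all: by end_near.
Qed.

End smoothstep.

(** * The L2 closure of an algebra of bounded functions *)

Section approximation.
Context d (T : measurableType d) (R : realType).
Variable mu : {measure set T -> \bar R}.
Hypothesis mu_fin : (mu setT < +oo)%E.
Local Notation C := R[i].
Variable S : set (T -> C).
Hypothesis S_meas : forall f, S f -> cmeas setT f.
Hypothesis S_bound : forall f, S f -> exists M : R, forall x, sqmod (f x) <= M.
Hypothesis S_one : S (fun=> 1).
Hypothesis S_add : forall f g, S f -> S g -> S (fun x => f x + g x).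
Hypothesis S_scale : forall (c : C) f, S f -> S (fun x => c * f x).
Hypothesis S_mul : forall f g, S f -> S g -> S (fun x => f x * g x).
Local Notation nrm := (sqnormL2 mu setT).
Local Notation mT := (@measurableT _ T).
Implicit Types (f g h : T -> C) (u v : T -> R).

Definition approximable f := forall e : R, 0 < e ->
  exists2 g, S g & (nrm (fun x => f x - g x)%R <= e%:E)%E.

Lemma approximable_self f : S f -> approximable f.
Proof.
move=> Sf e e0; exists f => //; rewrite /sqnormL2.
by under eq_integral do rewrite subrr sqmod0; rewrite integral0 lee_fin ltW.
Qed.

Lemma sqnormL2_split (a b : R) f g h : cmeas setT f -> cmeas setT g -> cmeas setT h ->
  (nrm (fun x => f x - g x)%R <= a%:E)%E -> (nrm (fun x => g x - h x)%R <= b%:E)%E ->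
  (nrm (fun x => f x - h x)%R <= (2 * a + 2 * b)%:E)%E.
Proof.
move=> mf mg mh fg gh.
have -> : (fun x => f x - h x) = (fun x => (f x - g x) + (g x - h x)).
  by apply/funext => x; rewrite addrA subrK.
apply: le_trans (sqnormL2D_le _ mT (cmeasB mf mg) (cmeasB mg mh)) _.
by rewrite [leRHS]EFinD (EFinM 2 a) (EFinM 2 b); apply: leeD; apply: lee_wpmul2l => //; rewrite lee_fin.
Qed.

Lemma approximable_trans f : cmeas setT f ->
  (forall e : R, 0 < e -> exists h, [/\ cmeas setT h, approximable h &
     (nrm (fun x => f x - h x)%R <= e%:E)%E]) -> approximable f.
Proof.
move=> mf H e e0; have e4 : 0 < e / 4 by rewrite divr_gt0.
have [h [mh ah fh]] := H _ e4; have [g Sg hg] := ah _ e4.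
exists g => //; apply: le_trans (sqnormL2_split mf mh (S_meas Sg) fh hg) _.
by rewrite lee_fin; lra.
Qed.

Lemma approximableZ (c : C) f : cmeas setT f -> approximable f -> approximable (fun x => c * f x).
Proof.
move=> mf af e e0; have c0 : 0 < sqmod c + 1 by have := sqmod_ge0 c; lra.
have [|g Sg fg] := af (e / (sqmod c + 1)); first by rewrite divr_gt0.
exists (fun x => c * g x); first exact: S_scale.
under eq_fun do rewrite -mulrBr.
rewrite sqnormL2Z//; last by apply: cmeasB => //; exact: S_meas.
apply: (@le_trans _ _ ((sqmod c)%:E * (e / (sqmod c + 1))%:E)%E).
  by apply: lee_wpmul2l => //; rewrite lee_fin sqmod_ge0.
rewrite -EFinM lee_fin mulrA ler_pdivrMr// mulrC ler_pM2l//; lra.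
Qed.

Lemma approximableD f g : cmeas setT f -> cmeas setT g ->
  approximable f -> approximable g -> approximable (fun x => f x + g x).
Proof.
move=> mf mg af ag e e0; have e4 : 0 < e / 4 by rewrite divr_gt0.
have [f' Sf ff] := af _ e4; have [g' Sg gg] := ag _ e4.
exists (fun x => f' x + g' x); first exact: S_add.
have -> : (fun x => f x + g x - (f' x + g' x)) = (fun x => (f x - f' x) + (g x - g' x)).
  by apply/funext => x; rewrite opprD addrACA.
apply: le_trans (sqnormL2D_le _ mT _ _) _.
- by apply: cmeasB => //; exact: S_meas.
- by apply: cmeasB => //; exact: S_meas.
apply: (@le_trans _ _ (2%:E * (e / 4)%:E + 2%:E * (e / 4)%:E)%E).
  by apply: leeD; apply: lee_wpmul2l => //; rewrite lee_fin.
by rewrite -!EFinM -EFinD lee_fin; lra.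
Qed.

Definition sqmod_bounded f := exists M : R, forall x, sqmod (f x) <= M.

(** The factors are replaced one at a time: [g] by an element [h] of [S], using that [f] is bounded,
    then [f] by an element of [S], using that [h] is bounded. *)
Lemma approximableM f g : cmeas setT f -> cmeas setT g -> sqmod_bounded f -> 
  approximable f -> approximable g -> approximable (fun x => f x * g x).
Proof.
move=> mf mg [M bf] af ag.
have bM f1 h1 h2 (K : R) : (forall x, sqmod (f1 x) <= K) -> cmeas setT f1 ->
    cmeas setT h1 -> cmeas setT h2 ->
    (nrm (fun x => f1 x * h1 x - f1 x * h2 x)%R <= (`|K| + 1)%:E * nrm (fun x => h1 x - h2 x)%R)%E.
  move=> fK mf1 mh1 mh2; have mh := cmeasB mh1 mh2.
  have := le_sqnormL2 mu mT _ (lexx 0) (cmeasM mf1 mh) mh mh.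
  move=> /(_ (`|K| + 1)); rewrite mul0e adde0; under eq_fun do rewrite mulrBr; apply.
    by rewrite addr_ge0.
  move=> x _; rewrite mul0r addr0 sqmodM ler_wpM2r ?sqmod_ge0//.
  by have := fK x; have := ler_norm K; lra.
apply: approximable_trans => [|e e0]; first exact: cmeasM.
have sK (K : R) : 0 < `|K| + 1 by rewrite ltr_wpDl.
have [|h Sh gh] := ag (e / (`|M| + 1)); first by rewrite divr_gt0.
have mh := S_meas Sh; exists (fun x => f x * h x); split; first exact: cmeasM.
  have [K hK] := S_bound Sh; move=> e' e'0.
  have [|k Sk fk] := af (e' / (`|K| + 1)); first by rewrite divr_gt0.
  exists (fun x => h x * k x); first exact: S_mul.
  under eq_fun do rewrite [f _ * _]mulrC.
  apply: le_trans (bM _ _ _ _ hK mh mf (S_meas Sk)) _.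
  apply: le_trans (lee_wpmul2l _ fk) _; first by rewrite lee_fin ltW.
  by rewrite -EFinM lee_fin mulrC divfK// gt_eqF.
apply: le_trans (bM _ _ _ _ bf mf mg mh) _.
apply: le_trans (lee_wpmul2l _ gh) _; first by rewrite lee_fin ltW.
by rewrite -EFinM lee_fin mulrC divfK// gt_eqF.
Qed.

Definition realC u : T -> C := fun x => (u x)%:C%C.

Lemma cmeas_realC u : measurable_fun setT u -> cmeas setT (realC u).
Proof. by move=> mu_; split => //=; exact: measurable_cst. Qed.

Lemma approximable_dominated (F : nat -> T -> R) u v :
  (forall n, measurable_fun setT (F n)) -> measurable_fun setT u ->
  mu.-integrable setT (EFin \o v) ->
  (forall n x, (F n x - u x) ^+ 2 <= v x) ->
  (forall x, F n x @[n --> \oo] --> u x) ->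
  (forall n, approximable (realC (F n))) -> approximable (realC u).
Proof.
move=> mF mu_ iv Fv Fu aF; apply: approximable_trans => [|e e0]; first exact: cmeas_realC.
pose g n := EFin \o (fun x => (F n x - u x) ^+ 2).
have mg n : measurable_fun setT (g n).
  by apply/measurable_EFinP; apply: measurable_funX; exact: measurable_funB.
have : (\int[mu]_(x in setT) g n x)%E @[n --> \oo] --> (\int[mu]_(x in setT) 0)%E.
  apply: (dominated_cvg mT mg _ _ iv) => //.
    move=> x _; apply: cvg_EFin; first by near=> n.
    rewrite [X in X @ _ --> _](_ : _ = (fun n => (F n x - u x) ^+ 2))//.
    have : (F n x - u x) * (F n x - u x) @[n --> \oo] --> (u x - u x) * (u x - u x).
      by apply: cvgM; apply: cvgB => //; exact: cvg_cst.
    by rewrite subrr mulr0; under eq_fun do rewrite -expr2.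
  by move=> n x _; rewrite /g /= ger0_norm ?sqr_ge0// lee_fin.
rewrite integral0 => /fine_cvgP[_ /cvgrPdist_le /(_ _ e0)[N _ /(_ N (leqnn N))]] /=.
rewrite sub0r normrN => gN.
have Efin : (\int[mu]_x g N x)%E \is a fin_num.
  have : mu.-integrable setT (g N).
    apply: (le_integrable mT _ _ iv) => // x _ /=.
    by rewrite !ger0_norm ?sqr_ge0// ?lee_fin//; apply: le_trans (Fv N x); exact: sqr_ge0.
  by move=> /(integrable_fin_num mT).
exists (realC (F N)); split => //; first exact: cmeas_realC.
have -> : nrm (fun x => realC u x - realC (F N) x) = (\int[mu]_x g N x)%E.
  apply: eq_integral => x _.
  by rewrite /realC -rmorphB /= sqmod_real /g /= -sqrrN opprB.
by rewrite -(fineK Efin) lee_fin; apply: le_trans gN; exact: ler_norm.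
Unshelve. all: by end_near.
Qed.

(** Boundedness is part of the notion because it is what makes these functions stable under
    products. *)
Definition good u := [/\ measurable_fun setT u, (exists M, forall x, `|u x| <= M) &
  approximable (realC u)].

Lemma goodD u v : good u -> good v -> good (fun x => u x + v x).
Proof.
move=> [m1 [M1 b1] a1] [m2 [M2 b2] a2]; split; first exact: measurable_funD.
  by exists (M1 + M2) => x; apply: le_trans (ler_normD _ _) _; exact: lerD.
have -> : realC (fun x => u x + v x) = (fun x => realC u x + realC v x).
  by apply/funext => x; rewrite /realC rmorphD.
by apply: approximableD => //; exact: cmeas_realC.
Qed.

Lemma goodM u v : good u -> good v -> good (fun x => u x * v x).
Proof.
move=> [m1 [M1 b1] a1] [m2 [M2 b2] a2]; split; first exact: measurable_funM.
  by exists (M1 * M2) => x; rewrite normrM ler_pM.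
have -> : realC (fun x => u x * v x) = (fun x => realC u x * realC v x).
  by apply/funext => x; rewrite /realC rmorphM.
apply: approximableM => //; try exact: cmeas_realC.
exists (M1 ^+ 2) => x; rewrite /realC sqmod_real -real_normK ?num_real//.
by rewrite lerXn2r// nnegrE; apply: le_trans (b1 x); exact: normr_ge0.
Qed.

Lemma good_cst (c : R) : good (fun=> c).
Proof.
split; [exact: measurable_cst|by exists (Num.norm c)|].
apply: approximable_self; rewrite [realC _](_ : _ = (fun x => c%:C%C * 1)).
  exact: S_scale.
by apply/funext => x; rewrite mulr1.
Qed.

Lemma goodZ (c : R) u : good u -> good (fun x => c * u x).
Proof. by move=> gu; exact: goodM (good_cst c) gu. Qed.

Lemma good_lim (F : nat -> T -> R) u : (forall n, good (F n)) ->
  (forall n x, `|F n x| <= 1) -> (forall x, F n x @[n --> \oo] --> u x) -> good u.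
Proof.
move=> gF F1 Fu; have mF n : measurable_fun setT (F n) by have [] := gF n.
have mu_ : measurable_fun setT u by apply: (measurable_fun_cvg mF) => x _; exact: Fu.
have u1 x : `|u x| <= 1.
  have c : `|F n x| @[n --> \oo] --> `|u x| by apply: cvg_norm; exact: Fu.
  rewrite -(cvg_lim _ c)//.
  by apply: limr_le; [exact: cvgP c|near=> n].
split => //; first by exists 1.
apply: (@approximable_dominated F u (fun=> 4)) => //; last by move=> n; have [] := gF n.
  apply/integrableP; split; first by apply/measurable_EFinP; exact: measurable_cst.
  under eq_integral do rewrite /=; rewrite integral_cst// lte_mul_pinfty//.
move=> n x; have := F1 n x; have := u1 x; rewrite !ler_norml => /andP[? ?] /andP[? ?]; nra.
Unshelve. all: by end_near.
Qed.

(** After scaling into [[-1, 1]] the iterates of [smoothstep] are polynomials in [u], hence good,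
    and converge boundedly to the sign. *)
Lemma good_sg u : good u -> good (fun x => Num.sg (u x)).
Proof.
move=> gu; have [_ [M uM] _] := gu.
have K0 : 0 < `|M| + 1 by rewrite ltr_wpDl.
pose w x := (`|M| + 1)^-1 * u x.
have w1 x : `|w x| <= 1.
  rewrite /w normrM normfV (gtr0_norm K0) mulrC ler_pdivrMr// mul1r.
  by have := uM x; have := ler_norm M; lra.
have -> : (fun x => Num.sg (u x)) = (fun x => Num.sg (w x)).
  by apply/funext => x; rewrite /w sgrM (gtr0_sg (_ : 0 < (`|M| + 1)^-1)) ?invr_gt0// mul1r.
apply: (@good_lim (fun n x => iter n (@smoothstep R) (w x))).
- elim=> [|n IH]; first exact: goodZ.
  have -> : (fun x => iter n.+1 (@smoothstep R) (w x)) =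
      (fun x => 3 / 2 * iter n (@smoothstep R) (w x) + - (1 / 2) *
        (iter n (@smoothstep R) (w x) * (iter n (@smoothstep R) (w x) * iter n (@smoothstep R) (w x)))).
    by apply/funext => x; rewrite iterS {1}/smoothstep; ring.
  by apply: goodD; apply: goodZ => //; apply: goodM => //; exact: goodM.
- by move=> n x; exact: iter_smoothstep_bound.
- by move=> x; exact: cvg_iter_smoothstep.
Qed.

Definition good_set (A : set T) := measurable A /\ good (\1_A : T -> R).

Lemma good_set_pos u : good u -> good_set [set x | 0 < u x].
Proof.
move=> gu; have [mu_ _ _] := gu; split.
  rewrite [X in measurable X](_ : _ = setT `&` u @^-1` `]0, +oo[%classic); first exact: mu_.
  by apply/seteqP; split => x /=; rewrite in_itv /= andbT; [move=> ?; split|case].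
have gs := good_sg gu.
have -> : \1_[set x | 0 < u x] = (fun x => 1 / 2 * (Num.sg (u x) * Num.sg (u x) + Num.sg (u x))).
  apply/funext => x; rewrite indicE; have [u0|u0|u0] := ltgtP (u x) 0.
  - by rewrite memNset /= ?ltr0_sg//; [ring|apply/negP; rewrite -leNgt ltW].
  - by rewrite mem_set //= gtr0_sg//; field.
  - by rewrite memNset /= ?u0 ?sgr0 ?ltxx//; ring.
by apply: goodZ; apply: goodD => //; exact: goodM.
Qed.

(** For a countable union, the finite products of [1 - \1_(A i)] converge boundedly to the indicator
    of the complement. *)
Lemma good_sigma_algebra : sigma_algebra setT good_set.
Proof.
have setC A : good_set A -> good_set (~` A).
  move=> [mA gA]; split; first exact: measurableC.
  have -> : \1_(~` A) = (fun x => 1 + -1 * \1_A x) :> (T -> R).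
    by apply/funext => x; rewrite !indicE in_setC; case: (x \in A) => /=; ring.
  by apply: goodD; [exact: good_cst|exact: goodZ].
split.
- split => //; rewrite indic0; exact: good_cst.
- by move=> A gA; rewrite setTD; exact: setC.
move=> A gA; rewrite -[\bigcup_k _]setCK; apply: setC.
have mU : measurable (\bigcup_k A k) by apply: bigcup_measurable => k _; have [] := gA k.
split; first exact: measurableC.
pose F n x : R := \prod_(i < n) (1 + -1 * \1_(A i) x).
have F01 n x : F n x = (~~ [exists i : 'I_n, x \in A i])%:R.
  rewrite /F; case: existsP => [[i xi]|h] /=.
    by rewrite (bigD1 i)//= indicE xi mulN1r subrr mul0r.
  rewrite big1// => i _; rewrite indicE; case: (boolP (x \in A i)) => [xi|_].
    by exfalso; apply: h; exists i.
  by rewrite mulr0 addr0.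
apply: (@good_lim F).
- elim=> [|n IH].
    rewrite [F _](_ : _ = fun=> 1); first exact: good_cst.
    by apply/funext => x; rewrite /F big_ord0.
  rewrite [F _](_ : _ = fun x => F n x * (1 + -1 * \1_(A n) x)); last first.
    by apply/funext => x; rewrite /F big_ord_recr.
  apply: goodM => //; apply: goodD; first exact: good_cst.
  by apply: goodZ; have [] := gA n.
- by move=> n x; rewrite F01; case: (~~ _); rewrite ?normr1 ?normr0.
- move=> x; rewrite indicE; case: (boolP (x \in ~` _)) => [|].
    rewrite inE /= => h; rewrite [X in X @ _ --> _](_ : _ = fun=> 1); first exact: cvg_cst.
    apply/funext => n; rewrite F01; case: existsP => [[j xj]|//]; rewrite inE in xj.
    by exfalso; apply: h; exists j.
  rewrite notin_setE /= => /contrapT[k _ xk].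
  apply: (cvg_near_cst (0 : R)); exists k.+1 => // n /= kn; rewrite F01.
  by case: existsP => //= h; exfalso; apply: h; exists (Ordinal kn); rewrite /= inE.
Qed.

Hypothesis good_measurable : measurable `<=` good_set.

(** The simple functions below [u] are combinations of good indicators, and [u ^ 2] dominates the
    squared errors. *)
Lemma approximable_nonneg u : measurable_fun setT u -> (forall x, 0 <= u x) ->
  mu.-integrable setT (EFin \o (fun x => u x ^+ 2)) -> approximable (realC u).
Proof.
move=> mu_ u0 iu.
have mE : measurable_fun setT (EFin \o u) by exact/measurable_EFinP.
pose q := nnsfun_approx mT mE.
have u0E x : setT x -> (0 <= (EFin \o u) x)%E by move=> _; rewrite lee_fin.
have qu x : q n x @[n --> \oo] --> u x.
  have := cvg_nnsfun_approx mT mE u0E (I : setT x).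
  by move=> /fine_cvgP[_].
have qle n x : q n x <= u x.
  rewrite -(cvg_lim _ (qu x))//.
  apply: nondecreasing_cvgn_le; last by apply: cvgP; exact: qu.
  by move=> a b ab; exact/lefP/nd_nnsfun_approx.
apply: (@approximable_dominated (fun n => q n) u (fun x => u x ^+ 2)) => //.
  move=> n x; have := qle n x; have : 0 <= q n x by []; move: (q n x) (u x) (u0 x) => a b; nra.
move=> n.
have qE x : q n x = \sum_(y <- fset_set (range (q n))) y * \1_(q n @^-1` [set y]) x.
  by rewrite [LHS]fimfunE fsbig_finite.
have -> : realC (q n) = realC (fun x => \sum_(y <- fset_set (range (q n))) y * \1_(q n @^-1` [set y]) x).
  by apply/funext => x; rewrite /realC qE.
suff : good (fun x => \sum_(y <- fset_set (range (q n))) y * \1_(q n @^-1` [set y]) x) by case.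
elim: (enum_fset _) => [|y s IH].
  by under eq_fun do rewrite big_nil; exact: good_cst.
under eq_fun do rewrite big_cons; apply: goodD => //; apply: goodZ.
by have [] := good_measurable (measurable_sfunP (q n) (measurable_set1 y)).
Qed.

Lemma approximable_L2 f : L2 mu setT f -> approximable f.
Proof.
move=> Lf; have [mr mi _] := Lf.
have isq := L2_sqmod_integrable Lf.
have part u : measurable_fun setT u -> (forall x, u x ^+ 2 <= sqmod (f x)) -> approximable (realC u).
  move=> mu_ ub.
  have pos v : measurable_fun setT v -> (forall x, v x ^+ 2 <= sqmod (f x)) ->
      approximable (realC (fun x => Num.max (v x) 0)).
    move=> mv vb; have mm : measurable_fun setT (fun x => Num.max (v x) 0).
      by apply: measurable_maxr => //; exact: measurable_cst.
    apply: approximable_nonneg => //; first by move=> x; rewrite le_max lexx orbT.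
    apply: (le_integrable mT _ _ isq) => [|x _ /=].
      by apply/measurable_EFinP; exact: measurable_funX.
    rewrite lee_fin !ger0_norm ?sqr_ge0 ?sqmod_ge0//; apply: le_trans (vb x).
    by have [v0|v0] := leP (v x) 0; rewrite ?expr0n ?sqr_ge0.
  have -> : realC u = (fun x => realC (fun x => Num.max (u x) 0) x +
      -1 * realC (fun x => Num.max (- u x) 0) x).
    apply/funext => x; rewrite /realC mulN1r -rmorphB /=; congr (_%:C)%C.
    by have [h|h] := leP (u x) 0; have [h'|h'] := leP (- u x) 0; lra.
  have mp v : measurable_fun setT v -> cmeas setT (realC (fun x => Num.max (v x) 0)).
    by move=> mv; apply: cmeas_realC; apply: measurable_maxr => //; exact: measurable_cst.
  have mN : measurable_fun setT (fun x => - u x) by exact: measurable_funN.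
  apply: approximableD; [exact: mp|by apply: cmeasZ; exact: mp|exact: pos|].
  apply: approximableZ; first exact: mp.
  by apply: pos => // x; rewrite sqrrN.
have -> : f = (fun x => realC (fun x => complex.Re (f x)) x + 'i%C * realC (fun x => complex.Im (f x)) x).
  apply/funext => x; rewrite /realC; case: (f x) => a b /=; apply/eqP; rewrite eq_complex /=.
  by apply/andP; split; apply/eqP; ring.
apply: approximableD; [exact: cmeas_realC|by apply: cmeasZ; exact: cmeas_realC| |].
  by apply: part => // x; rewrite sqmodE lerDl sqr_ge0.
apply: approximableZ; first exact: cmeas_realC.
by apply: part => // x; rewrite sqmodE lerDr sqr_ge0.
Qed.

End approximation.

(** * Completeness of the Wigner-D functions *)

Section finite_span.
Context (T : Type) (I : choiceType) (R : realType) (e : I -> T -> R[i]).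
Local Notation C := R[i].
Implicit Types (f g : T -> C).

(* The sums over all large enough finite sets agree, so that no bookkeeping of
   supports is needed when combining two elements. *)
Definition fin_span f := exists (c : I -> C) (s0 : {fset I}),
  forall F : {fset I}, (s0 `<=` F)%fset -> forall x, f x = \sum_(i <- F) c i * e i x.

Lemma fin_spanD f g : fin_span f -> fin_span g -> fin_span (fun x => f x + g x).
Proof.
move=> [c [s cs]] [c' [s' cs']]; exists (fun i => c i + c' i), (s `|` s')%fset => F sF x.
rewrite (cs F) ?(cs' F)//; last 2 first.
- by apply: fsubset_trans sF; exact: fsubsetUr.
- by apply: fsubset_trans sF; exact: fsubsetUl.
by rewrite -big_split /=; apply: eq_bigr => i _; rewrite mulrDl.
Qed.

Lemma fin_spanZ (a : C) f : fin_span f -> fin_span (fun x => a * f x).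
Proof.
move=> [c [s cs]]; exists (fun i => a * c i), s => F sF x.
by rewrite (cs F)// mulr_sumr; apply: eq_bigr => i _; rewrite mulrA.
Qed.

Lemma fin_span0 : fin_span (fun=> 0).
Proof.
by exists (fun=> 0), fset0 => F _ x; rewrite big1// => i _; rewrite mul0r.
Qed.

Lemma fin_span_basis i : fin_span (e i).
Proof.
exists (fun j => (j == i)%:R), [fset i]%fset => F; rewrite fsub1set => iF x.
rewrite (bigD1_seq i) ?fset_uniq//= eqxx mul1r big1 ?addr0// => j /negPf ->.
by rewrite mul0r.
Qed.

Lemma fin_span_sum (J : Type) (s : seq J) (F : J -> T -> C) :
  (forall j, fin_span (F j)) -> fin_span (fun x => \sum_(j <- s) F j x).
Proof.
move=> sF; elim: s => [|j s IH].
  by under eq_fun do rewrite big_nil; exact: fin_span0.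
by under eq_fun do rewrite big_cons; exact: fin_spanD.
Qed.

Lemma fin_span_repr f : fin_span f -> exists (c : I -> C) (s : seq I),
  f = fun x => \sum_(i <- s) c i * e i x.
Proof.
by move=> [c [s cs]]; exists c, s; apply/funext => x; exact: cs.
Qed.

End finite_span.

Section jacobi_size.
Variable R : realType.

(** The leading coefficient is a positive multiple of a sum of products of binomials whose first
    term is nonzero. The degree is thus exactly [s], which permits the elimination in
    [spinpoly_span]. *)
Lemma size_coef_jacobi a b s : (size (jacobi R a b s) <= s.+1)%N /\ (jacobi R a b s)`_s != 0.
Proof.
have bnd m : (m <= s)%N ->
    (('X - 1 : {poly R}) ^+ m * ('X + 1) ^+ (s - m)) \is monic /\
    size (('X - 1 : {poly R}) ^+ m * ('X + 1) ^+ (s - m)) = s.+1.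
  move=> ms; have m1 : ('X - 1 : {poly R}) \is monic by exact: monicXsubC.
  have m2 : ('X + 1 : {poly R}) \is monic by exact: monicXaddC.
  have n1 : 'X - 1 != 0 :> {poly R} by exact: monic_neq0.
  have n2 : 'X + 1 != 0 :> {poly R} by exact: monic_neq0.
  split; first by rewrite rpredM// rpredX.
  have z1 : size ('X - 1 : {poly R}) = 2 by exact: size_XsubC.
  have z2 : size ('X + 1 : {poly R}) = 2 by exact: size_XaddC.
  have := size_exp ('X - 1 : {poly R}) m; have := size_exp ('X + 1 : {poly R}) (s - m).
  rewrite z1 z2 size_mul ?expf_neq0// => e2 e1.
  have p1 : (0 < size (('X - 1 : {poly R}) ^+ m))%N by rewrite size_poly_gt0 expf_neq0.
  have p2 : (0 < size (('X + 1 : {poly R}) ^+ (s - m)))%N by rewrite size_poly_gt0 expf_neq0.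
  move: p1 p2 e1 e2; rewrite /= !mul1n; move: (size (polyseq (_ ^+ m))) (size (polyseq (_ ^+ (s - m)))) => u v.
  by move: ms; clear; lia.
have E : jacobi R a b s = 2^-1 ^+ s *: \sum_(m < s.+1) ('C(s + a, s - m) * 'C(s + b, m))%:R *:
    (('X - 1) ^+ m * ('X + 1) ^+ (s - m)).
  rewrite /jacobi scaler_sumr; apply: eq_bigr => m _.
  have ms : (m <= s)%N by rewrite -ltnS.
  rewrite !exprZn -scalerAl -scalerAr !scalerA; congr (_ *: _).
  by rewrite -mulrA -exprD subnKC// mulrC.
rewrite E; split.
  apply: (leq_trans (size_scale_leq _ _)); apply: (leq_trans (size_sum _ _ _)).
  apply/bigmax_leqP => m _; apply: (leq_trans (size_scale_leq _ _)).
  by have [_ ->] := bnd m (ltn_ord m).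
rewrite coefZ mulf_neq0 ?expf_neq0 ?invr_neq0 ?pnatr_eq0// coef_sum.
under eq_bigr => m _.
  rewrite coefZ; have [mon sz] := bnd m (ltn_ord m).
  move: mon; rewrite monicE lead_coefE sz /= => /eqP ->; rewrite mulr1.
  over.
rewrite big_ord_recl /= subn0 bin0 muln1 gt_eqF//.
apply: ltr_wpDr; first by apply: sumr_ge0 => i _; exact: ler0n.
by rewrite ltr0n bin_gt0 leq_addr.
Qed.

End jacobi_size.

Lemma absz_add_parity (x y : int) : exists i, (absz x + absz y = absz (x + y)%R + 2 * i)%N.
Proof.
have [x0|x0] := leP 0 x; have [y0|y0] := leP 0 y.
- by exists 0%N; lia.
- by exists (minn (absz x) (absz y)); lia.
- by exists (minn (absz x) (absz y)); lia.
- by exists 0%N; lia.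
Qed.

(** * The span of the Wigner-D functions as an algebra *)

Section rotation_algebra.
Variable R : realType.
Local Notation C := R[i].
Local Notation spanD := (fin_span (@basisD R)).

(** By the parity of [|x| + |y| - |x + y|], the half-angle powers in excess are even, hence powers
    of [(1 + cos b) / 2] and [(1 - cos b) / 2], and they join the polynomial factor. *)
Lemma spinpoly_mul k l k' l' (p p' : {poly R}) : exists q : {poly R},
  (fun A => spinpoly k l p A * spinpoly k' l' p' A) = spinpoly (k + k') (l + l') q.
Proof.
have [i iE] := absz_add_parity (k + l) (k' + l').
have [j jE] := absz_add_parity (k - l) (k' - l').
exists (p * p' * ((2^-1)%:P * (1 + 'X)) ^+ i * ((2^-1)%:P * (1 - 'X)) ^+ j).
apply/funext => A; rewrite /spinpoly /spinw_SO3 !spinwE cos_SO3E.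
move: (euler_angles A) => t; have [h1 h2 _] := half_angle_trig t.1.2.
rewrite !hornerM !horner_exp !hornerM hornerD hornerD hornerN hornerX !hornerC.
set c := cos (t.1.2 / 2) in h1 *; set s := sin (t.1.2 / 2) in h2 *.
rewrite ![2^-1 * _]mulrC -h1 -h2.
have -> : k + k' + (l + l') = k + l + (k' + l') by ring.
have -> : k + k' - (l + l') = k - l + (k' - l') by ring.
rewrite !rmorphD /= !mulrDl !opprD !expiD.
set ka := expi (- _); set ka' := expi (- _); set la := expi (- _); set la' := expi (- _).
have e1 : c ^+ absz (k + l) * c ^+ absz (k' + l') = c ^+ absz (k + l + (k' + l')) * (c ^+ 2) ^+ i.
  by rewrite -!exprD -exprM -exprD iE.
have e2 : s ^+ absz (k - l) * s ^+ absz (k' - l') = s ^+ absz (k - l + (k' - l')) * (s ^+ 2) ^+ j.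
  by rewrite -!exprD -exprM -exprD jE.
transitivity ((c ^+ absz (k + l) * c ^+ absz (k' + l') * (s ^+ absz (k - l) * s ^+ absz (k' - l')) *
   (p.[cos t.1.2] * p'.[cos t.1.2]))%:C%C * (ka * ka' * (la * la'))).
  by rewrite !rmorphM /=; ring.
by rewrite e1 e2 !rmorphM /=; ring.
Qed.

Lemma spinpolyD k l (p q : {poly R}) A : spinpoly k l (p + q) A = spinpoly k l p A + spinpoly k l q A.
Proof. by rewrite /spinpoly hornerD rmorphD mulrDr. Qed.

Lemma spinpolyZ k l (a : R) (p : {poly R}) A : spinpoly k l (a *: p) A = a%:C%C * spinpoly k l p A.
Proof. by rewrite /spinpoly hornerZ rmorphM mulrCA. Qed.

(** Induction on the degree: a multiple of the Jacobi polynomial of the same degree [r] removes the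
    leading term, and that multiple belongs to the Wigner-D function of degree
    [r + maxn |k| |l|]. *)
Lemma spinpoly_span k l (p : {poly R}) : spanD (spinpoly k l p).
Proof.
have [n] := ubnP (size p); elim: n p => // n IH p; rewrite ltnS => pn.
have [p0|p0] := eqVneq p 0.
  rewrite p0; have -> : spinpoly k l (0 : {poly R}) = (fun=> 0).
    by apply/funext => A; rewrite /spinpoly horner0 mulr0.
  exact: fin_span0.
pose r := (size p).-1; pose J := jacobi R (absz (k - l)) (absz (k + l)) r.
have sp : size p = r.+1 by rewrite prednK// size_poly_gt0.
have [sJ lJ] := size_coef_jacobi R (absz (k - l)) (absz (k + l)) r; rewrite -/J in sJ lJ.
have knl : Jinf_pred ((r + maxn (absz k) (absz l))%N, k, l).
  by rewrite /Jinf_pred /=; lia.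
pose P : Jinf := exist _ ((r + maxn (absz k) (absz l))%N, k, l) knl.
have [K K0] := basisD_spinpoly R P; rewrite /= addnK -/J => KE.
pose a := p`_r / J`_r.
have -> : spinpoly k l p = (fun A => spinpoly k l (p - a *: J) A +
    (a / K)%:C%C * basisD P A).
  apply/funext => A; rewrite KE mulrA -rmorphM /= divfK// -spinpolyZ -spinpolyD.
  by rewrite subrK.
apply: fin_spanD; last by apply: fin_spanZ; exact: fin_span_basis.
apply: IH; apply: leq_trans pn; rewrite sp; apply/leq_sizeP => j; rewrite leq_eqVlt => /orP[/eqP <-|rj].
  by rewrite coefB coefZ /a divfK// subrr.
rewrite coefB coefZ !nth_default ?mulr0 ?subr0//; first exact: leq_trans sJ _.
by rewrite sp.
Qed.

Lemma basisD_span_spinpoly (p : Jinf) (f : SO3 R -> C) :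
  (forall k l q, spanD (fun A => spinpoly k l q A * f A)) -> spanD (fun A => basisD p A * f A).
Proof.
move=> H; have [K _] := basisD_spinpoly R p; case: (\val p) => [[n k] l] ->.
under eq_fun do rewrite -mulrA.
exact: fin_spanZ.
Qed.

Lemma spanM (f g : SO3 R -> C) : spanD f -> spanD g -> spanD (fun A => f A * g A).
Proof.
have redu (h : SO3 R -> C) h' : spanD h -> (forall p, spanD (fun A => basisD p A * h' A)) ->
    spanD (fun A => h A * h' A).
  move=> /fin_span_repr[c [s ->]] H; under eq_fun do rewrite mulr_suml.
  by apply: fin_span_sum => p; under eq_fun do rewrite -mulrA; exact: fin_spanZ.
move=> sf sg; apply: (redu _ _ sf) => p; apply: basisD_span_spinpoly => k l q.
under eq_fun do rewrite mulrC; apply: (redu _ _ sg) => p'; apply: basisD_span_spinpoly => k' l' q'.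
have [w ->] := spinpoly_mul k' l' k l q' q; exact: spinpoly_span.
Qed.

Lemma spinpoly_bounded k l (p : {poly R}) : exists M : R, forall A, sqmod (spinpoly k l p A) <= M.
Proof.
have [M hM] : exists M : R, forall x, `|x| <= 1 -> `|p.[x]| <= M.
  elim/poly_ind: p => [|p c [M hM]]; first by exists 0 => x _; rewrite horner0 normr0.
  exists (M + `|c|) => x x1; rewrite hornerMXaddC; apply: le_trans (ler_normD _ _) _.
  rewrite lerD2r normrM; apply: le_trans (hM _ x1); apply: ler_piMr => //.
exists (M ^+ 2) => A; rewrite /spinpoly /spinw_SO3 spinwE cos_SO3E !sqmodM !sqmod_real !sqmod_expi !mulr1.
set t := euler_angles A.
have cs1 (x : R) (a b : nat) : (cos x ^+ a * sin x ^+ b) ^+ 2 <= 1.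
  rewrite -real_normK ?num_real// expr_le1// normrM mulr_ile1// normrX exprn_ile1//.
    by rewrite ler_norml cos_le1 cos_geN1.
  by rewrite ler_norml sin_le1 sin_geN1.
have pM : p.[cos t.1.2] ^+ 2 <= M ^+ 2.
  have h : `|p.[cos t.1.2]| <= M by apply: hM; rewrite ler_norml cos_le1 cos_geN1.
  by rewrite -real_normK ?num_real// lerXn2r// nnegrE; apply: le_trans h.
rewrite -[leRHS]mul1r; apply: ler_pM => //; exact: sqr_ge0.
Qed.

Lemma span_bounded (f : SO3 R -> C) : spanD f -> exists M : R, forall A, sqmod (f A) <= M.
Proof.
move=> /fin_span_repr[c [s ->]]; elim: s => [|p s [M hM]].
  by exists 0 => A; rewrite big_nil sqmod0.
have [K _] := basisD_spinpoly R p; case: (\val p) => [[n k] l] pE.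
have [N hN] := spinpoly_bounded k l (jacobi R (absz (k - l)) (absz (k + l)) (n - maxn (absz k) (absz l))).
exists (2 * (sqmod (c p) * (K ^+ 2 * N)) + 2 * M) => A; rewrite big_cons pE.
apply: le_trans (sqmod_le2 _ _) _; apply: lerD; rewrite ler_pM2l//.
rewrite (sqmodM (c p)) (sqmodM K%:C%C) sqmod_real ler_wpM2l ?sqmod_ge0//.
by rewrite ler_wpM2l ?sqr_ge0.
Qed.

Lemma span_cmeas (f : SO3 R -> C) : spanD f -> cmeas setT f.
Proof.
move=> /fin_span_repr[c [s ->]]; apply: cmeas_sum => p.
by apply: cmeasZ; exact: cmeas_basisD.
Qed.

Lemma spinpoly1E k l A : spinpoly k l 1 A = spinw_SO3 k l A :> C.
Proof. by rewrite /spinpoly hornerC mulr1. Qed.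

Lemma span1 : spanD (fun=> 1).
Proof.
have -> : (fun=> 1) = spinpoly 0 0 (1 : {poly R}) :> (SO3 R -> C); last exact: spinpoly_span.
by apply/funext => A; rewrite spinpoly1E /spinw_SO3 /spinw /sgpow /= !expr0 mulr1.
Qed.

(** The conjugate of [spinw k l] is [spinw (- k) (- l)], so real and imaginary parts stay in the
    span. *)
Lemma span_spinw k l (x y : SO3 R -> R) : (forall A, spinw k l (euler_angles A) = (x A +i* y A)%C) ->
  spanD (fun A => (x A)%:C%C) /\ spanD (fun A => (y A)%:C%C).
Proof.
move=> xy; have s1 : spanD (spinw_SO3 k l).
  by have := spinpoly_span k l 1; rewrite (_ : spinpoly k l 1 = spinw_SO3 k l)//; apply/funext => A; exact: spinpoly1E.
have s2 : spanD (spinw_SO3 (- k) (- l)).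
  by have := spinpoly_span (- k) (- l) 1; rewrite (_ : spinpoly _ _ 1 = spinw_SO3 (- k) (- l))//; apply/funext => A; exact: spinpoly1E.
have cE A : spinw_SO3 (- k) (- l) A = (x A -i* y A)%C.
  rewrite -[RHS]/((x A +i* y A)^*)%C -xy /spinw_SO3 !spinwE.
  have -> : - k + - l = - (k + l) by ring.
  have -> : - k - - l = - (k - l) by ring.
  rewrite !abszN !conjcM conjc_real -!expiN; congr (_ * _ * _); congr expi; rewrite rmorphN /=; ring.
split.
  have -> : (fun A => (x A)%:C%C) = (fun A => (2^-1)%:C%C * (spinw_SO3 k l A + spinw_SO3 (- k) (- l) A)).
    apply/funext => A; rewrite cE /spinw_SO3 xy; apply/eqP; rewrite eq_complex /=.
    by apply/andP; split; apply/eqP; field.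
  by apply: fin_spanZ; exact: fin_spanD.
have -> : (fun A => (y A)%:C%C) = (fun A => (0 +i* - 2^-1)%C * (spinw_SO3 k l A + -1 * spinw_SO3 (- k) (- l) A)).
  apply/funext => A; rewrite cE /spinw_SO3 xy; apply/eqP; rewrite eq_complex /=.
  by apply/andP; split; apply/eqP; field.
by apply: fin_spanZ; apply: fin_spanD => //; exact: fin_spanZ.
Qed.

Lemma span_comb (a b : R) (x y z : SO3 R -> R) : spanD (fun A => (x A)%:C%C) ->
  spanD (fun A => (y A)%:C%C) -> (forall A, z A = a * x A + b * y A) -> spanD (fun A => (z A)%:C%C).
Proof.
move=> sx sy zE; have -> : (fun A => (z A)%:C%C) = (fun A => a%:C%C * (x A)%:C%C + b%:C%C * (y A)%:C%C) :> (SO3 R -> C).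
  by apply/funext => A; rewrite zE rmorphD !rmorphM.
by apply: fin_spanD; exact: fin_spanZ.
Qed.

(** The pairs [(1, 1)], [(1, -1)], [(1, 0)] and [(0, 1)] yield, through [spin_entries], all entries
    but the last, which is [cos b]. *)
Lemma span_entry (i j : 'I_3) : spanD (fun A => (\val A i j)%:C%C).
Proof.
have E (A : SO3 R) : A = euler (euler_angles A) by have [_ ->] := euler_anglesK A.
have sp (A : SO3 R) := spin_entries (euler_angles A).
pose X1 (A : SO3 R) : R := (\val A 0 0 + \val A 1 1) / 2; pose X2 (A : SO3 R) : R := (\val A 0 1 - \val A 1 0) / 2.
pose Y1 (A : SO3 R) : R := (\val A 1 1 - \val A 0 0) / 2; pose Y2 (A : SO3 R) : R := (\val A 1 0 + \val A 0 1) / 2.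
pose U1 (A : SO3 R) : R := \val A 0 ord_max / 2; pose U2 (A : SO3 R) : R := - \val A 1 ord_max / 2.
pose V1 (A : SO3 R) : R := - \val A ord_max 0 / 2; pose V2 (A : SO3 R) : R := - \val A ord_max 1 / 2.
have sgp z : sgpow z 0 = 1 :> C /\ sgpow z 1 = z /\ sgpow z 2 = z * z /\ sgpow z (-1) = (z^*)%C.
  by rewrite /sgpow /= !expr0 !expr1 expr2.
have [sX1 sX2] : spanD (fun A => (X1 A)%:C%C) /\ spanD (fun A => (X2 A)%:C%C).
  apply: (@span_spinw 1 1) => A; rewrite /spinw.
  have -> : 1 + 1 = 2 :> int by []. 
  have [_ [_ [-> _]]] := sgp (spinX (euler_angles A)); rewrite subrr; have [-> _] := sgp (spinY (euler_angles A)).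
  by have [+ _ _ _] := sp A; rewrite -E mulr1.
have [sY1 sY2] : spanD (fun A => (Y1 A)%:C%C) /\ spanD (fun A => (Y2 A)%:C%C).
  apply: (@span_spinw 1 (-1)) => A; rewrite /spinw.
  have -> : 1 - -1 = 2 :> int by [].
  have [_ [_ [-> _]]] := sgp (spinY (euler_angles A)); rewrite subrr; have [-> _] := sgp (spinX (euler_angles A)).
  by have [_ + _ _] := sp A; rewrite -E mul1r.
have [sU1 sU2] : spanD (fun A => (U1 A)%:C%C) /\ spanD (fun A => (U2 A)%:C%C).
  apply: (@span_spinw 1 0) => A; rewrite /spinw !(addr0, subr0).
  have [_ [-> _]] := sgp (spinY (euler_angles A)); have [_ [-> _]] := sgp (spinX (euler_angles A)).
  by have [_ _ + _] := sp A; rewrite -E.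
have [sV1 sV2] : spanD (fun A => (V1 A)%:C%C) /\ spanD (fun A => (V2 A)%:C%C).
  apply: (@span_spinw 0 1) => A; rewrite /spinw add0r sub0r.
  have [_ [_ [_ ->]]] := sgp (spinY (euler_angles A)); have [_ [-> _]] := sgp (spinX (euler_angles A)).
  by have [_ _ _ +] := sp A; rewrite -E.
have s33 : spanD (fun A => (\val A ord_max ord_max)%:C%C).
  have := spinpoly_span 0 0 'X; rewrite (_ : spinpoly 0 0 'X = (fun A => (\val A ord_max ord_max)%:C%C))//.
  apply/funext => A; rewrite /spinpoly hornerX /spinw_SO3 /spinw !(addr0, subr0).
  by have [-> _] := sgp (spinY (euler_angles A)); have [-> _] := sgp (spinX (euler_angles A)); rewrite !mul1r.
have e3 (a b : 'I_3) : (a : nat) = b -> a = b by move=> ?; exact: val_inj.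
case: i => [[|[|[|//]]] hi]; case: j => [[|[|[|//]]] hj];
  rewrite ?(e3 (Ordinal hi) 0 erefl) ?(e3 (Ordinal hi) 1 erefl) ?(e3 (Ordinal hi) ord_max erefl);
  rewrite ?(e3 (Ordinal hj) 0 erefl) ?(e3 (Ordinal hj) 1 erefl) ?(e3 (Ordinal hj) ord_max erefl).
- by apply: (span_comb (a := 1) (b := -1) sX1 sY1) => A; rewrite /X1 /Y1; field.
- by apply: (span_comb (a := 1) (b := 1) sX2 sY2) => A; rewrite /X2 /Y2; field.
- by apply: (span_comb (a := 2) (b := 0) sU1 sU1) => A; rewrite /U1; field.
- by apply: (span_comb (a := -1) (b := 1) sX2 sY2) => A; rewrite /X2 /Y2; field.
- by apply: (span_comb (a := 1) (b := 1) sX1 sY1) => A; rewrite /X1 /Y1; field.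
- by apply: (span_comb (a := -2) (b := 0) sU2 sU2) => A; rewrite /U2; field.
- by apply: (span_comb (a := -2) (b := 0) sV1 sV1) => A; rewrite /V1; field.
- by apply: (span_comb (a := -2) (b := 0) sV2 sV2) => A; rewrite /V2; field.
- exact: s33.
Qed.

End rotation_algebra.

Section totally_limits.
Context (I : choiceType) (R : realType) (h : {fset I} -> \bar R).
Hypothesis h_ge0 : forall F, (0 <= h F)%E.

Let totally_is_filter : Filter (@totally I).
Proof. by case: (@totally_filter I). Qed.

Lemma totally_cvg0 : (forall e : R, 0 < e -> exists F0 : {fset I},
    forall F : {fset I}, (F0 `<=` F)%fset -> (h F <= e%:E)%E) ->
  h F @[F --> @totally I] --> (0 : \bar R).
Proof.
move=> H; apply/(fine_cvgP (FF := totally_is_filter)); split.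
  have [F0 hF0] := H 1 ltr01; exists F0 => // F F0F.
  have : h F \is a fin_num by rewrite ge0_fin_numE//; apply: le_lt_trans (hF0 _ F0F) _; exact: ltry.
  by [].
apply/(cvgrPdist_le (FF := totally_is_filter)) => e e0; have [F0 hF0] := H e e0; exists F0 => // F F0F /=.
have hF := hF0 _ F0F; rewrite sub0r normrN ger0_norm ?fine_ge0//.
rewrite -lee_fin fineK// ge0_fin_numE//; apply: le_lt_trans hF _; exact: ltry.
Qed.

Lemma totally_cvg0_le : h F @[F --> @totally I] --> (0 : \bar R) ->
  forall e : R, 0 < e -> exists F0 : {fset I},
    forall F : {fset I}, (F0 `<=` F)%fset -> (h F <= e%:E)%E.
Proof.
move=> /(fine_cvgP (FF := totally_is_filter))[fin cv] e e0; have [F1 _ fin1] := fin; move/(cvgrPdist_le (FF := totally_is_filter)) : cv => H.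
have [F2 _ h2] := H e e0; exists (F1 `|` F2)%fset => F F12.
have hf : h F \is a fin_num by apply: fin1; apply: fsubset_trans F12; exact: fsubsetUl.
have := h2 F (fsubset_trans (fsubsetUr _ _) F12) => /=.
rewrite sub0r normrN ger0_norm ?fine_ge0// => hle.
by rewrite -(fineK hf) lee_fin.
Qed.

End totally_limits.

(** * Density of the span and uniqueness of coefficients *)

Section completeness.
Variable R : realType.
Local Notation C := R[i].
Local Notation haarR := (@haar R).
Local Notation spanD := (fin_span (@basisD R)).
Local Notation mT := (@measurableT _ (SO3 R)).

(** The function of degree 0 is a nonzero constant and square-integrable, so the total mass is
    finite. *)
Lemma haar_finite : (haarR setT < +oo)%E.
Proof.
pose p : Jinf := exist _ (0%N, 0, 0) erefl.
have [_ _] := L2_basisD R p; have [K K0] := basisD_spinpoly R p => /= pE.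
have E A : sqmod (basisD p A) = K ^+ 2.
  rewrite pE sqmodM sqmod_real /spinpoly /spinw_SO3 /spinw /sgpow /= !expr0 mulr1 mul1r.
  rewrite /jacobi big_ord1 /= !bin0 scale1r !expr0 mulr1 hornerC.
  by rewrite sqmod_real expr1n mulr1.
rewrite /sqnormL2; under eq_integral do rewrite E; rewrite integral_cst// => h; have {}h : ((K ^+ 2)%:E * haarR setT < +oo)%E := h.
rewrite ltNge leye_eq; apply/negP => /eqP hT; move: h.
by rewrite hT gt0_muley ?ltxx// lte_fin exprn_even_gt0.
Qed.

Lemma spanD_scale (c : C) f : spanD f -> spanD (fun x => c * f x).
Proof. exact: fin_spanZ. Qed.

Lemma good_entry (i j : 'I_3) : good haarR spanD (fun A => \val A i j).
Proof.
split; first exact: measurable_SO3_entry.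
  have [M hM] := span_bounded (span_entry R i j); exists (M + 1) => A.
  by have := hM A; rewrite sqmod_real -real_normK ?num_real//; nra.
by apply: approximable_self; exact: span_entry.
Qed.

(** Half-spaces in each matrix entry are good by [good_set_pos]; open sets are countable unions of
    boxes with rational bounds, and good sets form a sigma-algebra. *)
Lemma good_measurable_SO3 : measurable `<=` good_set haarR spanD.
Proof.
have gD u v := @goodD _ _ _ haarR spanD (@span_cmeas R) (@fin_spanD _ _ _ (@basisD R)) u v.
have gZ c u := @goodZ _ _ _ haarR spanD (@span_cmeas R) (@span_bounded R) (@span1 R) spanD_scale (@spanM R) c u.
have gC := @good_cst _ _ _ haarR spanD (@span1 R) spanD_scale.
have gP u := @good_set_pos _ _ _ haarR haar_finite spanD (@span_cmeas R) (@span_bounded R) (@span1 R) (@fin_spanD _ _ _ (@basisD R)) spanD_scale (@spanM R) u.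
set G := good_set haarR spanD.
have sG : sigma_algebra setT G.
  exact: (@good_sigma_algebra _ _ _ haarR haar_finite spanD (@span_cmeas R) (@span_bounded R) (@span1 R) (@fin_spanD _ _ _ (@basisD R)) spanD_scale (@spanM R)).
have lower (c : R) (i j : 'I_3) : G [set A : SO3 R | c < \val A i j].
  rewrite [X in G X](_ : _ = [set A : SO3 R | 0 < (\val A i j : R) + - c]).
    by apply: gP; apply: gD; [exact: good_entry|exact: gC].
  by apply/seteqP; split => A /=; rewrite subr_gt0.
have upper (c : R) (i j : 'I_3) : G [set A : SO3 R | \val A i j < c].
  rewrite [X in G X](_ : _ = [set A : SO3 R | 0 < c + -1 * (\val A i j : R)]).
    by apply: gP; apply: gD; [exact: gC|apply: gZ; exact: good_entry].
  by apply/seteqP; split => A /=; rewrite mulN1r subr_gt0.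
apply: smallest_sub => // _ [U Uo <-].
(* Viewing the sigma-algebra [G] as generated by itself gives access to the closure lemmas for
   [measurable]. *)
suff : measurable (\val @^-1` U : set (g_sigma_algebraType G)).
  by rewrite /measurable /= sigma_algebra_id.
pose box (pq : 'M[rat]_3 * 'M[rat]_3) : set 'M[R]_3 :=
  [set A | forall i j, ratr (pq.1 i j) < A i j < ratr (pq.2 i j)].
have -> : U = \bigcup_(pq in [set pq | box pq `<=` U]) box pq.
  apply/seteqP; split=> [A UA|A [pq pqU]]; last exact: pqU.
  have /nbhs_ballP[e /= e0 AeU] : nbhs A U by exact: open_nbhs_nbhs.
  have lt1 i j : A i j - e < A i j by rewrite ltrBlDr ltrDl.
  have lt2 i j : A i j < A i j + e by rewrite ltrDl.
  pose p := \matrix_(i, j) projT1 (cid (rat_in_itvoo (lt1 i j))).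
  pose q := \matrix_(i, j) projT1 (cid (rat_in_itvoo (lt2 i j))).
  have pP i j : A i j - e < ratr (p i j) < A i j.
    by rewrite mxE; case: cid => x /=; rewrite in_itv.
  have qP i j : A i j < ratr (q i j) < A i j + e.
    by rewrite mxE; case: cid => x /=; rewrite in_itv.
  exists (p, q) => [B pqB|i j /=]; last first.
    by have /andP[_ ->] := pP i j; have /andP[-> _] := qP i j.
  apply: AeU; split=> // i j; rewrite /ball /= distrC ltr_distl.
  have /= /andP[pB Bq] := pqB i j.
  have /andP[pA _] := pP i j; have /andP[_ Aq] := qP i j.
  by rewrite (lt_trans pA pB) (lt_trans Bq Aq).
rewrite preimage_bigcup bigcup_mkcond.
apply: countable_bigcupT_measurable => // pq; case: ifPn => // _.
rewrite [X in measurable X](_ : _ = \bigcap_(ij in [set: 'I_3 * 'I_3])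
    ([set A : SO3 R | ratr (pq.1 ij.1 ij.2) < \val A ij.1 ij.2] `&`
     [set A : SO3 R | \val A ij.1 ij.2 < ratr (pq.2 ij.1 ij.2)])); last first.
  apply/seteqP; split=> [A /= H [i j] _ /=|A /= H i j]; first by apply/andP; exact: H.
  by apply/andP; exact: (H (i, j) I).
apply: fin_bigcap_measurable => // -[i j] _ /=.
by apply: measurableI; apply: sub_sigma_algebra; [exact: lower|exact: upper].
Qed.

Lemma approximable_haar (f : SO3 R -> C) : L2_SO3 f -> approximable haarR spanD f.
Proof.
move=> Lf; exact: (@approximable_L2 _ _ _ haarR spanD (@span_cmeas R) (@span_bounded R) (@span1 R) (@fin_spanD _ _ _ (@basisD R)) spanD_scale (@spanM R) good_measurable_SO3 _ Lf).
Qed.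

Definition bessel_gap (f : SO3 R -> C) (s : seq Jinf) : R :=
  fine (sqnormL2 haarR setT f) - \sum_(p <- s) sqmod (harmonic_coef f p).

(** Completing the square separates the distance to the span from the error in the coefficients;
    best approximation and uniqueness are both read off from it. *)
Lemma sqnormL2_partial f (c : Jinf -> C) (s : seq Jinf) : L2_SO3 f -> uniq s ->
  sqnormL2 haarR setT (fun A => f A - \sum_(p <- s) c p * basisD p A) =
  (bessel_gap f s + \sum_(p <- s) sqmod (harmonic_coef f p - c p))%:E.
Proof.
move=> Lf us; rewrite (pythagoras mT (L2_basisD R) (basisD_orth R) c Lf us).
congr EFin; rewrite /bessel_gap mul1r -!addrA; congr (_ + _).
rewrite -!sumrN -!big_split /=; apply: eq_bigr => p _; rewrite /harmonic_coef.
case: (innerL2 _ _ _ _) (c p) => [x y] [z w]; rewrite !sqmodE /=; ring.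
Qed.

Lemma bessel_gap_ge0 f (s : seq Jinf) : L2_SO3 f -> uniq s -> 0 <= bessel_gap f s.
Proof.
move=> Lf us; rewrite -lee_fin; have := sqnormL2_partial (harmonic_coef f) Lf us.
rewrite big1 ?addr0 => [<-|p _]; first exact: sqnormL2_ge0.
by rewrite subrr sqmod0.
Qed.

Lemma harmonic_coef_l2 (f : SO3 R -> C) : L2_SO3 f -> l2 (harmonic_coef f).
Proof.
move=> Lf; rewrite /l2 /sqnorm_l2 /sqnorm_wl2.
apply: (@le_lt_trans _ _ (fine (sqnormL2 haarR setT f))%:E); last exact: ltry.
apply: esum_le_sum => s us; under eq_bigr do rewrite mul1r.
by have := bessel_gap_ge0 Lf us; rewrite subr_ge0.
Qed.

(** An approximant from the span is a combination over every larger finite set, and there the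
    harmonic coefficients do at least as well. *)
Lemma harmonic_coef_sumL2 (f : SO3 R -> C) : L2_SO3 f -> sumL2 haarR setT (@basisD R) (harmonic_coef f) f.
Proof.
move=> Lf; apply: totally_cvg0 => [F|e e0]; first exact: sqnormL2_ge0.
have [g [c [s0 gE]] fg] := approximable_haar Lf e0; exists s0 => F s0F.
apply: le_trans fg; rewrite (_ : (fun A => f A - g A) = (fun A => f A - \sum_(p <- F) c p * basisD p A)); last first.
  by apply/funext => A; rewrite (gE F).
rewrite !sqnormL2_partial ?fset_uniq// lee_fin lerD2l big1 => [|p _].
  by apply: sumr_ge0 => p _; exact: sqmod_ge0.
by rewrite subrr sqmod0.
Qed.

Lemma sqmod_eq0 (z : C) : sqmod z <= 0 -> z = 0.
Proof.
rewrite sqmodE; case: z => x y /= h; apply/eqP; rewrite eq_complex /=.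
have := sqr_ge0 x; have := sqr_ge0 y => hy hx.
have /eqP : x ^+ 2 = 0 by lra.
have /eqP : y ^+ 2 = 0 by lra.
by rewrite !sqrf_eq0 => -> ->.
Qed.

Lemma fourier_SO3_unique f (c : Jinf -> C) : L2_SO3 f ->
  sumL2 haarR setT (@basisD R) c f -> c = harmonic_coef f.
Proof.
move=> Lf sf; apply/funext => p; apply/esym/eqP; rewrite -subr_eq0; apply/eqP.
apply: sqmod_eq0; apply/ler_addgt0Pl => e e0; rewrite addr0.
have [|F0 hF0] := totally_cvg0_le _ sf e0; first by move=> F; exact: sqnormL2_ge0.
have := hF0 (p |` F0)%fset (fsubsetUr _ _).
rewrite sqnormL2_partial ?fset_uniq// lee_fin; apply: le_trans.
apply: ler_wpDl; first by apply: bessel_gap_ge0 => //; exact: fset_uniq.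
rewrite (bigD1_seq p) ?fset_uniq ?fset1U1//= lerDl.
by apply: sumr_ge0 => q _; exact: sqmod_ge0.
Qed.

Lemma fourier_SO3P f (c : Jinf -> C) : L2_SO3 f -> fourier_SO3 c f <-> c = harmonic_coef f.
Proof.
move=> Lf; split => [[_ _ sf]|->]; first exact: fourier_SO3_unique.
by split => //; [exact: harmonic_coef_l2|exact: harmonic_coef_sumL2].
Qed.

End completeness.

(** * From SO(3) to the torus *)

Section integral_preserving.
Local Open Scope ereal_scope.

(** Stated for nonnegative functions, so that Tonelli's theorem gives stability under products with
    no integrability condition. *)
Definition integral_preserving d (T : measurableType d) (R : realType)
    (m : {measure set T -> \bar R}) (phi : T -> T) :=
  measurable_fun setT phi /\ forall f : T -> \bar R, measurable_fun setT f ->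
    (forall x, 0 <= f x) -> \int[m]_x f (phi x) = \int[m]_x f x.

Lemma integral_preserving_prod d1 d2 (T1 : measurableType d1) (T2 : measurableType d2)
    (R : realType) (m1 : {sigma_finite_measure set T1 -> \bar R})
    (m2 : {sigma_finite_measure set T2 -> \bar R}) phi1 phi2 :
  integral_preserving m1 phi1 -> integral_preserving m2 phi2 ->
  integral_preserving (m1 \x m2) (fun z => (phi1 z.1, phi2 z.2)).
Proof.
move=> [mp1 p1] [mp2 p2].
have mp : measurable_fun setT (fun z : T1 * T2 => (phi1 z.1, phi2 z.2)).
  by apply: measurable_fun_pair; [exact: (measurableT_comp mp1 measurable_fst)|
    exact: (measurableT_comp mp2 measurable_snd)].
split => // f mf f0.
have mfp : measurable_fun setT (fun z : T1 * T2 => f (phi1 z.1, phi2 z.2)).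
  exact: (measurableT_comp mf mp).
rewrite (fubini_tonelli1 _ mfp)// (fubini_tonelli1 _ mf)// -[RHS]p1//.
- apply: eq_integral => x _; rewrite /fubini_F /=.
  by apply: (p2 (fun y => f (phi1 x, y))) => //; apply: (measurableT_comp mf); exact: pair1_measurable.
- exact: measurable_fun_fubini_tonelli_F.
- by move=> x; apply: integral_ge0 => y _; exact: f0.
Qed.

End integral_preserving.

Section lebesgue_isometry.
Variable R : realType.
Local Notation M := (measurableTypeR R).
Local Notation leb := (@lebesgue_measure R).
Variables (phi : M -> M).
Hypothesis mphi : measurable_fun setT phi.
Hypothesis phi_ocitv : forall a b : R, a < b ->
  leb (phi @^-1` `]a, b]%classic) = (b - a)%:E.

Let mphi_mixin := isMeasurableFun.Build _ _ _ _ _ mphi.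
Let mphi_pack : {mfun M >-> M} := HB.pack phi mphi_mixin.

(** The image measure agrees with Lebesgue measure on half-open intervals, which determine it. *)
Lemma integral_preserving_lebesgue : integral_preserving leb phi.
Proof.
have lebE A : measurable A -> leb A = leb (phi @^-1` A).
  move=> mA; rewrite (@lebesgue_measure_unique R (pushforward leb mphi_pack))//.
  move=> _ /ocitvP[->|[[a b] /= ab ->]]; first by rewrite !measure0.
  by rewrite /pushforward /= phi_ocitv// lebesgue_measure_itv /= lte_fin ab EFinB.
split => // f mf f0.
have := @integral_image_density _ _ _ _ R leb leb phi setT (fun=> 1) mphi measurableT
  (@measurable_cst _ _ _ _ _ _) (fun _ _ => ler01) _ f mf.
move=> ->; first by apply: eq_integral => x _; rewrite mule1.
move=> A mA; rewrite setTI integral_cst ?mul1e; first exact: lebE.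
by rewrite -[X in measurable X]setTI; exact: mphi.
Qed.

End lebesgue_isometry.

(** * Comparing norms on the torus cell and on the rotation group *)

Section torus_cell_integrals.
Variable R : realType.
Local Notation C := R[i].
Local Notation M := (measurableTypeR R).
Local Notation leb := (@lebesgue_measure R).
Local Notation leb3 := (@lebesgue3 R).
Local Notation cell := (@torus_cell R).
Local Notation dom := (@euler_domain R).

Lemma integral_preserving_shift (u : R) : integral_preserving leb (fun x : M => x + u : M).
Proof.
apply: integral_preserving_lebesgue.
  by apply: measurable_funD => //; exact: measurable_cst.
move=> a b ab; rewrite (_ : _ @^-1` _ = `]a - u, b - u]%classic); last first.
  by apply/seteqP; split => x /=; rewrite !in_itv /= ltrBlDr lerBrDr.
rewrite lebesgue_measure_itv /= lte_fin ltrD2r ab -EFinB; congr (_%:E); ring.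
Qed.

Lemma integral_preserving_reflect (u : R) : integral_preserving leb (fun x : M => u - x : M).
Proof.
apply: integral_preserving_lebesgue.
  by apply: measurable_funB => //; exact: measurable_cst.
move=> a b ab; rewrite (_ : _ @^-1` _ = `[u - b, u - a[%classic); last first.
  apply/seteqP; split => x /=; rewrite !in_itv /= => /andP[h1 h2]; apply/andP; split; lra.
rewrite lebesgue_measure_itv /= lte_fin ltrD2l ltrN2 ab -EFinB; congr (_%:E); ring.
Qed.

(** For shifts [u, v] equal to [pi] or [- pi] this is a symmetry of the Euler map; it carries the
    part [b > pi] of the cell into the Euler domain, the signs being chosen so that the outer angles
    stay in [[0, 2 * pi[]. *)
Definition cell_flip (u v : R) (t : angles R) : angles R := (t.1.1 + u, 2 * pi - t.1.2, t.2 + v).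

Lemma cell_flip_preserving u v : integral_preserving leb3 (cell_flip u v).
Proof.
pose m12 := sigma_finite_product leb leb.
have p12 : integral_preserving m12 (fun z => (z.1 + u, 2 * pi - z.2)).
  exact: (integral_preserving_prod (integral_preserving_shift u) (integral_preserving_reflect (2 * pi))).
exact: (integral_preserving_prod p12 (integral_preserving_shift v)).
Qed.

Lemma euler_flip (u v : R) (t : angles R) :
  u = pi \/ u = - pi -> v = pi \/ v = - pi -> euler (cell_flip u v t) = euler t.
Proof.
have cpi (x w : R) : w = pi \/ w = - pi -> cos (x + w) = - cos x /\ sin (x + w) = - sin x.
  by move=> [] ->; rewrite ?cosDpi ?sinDpi// cosB sinB cospi sinpi; split; ring.
move=> hu hv; have [cu su] := cpi t.1.1 u hu; have [cv sv] := cpi t.2 v hv.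
have c2 : cos (2 * pi - t.1.2) = cos t.1.2 by rewrite mulr_natl cosB cos2pi sin2pi; ring.
have s2 : sin (2 * pi - t.1.2) = - sin t.1.2 by rewrite mulr_natl sinB cos2pi sin2pi; ring.
apply: val_inj; apply/matrixP => i j /=; rewrite !mxE !big_ord_recl !big_ord0 ![(Rz _ *m Ry _) _ _]mxE.
rewrite !big_ord_recl !big_ord0 !mxE /= cu su cv sv c2 s2.
by case: i => [[|[|[|//]]] hi]; case: j => [[|[|[|//]]] hj] /=; ring.
Qed.

Let mcell : measurable cell.
Proof. by apply: measurableX => //; exact: measurableX. Qed.

Lemma measurable_abs_sin : measurable_fun setT (fun t : angles R => `|sin t.1.2|).
Proof.
apply: measurableT_comp => //.
apply: (measurableT_comp (continuous_measurable_fun (@continuous_sin R))).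
exact: (measurableT_comp measurable_snd measurable_fst).
Qed.

Lemma cmeas_euler (F : SO3 R -> C) D : cmeas setT F -> cmeas D (fun t => F (euler t)).
Proof.
move=> [mr mi]; split; apply: measurable_funTS; [apply: (measurableT_comp mr)|
  apply: (measurableT_comp mi)]; exact: measurable_euler.
Qed.

(** The integrand on the cell is dominated by its restriction to the Euler domain plus the four
    flipped copies of that restriction, all with the same integral; hence the factor 5. The factor
    [8 * pi ^ 2] inverts the Haar density. *)
Lemma torus_haar_le (F : SO3 R -> C) : cmeas setT F ->
  (\int[leb3]_(t in cell) (sqmod (F (euler t)) * `|sin t.1.2|)%:E <=
   (5 * (8 * pi ^+ 2))%:E * sqnormL2 (@haar R) setT F)%E.
Proof.
move=> mF; pose H t : \bar R := (sqmod (F (euler t)) * `|sin t.1.2|)%:E.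
have mH D : measurable_fun D H.
  apply/measurable_EFinP; apply: measurable_funM; last first.
    by apply: measurable_funTS; exact: measurable_abs_sin.
  by apply: measurable_sqmod; exact: cmeas_euler.
have H0 t : (0 <= H t)%E by rewrite lee_fin mulr_ge0 ?sqmod_ge0.
have mdom : measurable dom by exact: measurable_domain.
pose K := H \_ dom.
have mK : measurable_fun setT K by apply/(measurable_restrictT _ mdom); exact: mH.
have K0 t : (0 <= K t)%E by rewrite /K patchE; case: ifP.
have KI : (\int[leb3]_t K t = (8 * pi ^+ 2)%:E * sqnormL2 (@haar R) setT F)%E.
  rewrite /K -integral_mkcond haar_sqnormL2// -ge0_integralZl//.
  - apply: eq_integral => t; rewrite inE => Dt; rewrite -EFinM /H; congr (_%:E).
    have := density_ge0 Dt; rewrite /euler_density => d0.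
    have p0 : 0 < 8 * pi ^+ 2 :> R by rewrite mulr_gt0// exprn_gt0// pi_gt0.
    have q0 : pi != 0 :> R by rewrite gt_eqF// pi_gt0.
    rewrite ger0_norm; first by move: q0; move: (pi : R) => w w0; field; rewrite w0.
    by move: d0; rewrite pmulr_lge0 ?invr_gt0.
  - apply/measurable_EFinP; apply: measurable_funM; first by apply: measurable_sqmod; exact: cmeas_euler.
    by apply: measurable_funTS; exact: measurable_density.
  - by move=> t Dt; rewrite lee_fin mulr_ge0 ?sqmod_ge0 ?density_ge0.
  - by rewrite lee_fin mulr_ge0// sqr_ge0.
have Kf u v : u = pi \/ u = - pi -> v = pi \/ v = - pi ->
    (\int[leb3]_t K (cell_flip u v t) = \int[leb3]_t K t)%E.
  by move=> hu hv; have [_ ->] := cell_flip_preserving u v.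
have mKf u v : measurable_fun setT (fun t => K (cell_flip u v t)).
  by have [mf _] := cell_flip_preserving u v; exact: (measurableT_comp mK mf).
pose G t := (K t + (K (cell_flip pi pi t) + (K (cell_flip pi (- pi) t) +
  (K (cell_flip (- pi) pi t) + K (cell_flip (- pi) (- pi) t)))))%E.
have HG t : cell t -> (H t <= G t)%E.
  move=> [[+ +] +]; rewrite /= !in_itv /= => /andP[a0 a1] /andP[b0 b1] /andP[c0 c1].
  have [bp|bp] := leP t.1.2 pi.
    have Dt : dom t by split; [split|]; rewrite /= in_itv /=; apply/andP.
    rewrite /G {1}/K patchE mem_set//; apply: leeDl.
    by rewrite !adde_ge0.
  have key u v : u = pi \/ u = - pi -> v = pi \/ v = - pi -> 0 <= t.1.1 + u < 2 * pi ->
      0 <= t.2 + v < 2 * pi -> K (cell_flip u v t) = H t.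
    move=> hu hv h1 h2; rewrite /K patchE mem_set.
      rewrite /H (euler_flip t hu hv); congr (_ * _)%:E.
      by rewrite /= mulr_natl sinB cos2pi sin2pi mul0r mul1r sub0r normrN.
    by split; [split|]; rewrite /= in_itv //=; apply/andP; split; lra.
  have P0 := pi_gt0 R.
  have g4 (x1 x2 x3 x4 x5 : \bar R) : (0 <= x1 -> 0 <= x2 -> 0 <= x3 -> 0 <= x4 -> 0 <= x5 ->
      [/\ x2 <= x1 + (x2 + (x3 + (x4 + x5))), x3 <= x1 + (x2 + (x3 + (x4 + x5))),
      x4 <= x1 + (x2 + (x3 + (x4 + x5))) & x5 <= x1 + (x2 + (x3 + (x4 + x5)))])%E.
    move=> h1 h2 h3 h4 h5; split.
    - by apply: le_trans (leeDr _ h1); apply: leeDl; rewrite !adde_ge0.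
    - by apply: le_trans (leeDr _ h1); apply: le_trans (leeDr _ h2); apply: leeDl; rewrite !adde_ge0.
    - by apply: le_trans (leeDr _ h1); apply: le_trans (leeDr _ h2); apply: le_trans (leeDr _ h3); apply: leeDl.
    - by apply: le_trans (leeDr _ h1); apply: le_trans (leeDr _ h2); apply: le_trans (leeDr _ h3); apply: leeDr.
  have [q1 q2 q3 q4] := g4 (K t) _ _ _ _ (K0 _) (K0 (cell_flip pi pi t)) (K0 (cell_flip pi (- pi) t))
    (K0 (cell_flip (- pi) pi t)) (K0 (cell_flip (- pi) (- pi) t)).
  have [ap|ap] := ltP t.1.1 pi; have [cp|cp] := ltP t.2 pi.
  - by apply: le_trans q1; rewrite key//; [left|left|apply/andP; split; lra|apply/andP; split; lra].
  - by apply: le_trans q2; rewrite key//; [left|right|apply/andP; split; lra|apply/andP; split; lra].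
  - by apply: le_trans q3; rewrite key//; [right|left|apply/andP; split; lra|apply/andP; split; lra].
  - by apply: le_trans q4; rewrite key//; [right|right|apply/andP; split; lra|apply/andP; split; lra].
have mG : measurable_fun setT G.
  by repeat (apply: emeasurable_funD => //).
have GI : (\int[leb3]_t G t = 5%:E * \int[leb3]_t K t)%E.
  rewrite /G !ge0_integralD//; try by [repeat (apply: emeasurable_funD => //)|move=> t _; rewrite ?adde_ge0].
  rewrite !Kf; try by [left|right].
  have k0 : (0 <= \int[leb3]_t K t)%E by exact: integral_ge0.
  move: (integral _ _ _) k0 => k k0.
  have -> : 5 = 1 + (1 + (1 + (1 + 1))) :> R by ring.
  by rewrite !EFinD !ge0_muleDl ?mul1e// ?adde_ge0 ?lee_fin.
apply: (@le_trans _ _ (\int[leb3]_t G t)%E); last by rewrite GI KI EFinM muleA.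
apply: (@le_trans _ _ (\int[leb3]_(t in cell) G t)%E).
  apply: (@ge0_le_integral _ _ _ leb3 cell mcell H G) => //; try exact: mH.
  exact: measurable_funTS.
apply: ge0_subset_integral => //.
by move=> t _; rewrite /G !adde_ge0.
Qed.

(** At most [n * |sin|], hence controlled by Haar measure, yet increasing to 1 away from
    [sin b = 0]. *)
Definition sin_cutoff (n : nat) (t : angles R) : R := Num.min 1 (n%:R * `|sin t.1.2|).

Lemma sin_cutoff_ge0 n t : 0 <= sin_cutoff n t.
Proof. by rewrite /sin_cutoff le_min ler01 mulr_ge0. Qed.

Lemma measurable_sin_cutoff n : measurable_fun setT (sin_cutoff n).
Proof.
apply: measurable_minr; first exact: measurable_cst.
by apply: measurable_funM; [exact: measurable_cst|exact: measurable_abs_sin].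
Qed.

(** Inside the cell the sine vanishes only for [b = 0] and [b = pi], a null set; monotone
    convergence applies off it. *)
Lemma sqnormL2_cutoff_limit (g : angles R -> C) (B : R) : cmeas cell g ->
  (forall n, (\int[leb3]_(t in cell) (sqmod (g t) * sin_cutoff n t)%:E <= B%:E)%E) ->
  (sqnormL2 leb3 cell g <= B%:E)%E.
Proof.
move=> mg HB.
pose N : set (angles R) := [set: M] `*` ([set 0; pi] : set M) `*` [set: M].
have mpt : measurable ([set 0; pi] : set M).
  by apply: measurableU; exact: measurable_set1.
have mN : measurable N by apply: measurableX => //; exact: measurableX.
have N0 : leb3 N = 0%E.
  have l0 : leb ([set 0; pi] : set M) = 0%E.
    apply: countable_lebesgue_measure0; apply: finite_set_countable.
    exact: finite_set2.
  pose m12 := sigma_finite_product leb leb.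
  have e1 : leb3 N = (m12 ([set: M] `*` [set 0%R; pi]) * leb [set: M])%E.
    by apply: (@product_measure1E _ _ _ _ _ m12 leb) => //; exact: measurableX.
  have e2 : m12 ([set: M] `*` [set 0; pi]) = (leb [set: M] * leb [set 0%R; pi])%E.
    exact: product_measure1E.
  by rewrite e1 e2 l0 mule0 mul0e.
have mgE : measurable_fun cell (fun t => (sqmod (g t))%:E).
  by apply/measurable_EFinP; exact: measurable_sqmod.
rewrite /sqnormL2 (ge0_negligible_integral mN mcell mgE)//; last first.
  by move=> t _; rewrite lee_fin sqmod_ge0.
have mD : measurable (cell `\` N) by exact: measurableD.
pose f n t : \bar R := (sqmod (g t) * sin_cutoff n t)%:E.
have mf n : measurable_fun cell (f n).
  apply/measurable_EFinP; apply: measurable_funM; first exact: measurable_sqmod.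
  by apply: measurable_funTS; exact: measurable_sin_cutoff.
have f0 n t : (0 <= f n t)%E by rewrite lee_fin mulr_ge0 ?sqmod_ge0 ?sin_cutoff_ge0.
have flim t : (cell `\` N) t -> limn (f ^~ t) = (sqmod (g t))%:E.
  move=> [[[_ bt] _] Nt]; move: bt; rewrite /= in_itv /= => /andP[b0 b1].
  have s0 : 0 < `|sin t.1.2|.
    rewrite normr_gt0; apply/eqP => s0; apply: Nt; split => //; split => //=.
    have [bp|bp|] := ltgtP t.1.2 pi; last by right.
      have [/eqP|bn] := eqVneq t.1.2 0; first by left; apply/eqP.
      have : 0 < sin t.1.2 by apply: sin_gt0_pi; rewrite lt_neqAle eq_sym bn b0.
      by rewrite s0 ltxx.
    have : 0 < sin (t.1.2 - pi).
      by apply: sin_gt0_pi; apply/andP; split; lra.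
    by rewrite sinB cospi sinpi s0; lra.
  apply/cvg_lim => //; apply: (cvg_near_cst ((sqmod (g t))%:E : \bar R)).
  have [m _ mP] : \forall n \near \oo, 1 <= n%:R * `|sin t.1.2|.
    near=> n; rewrite -ler_pdivrMr//; near: n.
    exact: nbhs_infty_ger.
  by exists m => // n mn /=; rewrite /f /sin_cutoff min_l ?mulr1//; exact: mP.
have -> : (\int[leb3]_(t in cell `\` N) (sqmod (g t))%:E =
    \int[leb3]_(t in cell `\` N) limn (f ^~ t))%E.
  by apply: eq_integral => t; rewrite inE => /flim ->.
rewrite monotone_convergence//.
- apply: lime_le.
    apply: ereal_nondecreasing_is_cvgn => a b ab; apply: ge0_le_integral => //.
    + by apply: measurable_funS (mf a) => //; exact: subDsetl.
    + by apply: measurable_funS (mf b) => //; exact: subDsetl.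
    + move=> t _; rewrite lee_fin ler_wpM2l ?sqmod_ge0// /sin_cutoff.
      by rewrite le_min ge_min lexx /= ge_min; apply/orP; right; rewrite ler_wpM2r// ler_nat.
  near=> n; apply: le_trans (HB n); apply: (@ge0_subset_integral _ _ _ leb3 (cell `\` N) cell) => //; try by move=> t [].
- by move=> n; apply: measurable_funS (mf n) => //; exact: subDsetl.
- move=> t _ a b ab; rewrite lee_fin ler_wpM2l ?sqmod_ge0// /sin_cutoff.
  by rewrite le_min ge_min lexx /= ge_min; apply/orP; right; rewrite ler_wpM2r// ler_nat.
Unshelve. all: by end_near.
Qed.

(* The weight [sin] vanishes on the boundary, so composition with [euler] is
   unbounded from L^2(SO(3)) to L^2 of the cell; the bound has to be known on a
   dense set of approximants. *)
Lemma sqnormL2_euler_bound (F : SO3 R -> C) (B : R) : cmeas setT F -> 0 <= B ->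
  (forall e : R, 0 < e -> exists h : SO3 R -> C, [/\ cmeas setT h,
     (sqnormL2 (@haar R) setT (fun A => F A - h A)%R <= e%:E)%E &
     (sqnormL2 leb3 cell (fun t => h (euler t)) <= B%:E)%E]) ->
  (sqnormL2 leb3 cell (fun t => F (euler t)) <= (2 * B)%:E)%E.
Proof.
move=> mF B0 H; apply: sqnormL2_cutoff_limit => [|n]; first exact: cmeas_euler.
apply/lee_addgt0Pr => e e0.
pose c : R := 2 * n%:R * (5 * (8 * pi ^+ 2)) + 1.
have c0 : 0 < c.
  by rewrite /c ltr_wpDl//; apply: mulr_ge0; apply: mulr_ge0 => //; apply: mulr_ge0 => //; exact: sqr_ge0.
have [|h [mh Fh hB]] := H (e / c); first by rewrite divr_gt0.
have mFh := cmeasB mF mh.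
have mw D : measurable_fun D (sin_cutoff n) by apply: measurable_funTS; exact: measurable_sin_cutoff.
have ms D : measurable_fun D (fun t : angles R => `|sin t.1.2|) by apply: measurable_funTS; exact: measurable_abs_sin.
have mq G D : cmeas setT G -> measurable_fun D (fun t : angles R => sqmod (G (euler t) : C)).
  by move=> mG; apply: measurable_sqmod; exact: cmeas_euler.
have m1 : measurable_fun cell (fun t => (sqmod (F (euler t) - h (euler t)) * `|sin t.1.2|)%:E).
  by apply/measurable_EFinP; apply: measurable_funM => //; exact: (mq _ _ mFh).
have m2 : measurable_fun cell (fun t => (sqmod (h (euler t)))%:E).
  by apply/measurable_EFinP; exact: mq.
(* The cutoff is bounded by [n * |sin|] on the error [F - h] and by 1 on [h]. For fixed [n] the
   error term becomes small with [e], while the term of [h] is bounded by [2 * B] for every [n]. *)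
have step : (\int[leb3]_(t in cell) (sqmod (F (euler t)) * sin_cutoff n t)%:E <=
   \int[leb3]_(t in cell) ((2 * n%:R)%:E * (sqmod (F (euler t) - h (euler t)) * `|sin t.1.2|)%:E
     + 2%:E * (sqmod (h (euler t)))%:E))%E.
  apply: ge0_le_integral => //.
  - by move=> t _; rewrite lee_fin mulr_ge0 ?sqmod_ge0 ?sin_cutoff_ge0.
  - by apply/measurable_EFinP; apply: measurable_funM => //; exact: mq.
  - by apply: emeasurable_funD; exact: measurable_funeM.
  move=> t _; rewrite -!EFinM -EFinD lee_fin.
  have := sqmod_le2 (F (euler t) - h (euler t)) (h (euler t)); rewrite subrK.
  have w1 : sin_cutoff n t <= 1 by rewrite /sin_cutoff ge_min lexx.
  have w2 : sin_cutoff n t <= n%:R * `|sin t.1.2| by rewrite /sin_cutoff ge_min lexx orbT.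
  have w0 := sin_cutoff_ge0 n t.
  move: (sqmod_ge0 (F (euler t) - h (euler t))) (sqmod_ge0 (h (euler t))).
  move: (sqmod (F _)) (sqmod (_ - _)) (sqmod (h _)) (sin_cutoff n t) w0 w1 w2 => x y z w w0 w1 w2 y0 z0 xyz.
  apply: (@le_trans _ _ ((2 * y + 2 * z) * w)); first by rewrite ler_wpM2r.
  rewrite mulrDl; apply: lerD; last by rewrite ler_piMr ?mulr_ge0.
  have -> : 2 * n%:R * (y * `|sin t.1.2|) = 2 * y * (n%:R * `|sin t.1.2|) by ring.
  by rewrite ler_wpM2l ?mulr_ge0.
have nn1 t : cell t -> (0 <= (sqmod (F (euler t) - h (euler t)) * `|sin t.1.2|)%:E)%E.
  by move=> _; rewrite lee_fin; apply: mulr_ge0; [exact: sqmod_ge0|exact: normr_ge0].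
have nn2 t : cell t -> (0 <= (sqmod (h (euler t)))%:E)%E.
  by move=> _; rewrite lee_fin sqmod_ge0.
have n0 : (0 <= (2 * n%:R : R)%:E)%E by rewrite lee_fin mulr_ge0.
have nn3 t : cell t -> (0 <= (2 * n%:R)%:E * (sqmod (F (euler t) - h (euler t)) * `|sin t.1.2|)%:E)%E.
  by move=> ct; exact: mule_ge0 (nn1 t ct).
have nn4 t : cell t -> (0 <= 2%:E * (sqmod (h (euler t)))%:E)%E.
  by move=> ct; apply: mule_ge0 (nn2 t ct).
have m3 := measurable_funeM (2 * n%:R)%:E m1; have m4 := measurable_funeM 2%:E m2.
apply: (le_trans step); rewrite (ge0_integralD leb3 mcell nn3 m3 nn4 m4).
rewrite (ge0_integralZl leb3 mcell m1 nn1 n0) (ge0_integralZl leb3 mcell m2 nn2)//.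
rewrite addeC (EFinM 2 B); apply: leeD; first by apply: lee_wpmul2l => //; rewrite lee_fin.
apply: (@le_trans _ _ ((2 * n%:R)%:E * ((5 * (8 * pi ^+ 2))%:E * (e / c)%:E))%E).
  apply: lee_wpmul2l; first by rewrite lee_fin mulr_ge0.
  apply: le_trans (torus_haar_le mFh) _; apply: lee_wpmul2l => //.
  by rewrite lee_fin; apply: mulr_ge0 => //; apply: mulr_ge0 => //; exact: sqr_ge0.
rewrite -!EFinM lee_fin !mulrA ler_pdivrMr// mulrC -!mulrA ler_pM2l// !mulrA.
by rewrite /c; lra.
Qed.

End torus_cell_integrals.

(** * Exponentials on the cell and expansion of the Wigner-D functions *)

Section torus_basis.
Variable R : realType.
Local Notation C := R[i].
Local Notation M := (measurableTypeR R).
Local Notation leb3 := (@lebesgue3 R).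
Local Notation cell := (@torus_cell R).
Local Notation period := (`[0, 2 * pi[%classic : set M).
Implicit Types (q : int * int * int).

Lemma trig3E q (t : angles R) : trig3 q t = chi q.1.1 t.1.1 * chi q.1.2 t.1.2 * chi q.2 t.2.
Proof. by rewrite /trig3 /chi !expiD. Qed.

Lemma trig3_mul_conj q q' (t : angles R) : trig3 q t * (trig3 q' t)^*%C =
  chi (q.1.1 - q'.1.1) t.1.1 * chi (q.1.2 - q'.1.2) t.1.2 * chi (q.2 - q'.2) t.2.
Proof. by rewrite !trig3E !conjcM -!chi_conj; ring. Qed.

Lemma measurable_torus_cell : measurable cell.
Proof. by apply: measurableX => //; exact: measurableX. Qed.

Lemma trig3_orth q q' : innerL2 leb3 cell (trig3 q) (trig3 q') =
  ((2 * pi) ^+ 3 * (q == q')%:R)%:C%C.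
Proof.
have mp : measurable period by exact: measurable_itv.
rewrite /innerL2 (_ : (fun t => _) = (fun t : angles R =>
   chi (q.1.1 - q'.1.1) t.1.1 * chi (q.1.2 - q'.1.2) t.1.2 * chi (q.2 - q'.2) t.2)); last first.
  by apply/funext => t; exact: trig3_mul_conj.
rewrite (lebesgue3_Cintegral_prod mp mp mp (cint_chi _ _) (cint_chi _ _) (cint_chi _ _)).
rewrite !(Cintegral_expi R _).2 -!rmorphM /= !subr_eq0; congr (_%:C)%C.
move: q q' => [[a b] c] [[a' b'] c'] /=; rewrite !xpair_eqE.
by case: (a == a'); case: (b == b'); case: (c == c'); rewrite /= ?mulr0 ?mul0r ?mulr1 // exprS expr2 mulrA.
Qed.

Lemma cmeas_trig3 q : cmeas cell (trig3 q : angles R -> C).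
Proof.
have m : measurable_fun [set: angles R] (fun t : angles R =>
    q.1.1%:~R * t.1.1 + q.1.2%:~R * t.1.2 + q.2%:~R * t.2 : R).
  apply: measurable_funD; first apply: measurable_funD.
  - by apply: measurable_funM; [exact: measurable_cst|exact: (measurableT_comp measurable_fst measurable_fst)].
  - by apply: measurable_funM; [exact: measurable_cst|exact: (measurableT_comp measurable_snd measurable_fst)].
  - by apply: measurable_funM; [exact: measurable_cst|exact: measurable_snd].
split; apply: measurable_funTS => /=.
  exact: (measurableT_comp (continuous_measurable_fun (@continuous_cos R)) m).
exact: (measurableT_comp (continuous_measurable_fun (@continuous_sin R)) m).
Qed.

Lemma L2_trig3 q : L2 leb3 cell (trig3 q : angles R -> C).
Proof.
have [mr mi] := cmeas_trig3 q; split => //.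
have mp : measurable period by exact: measurable_itv.
have [ir _] := lebesgue3_cintegrable_prod mp mp mp (cint_chi R 0) (cint_chi R 0) (cint_chi R 0).
move/integrableP : ir => [_]; apply: le_lt_trans; rewrite le_eqVlt; apply/orP; left; apply/eqP.
apply: eq_integral => t _.
transitivity (`|complex.Re (chi 0 t.1.1 * chi 0 t.1.2 * chi 0 t.2 : C)|%:E); last by [].
by rewrite /chi !mul0r !expi0 !mulr1 sqmod_expi normr1.
Qed.

Lemma expi_int_pi (m : int) : expi (m%:~R * pi) = (-1) ^+ absz m :> C.
Proof.
have e1 : expi (pi : R) = -1.
  by rewrite /expi cospi sinpi; apply/eqP; rewrite eq_complex /= oppr0 !eqxx.
have e2 : expi (- pi : R) = -1.
  by rewrite /expi cosN sinN cospi sinpi oppr0; apply/eqP; rewrite eq_complex /= oppr0 !eqxx.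
case: m => n; first by rewrite -[_%:~R]/(n%:R) -expi_exp e1.
by rewrite NegzE mulrNz mulNr -mulrN -[_%:~R]/(n.+1%:R) -expi_exp e2.
Qed.

Lemma halfdNc n k l (c s : R) : halfd n k l (- c) s = (-1) ^+ absz (k + l) * halfd n k l c s.
Proof. by rewrite /halfd sqrrN (exprNn c); move: (jacobi _ _ _ _).[_] => J; ring. Qed.

(** Beyond [pi] the flip changes the sign of [cos (b / 2)], which produces [(-1) ^ (k + l)]; the
    shifts of the outer angles by [pi] and [- pi] produce the same sign and cancel it. Thus [halfd]
    is the right extension of the Wigner-d function. *)
Lemma basisD_cell (p : Jinf) (t : angles R) : 0 <= t.1.2 <= 2 * pi ->
  basisD p (euler t) = chi (- (\val p).1.2) t.1.1
   * (halfd_tilde (\val p).1.1 (- (\val p).1.2) (- (\val p).2) t.1.2)%:C%C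
   * chi (- (\val p).2) t.2.
Proof.
move=> /andP[b0 b1]; have [bp|bp] := leP t.1.2 pi; first by rewrite basisD_euler// b0.
have <- : euler (cell_flip pi (- pi) t) = euler t by apply: euler_flip; [left|right].
have bt : 0 <= (cell_flip pi (- pi) t).1.2 <= pi by rewrite /=; apply/andP; split; lra.
rewrite basisD_euler//= /halfd_tilde !opprK.
set n := (sval p).1.1; set k := (sval p).1.2; set l := (sval p).2.
have h : (2 * pi - t.1.2) / 2 = pi - t.1.2 / 2 :> R by field.
have c1 : cos (pi - t.1.2 / 2) = - cos (t.1.2 / 2) :> R by rewrite cosB cospi sinpi; ring.
have s1 : sin (pi - t.1.2 / 2) = sin (t.1.2 / 2) :> R by rewrite sinB cospi sinpi; ring.
rewrite h c1 s1 halfdNc /chi (mulrDr _ _ pi) (mulrDr _ _ (- pi)) (expiD (_ * t.1.1)) (expiD (_ * t.2)).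
have e : expi ((- k)%:~R * pi) * expi ((- l)%:~R * - pi) * ((-1) ^+ absz (k + l))%:C%C = 1 :> C.
  rewrite mulrN -mulNr -rmorphN /= opprK -expiD -mulrDl -rmorphD /= expi_int_pi.
  rewrite rmorphXn rmorphN1 -exprD.
  have [j jE] := absz_add_parity (- k + l) (k + l).
  have -> : (absz (- k + l)%R + absz (k + l)%R = 2 * (absz l + j))%N.
    by rewrite jE (_ : - k + l + (k + l) = 2 * l); [lia|ring].
  by rewrite exprM sqrrN expr1n expr1n.
move: (halfd _ _ _ _ _) e => w; set x1 := expi (_ * pi); set x2 := expi (_ * - pi) => e.
set sg := (-1) ^+ _ in e *.
rewrite -[RHS]mul1r -e !rmorphM /=. ring.
Qed.

Lemma basisD_trig (p : Jinf) N (t : angles R) : cell t -> ((\val p).1.1 <= N)%N ->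
  let k := - (\val p).1.2 in let l := - (\val p).2 in
  basisD p (euler t) = \sum_(j <- freqs N)
    ('i%C ^ (k - l) * (dfsker R (\val p).1.1 k j l)%:C%C) * trig3 (k, j, l) t.
Proof.
move=> [[_ +] _] nN k l; rewrite /= in_itv /= => /andP[b0 b1].
have /andP[kn ln] := valP p.
rewrite basisD_cell; last by rewrite b0 ltW.
rewrite (halfd_tilde_freqs _ nN) ?abszN// -/k -/l mulr_sumr mulr_sumr mulr_suml.
by apply: eq_bigr => j _; rewrite trig3E /= /chi; ring.
Qed.

Lemma euler_periodic (F : SO3 R -> C) : periodic3 (DFS F).
Proof.
have per (x : R) : cos (x + 2 * pi) = cos x /\ sin (x + 2 * pi) = sin x.
  by rewrite mulr_natl cosD2pi sinD2pi.
have rz x : Rz (x + 2 * pi) = Rz x :> 'M[R]_3 by have [c s] := per x; rewrite /Rz c s.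
have ry x : Ry (x + 2 * pi) = Ry x :> 'M[R]_3 by have [c s] := per x; rewrite /Ry c s.
move=> a b c; rewrite /DFS /=.
by split; congr F; apply: val_inj; rewrite /= ?rz ?ry.
Qed.

End torus_basis.

(** * Truncated Fourier series and passage to the limit on the torus *)

Section truncation.
Variable R : realType.
Local Notation C := R[i].
Local Notation leb3 := (@lebesgue3 R).
Local Notation cell := (@torus_cell R).
Implicit Types (q : int * int * int) (fhat : Jinf -> C).

Definition box3 m : seq (int * int * int) :=
  [seq (x, l) | x <- [seq (k, j) | k <- freqs m, j <- freqs m], l <- freqs m].

(** The orders are negated to match the indices [(-k, -l)] read by the operator; triples violating
    [|k|, |l| <= n] are dropped by [insub] in [Jseq]. *)
Definition triples m : seq (nat * int * int) :=
  [seq (x, - l) | x <- [seq (n, - k) | n <- iota 0 m, k <- freqs m], l <- freqs m].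

Definition Jseq m : seq Jinf := pmap insub (triples m).

Definition trunc fhat m (A : SO3 R) : C := \sum_(p <- Jseq m) fhat p * basisD p A.

Lemma mem_pairs (S T : eqType) (u : seq S) (v : seq T) x y :
  ((x, y) \in [seq (a, b) | a <- u, b <- v]) = (x \in u) && (y \in v).
Proof.
apply/allpairsP/andP => [[[a b] /= [au bv [-> ->]]]//|[xu yv]].
by exists (x, y).
Qed.

Lemma uniq_box3 m : uniq (box3 m).
Proof.
apply: allpairs_uniq; [|exact: uniq_freqs|by move=> [? ?] [? ?] _ _ /= [-> ->]].
apply: allpairs_uniq; [exact: uniq_freqs|exact: uniq_freqs|by move=> [? ?] [? ?] _ _ /= [-> ->]].
Qed.

Lemma mem_box3 m k j l : ((k, j, l) \in box3 m) = [&& (absz k <= m)%N, (absz j <= m)%N & (absz l <= m)%N].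
Proof.
by rewrite !mem_pairs !mem_freqs andbA.
Qed.

Lemma uniq_Jseq m : uniq (Jseq m).
Proof.
apply: pmap_sub_uniq; apply: allpairs_uniq; [|exact: uniq_freqs|].
  apply: allpairs_uniq; [exact: iota_uniq|exact: uniq_freqs|].
  by move=> [? ?] [? ?] _ _ /= [-> /oppr_inj ->].
by move=> [? ?] [? ?] _ _ /= [-> /oppr_inj ->].
Qed.

Lemma mem_Jseq m (p : Jinf) : (p \in Jseq m) = ((\val p).1.1 < m)%N.
Proof.
rewrite mem_pmap_sub; case: p => [[[n k] l] /= knl]; have /andP[/= kn ln] := knl.
apply/idP/idP => [/allpairsP[[y l'] [ymem _ E]]|nm].
  move/allpairsP : ymem => [[n' k'] [nm _ yE]]; rewrite /= in E nm yE.
  by move: E nm; rewrite yE mem_iota => -[-> _ _] /andP[].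
apply/allpairsP; exists ((n, k), - l); split; last by rewrite /= opprK.
  apply/allpairsP; exists (n, - k); split; [by rewrite mem_iota|rewrite mem_freqs /= abszN; lia|by rewrite /= opprK].
by rewrite mem_freqs /= abszN; lia.
Qed.

Lemma truncE fhat m A : trunc fhat m A = \sum_(0 <= n < m) \sum_(k <- freqs m) \sum_(l <- freqs m)
  Defs.coef0 fhat n (- k) (- l) * wignerD n (- k) (- l) A.
Proof.
rewrite /trunc /Jseq.
transitivity (\sum_(x <- triples m) Defs.coef0 fhat x.1.1 x.1.2 x.2 * wignerD x.1.1 x.1.2 x.2 A).
  elim: (triples m) => [|[[n k] l] s IH]; first by rewrite !big_nil.
  rewrite big_cons -IH /= /Defs.coef0 /oapp; case: insubP => [p _ pE|_] /=.
    by rewrite big_cons /basisD pE.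
  by rewrite mul0r add0r.
rewrite /triples big_allpairs_dep big_allpairs_dep /index_iota subn0.
by [].
Qed.

Lemma DFS_partial_sum_out fhat q m : q \notin box3 m -> DFS_partial_sum fhat q m = 0.
Proof.
move: q => [[k j] l]; rewrite mem_box3 => h; rewrite DFS_partial_sumE big_nat big1// => n nm.
by rewrite dfsker_out ?mul0r//; lia.
Qed.

(** Expanding each Wigner-D function and exchanging sums collects the partial sums of the operator.
    Any [F] containing the box is allowed, since these partial sums vanish outside it. *)
Lemma trunc_trig fhat m (F : seq (int * int * int)) (t : angles R) : cell t -> uniq F ->
  {subset box3 m <= F} ->
  trunc fhat m (euler t) = \sum_(q <- F) ('i%C ^ (q.1.1 - q.2) * DFS_partial_sum fhat q m) * trig3 q t.
Proof.
move=> ct uF boxF; transitivity (\sum_(q <- box3 m) ('i%C ^ (q.1.1 - q.2) * DFS_partial_sum fhat q m) * trig3 q t); last first.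
  rewrite [RHS](bigID (mem (box3 m))) /= [X in _ = _ + X]big1 ?addr0 => [|q qn]; last first.
    by rewrite (DFS_partial_sum_out fhat qn) mulr0 mul0r.
  rewrite -[RHS]big_filter; apply: perm_big; apply: uniq_perm; [exact: uniq_box3|exact: filter_uniq|].
  by move=> q; rewrite mem_filter /=; case: (boolP (q \in box3 m)) => // /boxF ->.
rewrite truncE /box3 big_allpairs_dep big_allpairs_dep /=.
transitivity (\sum_(0 <= n < m) \sum_(k <- freqs m) \sum_(j <- freqs m) \sum_(l <- freqs m)
   ('i%C ^ (k - l) * ((dfsker R n k j l)%:C%C * Defs.coef0 fhat n (- k) (- l))) * trig3 (k, j, l) t).
  rewrite big_nat [RHS]big_nat; apply: eq_bigr => n /andP[_ nm].
  apply: eq_bigr => k _; rewrite [RHS]exchange_big /=; apply: eq_bigr => l _; rewrite /Defs.coef0 /oapp.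
  case: insubP => [p _ pE|_]; last first.
    by rewrite mul0r big1// => j _; rewrite !mulr0 mul0r.
  have := basisD_trig (N := m) ct (p := p); rewrite pE /= !opprK => /(_ (ltnW nm)).
  rewrite /basisD pE /= => ->; rewrite mulr_sumr; apply: eq_bigr => j _; ring.
rewrite exchange_big /=; apply: eq_bigr => k _; rewrite exchange_big /=; apply: eq_bigr => j _.
rewrite exchange_big /=; apply: eq_bigr => l _.
transitivity (('i%C ^ (k - l) * DFS_partial_sum fhat (k, j, l) m) * trig3 (k, j, l) t); last by [].
rewrite DFS_partial_sumE mulr_sumr mulr_suml; apply: eq_bigr => n _; ring.
Qed.

Lemma cmeas_trunc fhat m : cmeas setT (trunc fhat m).
Proof. by apply: cmeas_sum => p; apply: cmeasZ; exact: cmeas_basisD. Qed.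

Lemma trunc_htail fhat m m' A : (m <= m')%N ->
  trunc (htail m fhat) m' A = trunc fhat m' A - trunc fhat m A.
Proof.
move=> mm'; apply/eqP; rewrite eq_sym subr_eq eq_sym; apply/eqP.
have -> : trunc fhat m A = \sum_(p <- Jseq m') (if (m <= (\val p).1.1)%N then 0 else fhat p * basisD p A).
  rewrite (eq_bigr (fun p => if ((\val p).1.1 < m)%N then fhat p * basisD p A else 0)); last first.
    by move=> p _; rewrite ltnNge; case: ifP.
  rewrite -big_mkcond -[RHS]big_filter; apply: perm_big; apply: uniq_perm; [exact: uniq_Jseq|by apply: filter_uniq; exact: uniq_Jseq|].
  by move=> p; rewrite mem_filter !mem_Jseq; case: (ltnP _ m) => // pm; rewrite (leq_trans pm).
rewrite /trunc -big_split /=; apply: eq_bigr => p _; rewrite /htail.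
by case: ifP => _; rewrite ?addr0 // mul0r add0r.
Qed.

Lemma trunc_cvg (f : SO3 R -> C) (e : R) : L2_SO3 f -> 0 < e -> exists m0, forall m, (m0 <= m)%N ->
  (sqnormL2 (@haar R) setT (fun A => f A - trunc (harmonic_coef f) m A)%R <= e%:E)%E.
Proof.
move=> Lf e0.
have [|F0 hF0] := totally_cvg0_le _ (harmonic_coef_sumL2 Lf) e0.
  by move=> F; exact: sqnormL2_ge0.
exists (\max_(p <- F0) (\val p).1.1).+1 => m mm.
apply: le_trans (hF0 F0 (fsubset_refl _)).
rewrite !sqnormL2_partial ?fset_uniq ?uniq_Jseq// lee_fin.
rewrite !big1 ?addr0; try by move=> p _; rewrite subrr sqmod0.
rewrite /bessel_gap lerD2l lerN2; apply: ler_sum_uniq; [exact: fset_uniq|exact: uniq_Jseq|by move=> p; exact: sqmod_ge0|].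
move=> p pF; rewrite mem_Jseq => /negP h; exfalso; apply: h; apply: leq_trans mm; rewrite ltnS.
by rewrite (big_rem p pF) /= leq_maxl.
Qed.

Variable s : R.
Hypothesis s_gt : 2^-1 < s.
Local Notation K := (dfs_const s).
Local Notation V := ((2 * pi) ^+ 3 : R).

Let V0 : 0 <= V.
Proof. by rewrite exprn_ge0// mulr_ge0// pi_ge0. Qed.

Lemma eq_sqnormL2_cell (g h : angles R -> C) : (forall t, cell t -> g t = h t) ->
  sqnormL2 leb3 cell g = sqnormL2 leb3 cell h.
Proof. by move=> gh; apply: eq_integral => t; rewrite inE => /gh ->. Qed.

Lemma trunc_cell_le fhat m : hs s fhat ->
  (sqnormL2 leb3 cell (fun t => trunc fhat m (euler t)) <= (V * (K * fine (sqnorm_hs s fhat)))%:E)%E.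
Proof.
move=> hf; rewrite (eq_sqnormL2_cell (fun t ct => trunc_trig fhat ct (uniq_box3 m) (fun _ => id))).
rewrite (pythagoras0 (@measurable_torus_cell R) (@L2_trig3 R) (@trig3_orth R)) ?uniq_box3// lee_fin ler_wpM2l//.
under eq_bigr do rewrite sqmodM sqr_i_expz mul1r.
by apply: DFS_partial_sum_bound => //; exact: uniq_box3.
Qed.

(** The dense approximants required by [sqnormL2_euler_bound] are longer truncations of the same
    tail, whose norms on the whole cell are bounded uniformly by [trunc_cell_le]. *)
Lemma DFS_trunc_bound (f : SO3 R -> C) m : Hs s f ->
  (sqnormL2 leb3 cell (fun t => DFS f t - trunc (harmonic_coef f) m (euler t))%R <=
   (2 * (V * (K * fine (sqnorm_hs s (htail m (harmonic_coef f))))))%:E)%E.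
Proof.
move=> [Lf hf]; have mf : cmeas setT f by exact: L2_cmeas Lf.
apply: (@sqnormL2_euler_bound R (fun A => f A - trunc (harmonic_coef f) m A)).
- by apply: cmeasB => //; exact: cmeas_trunc.
- by rewrite mulr_ge0// mulr_ge0 ?dfs_const_ge0 ?fine_hs_ge0.
move=> e e0; have [m0 hm0] := trunc_cvg Lf e0.
pose m' := maxn m m0; exists (trunc (htail m (harmonic_coef f)) m'); split.
- exact: cmeas_trunc.
- have := hm0 m' (leq_maxr _ _); congr (_ <= _)%E; congr sqnormL2.
  by apply/funext => A; rewrite trunc_htail ?leq_maxl//; ring.
- by apply: trunc_cell_le; exact: hs_htail.
Qed.

Lemma DFS_L2 (f : SO3 R -> C) : Hs s f -> L2_T3 (DFS f).
Proof.
move=> Hf; split; first exact: euler_periodic.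
(* The truncation of length 0 is an empty sum, so the tail bound at [m = 0] bounds the function
   itself. *)
have [Lf _] := Hf; have [mr mi] := cmeas_euler cell (L2_cmeas Lf).
split => //; have := DFS_trunc_bound 0 Hf.
have -> : (fun t => DFS f t - trunc (harmonic_coef f) 0 (euler t)) = DFS f.
  by apply/funext => t; rewrite truncE big_geq// subr0.
by move=> /le_lt_trans; apply; exact: ltry.
Qed.

Lemma DFS_fourier (f : SO3 R -> C) : Hs s f -> fourier_T3 (DFS_hat (harmonic_coef f)) (DFS f).
Proof.
move=> Hf; have [Lf hf] := Hf; split; [exact: (DFS_hat_l2_bound s_gt hf).1|exact: DFS_L2|].
apply: totally_cvg0 => [F|e e0]; first exact: sqnormL2_ge0.
have K0 : 0 <= K by exact: dfs_const_ge0.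
have c0 : 0 < 8 * (V * K) + 1 by rewrite ltr_wpDl// mulr_ge0// mulr_ge0.
have [|m0 /(_ m0 (leqnn _)) tail] := htail_small (e := e / (8 * (V * K) + 1)) hf.
  by rewrite divr_gt0.
exists [fset q in box3 m0]%fset => F boxF.
have {}boxF : {subset box3 m0 <= F}.
  by move=> q qb; apply: (fsubsetP boxF); rewrite in_fset.
set T := fine _ in tail.
have b1 := DFS_trunc_bound m0 Hf; rewrite -/T in b1.
have mD : cmeas cell (DFS f) by apply: cmeas_euler; exact: L2_cmeas Lf.
have mt : cmeas cell (fun t => trunc (harmonic_coef f) m0 (euler t)) by apply: cmeas_euler; exact: cmeas_trunc.
have mS : cmeas cell (fun t : angles R => \sum_(q <- F) DFS_hat (harmonic_coef f) q * trig3 q t).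
  by apply: cmeas_sum => q; apply: cmeasZ; exact: cmeas_trig3.
(* Since [F] contains the box, the difference is the trigonometric polynomial over [F] whose
   coefficients are, up to sign, the image of the tail; [DFS_hat_sum_le] bounds it independently of
   [F]. *)
have b2 : (sqnormL2 leb3 cell (fun t => trunc (harmonic_coef f) m0 (euler t) -
    \sum_(q <- F) DFS_hat (harmonic_coef f) q * trig3 q t)%R <= (V * (2 * K * T))%:E)%E.
  rewrite (@eq_sqnormL2_cell _ (fun t => \sum_(q <- F) - DFS_hat (htail m0 (harmonic_coef f)) q * trig3 q t)); last first.
    move=> t ct; rewrite (trunc_trig _ ct (fset_uniq F) boxF) -sumrB; apply: eq_bigr => -[[k j] l] _.
    by rewrite (DFS_hat_htail s_gt)//= -mulrBl opprB.
  rewrite (pythagoras0 (@measurable_torus_cell R) (@L2_trig3 R) (@trig3_orth R)) ?fset_uniq// lee_fin ler_wpM2l//.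
  under eq_bigr do rewrite sqmodN.
  by apply: DFS_hat_sum_le => //; [exact: hs_htail|exact: fset_uniq].
have -> : (fun t => DFS f t - \sum_(q <- F) DFS_hat (harmonic_coef f) q * trig3 q t) =
  (fun t => (DFS f t - trunc (harmonic_coef f) m0 (euler t)) + (trunc (harmonic_coef f) m0 (euler t)
    - \sum_(q <- F) DFS_hat (harmonic_coef f) q * trig3 q t)).
  by apply/funext => t; rewrite addrA subrK.
apply: le_trans (sqnormL2D_le leb3 (@measurable_torus_cell R) (cmeasB mD mt) (cmeasB mt mS)) _.
(* Both errors are [2 * V * K * T], and the quadratic triangle inequality doubles each; this is the
   origin of the 8 in the choice of [m0]. *)
apply: (@le_trans _ _ (2%:E * (2 * (V * (K * T)))%:E + 2%:E * (V * (2 * K * T))%:E)%E).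
  by apply: leeD; apply: lee_wpmul2l => //; rewrite lee_fin.
rewrite -!EFinM -EFinD lee_fin.
have -> : 2 * (2 * (V * (K * T))) + 2 * (V * (2 * K * T)) = 8 * (V * K) * T by ring.
move: tail; rewrite ler_pdivlMr// => tail; apply: le_trans tail.
rewrite mulrC ler_wpM2l ?fine_hs_ge0// lerDl//.
Qed.

End truncation.

Theorem corollary3p10 (R : realType) (s : R) (s_gt : 3%:R / 4%:R < s) :
  (* the series defining the matrix operator converge on h^s *)
  (forall fhat : Jinf -> R[i], hs s fhat ->
     forall q : int * int * int, cvgn (DFS_partial_sum fhat q)) /\
  (* it is linear *)
  (forall (a : R[i]) (fhat ghat : Jinf -> R[i]), hs s fhat -> hs s ghat ->
     forall q : int * int * int,
       DFS_hat (fun p => a * fhat p + ghat p) q =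
       a * DFS_hat fhat q + DFS_hat ghat q) /\
  (* and bounded from h^s to l_2 *)
  (exists C : R, forall fhat : Jinf -> R[i], hs s fhat ->
     l2 (DFS_hat fhat) /\
     (sqnorm_l2 (DFS_hat fhat) <= (C ^+ 2)%:E * sqnorm_hs s fhat)%E) /\
  (* the DFS operator maps H^s(SO(3)) into L^2(T^3) *)
  (forall f : SO3 R -> R[i], Hs s f -> L2_T3 (DFS f)) /\
  (* and factors through the Fourier transforms; fhat is the preimage of f *)
  (forall f : SO3 R -> R[i], Hs s f ->
     exists fhat : Jinf -> R[i],
       [/\ forall ghat : Jinf -> R[i], fourier_SO3 ghat f <-> ghat = fhat,
           hs s fhat &
           fourier_T3 (DFS_hat fhat) (DFS f)]).
Proof.
have s_half : 2^-1 < s by apply: lt_trans s_gt; lra.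
split; first by move=> fhat hf q; exact: (DFS_partial_sum_cvg s_half hf).
split; first by move=> a fhat ghat hf hg q; exact: (DFS_hat_linear s_half).
split.
  exists (Num.sqrt (2 * dfs_const s)) => fhat hf.
  by have [h1 h2] := DFS_hat_l2_bound s_half hf.
split; first by move=> f Hf; exact: (DFS_L2 s_half Hf).
move=> f Hf; exists (harmonic_coef f); split.
- by move=> ghat; apply: fourier_SO3P; exact: Hf.1.
- exact: Hf.2.
- exact: (DFS_fourier s_half Hf).
Qed.
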